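(* Let $T>0$, $A\in\mathbb{R}^{d\times d}$ and $\Sigma\in\mathbb{R}^{d\times m}$, and let $(B_t)_{t\in[0,T)}$ be an $m$-dimensional standard Wiener process. Suppose that $\Sigma$ has full rank $d$ (and consequently $m\ge d$). If every eigenvalue of $A$ has strictly positive real part, i.e. $\operatorname{ReSpec}(A)\subseteq(0,\infty)$, then the process $(\widehat X_t)_{t\in[0,T]}$ defined by $$\widehat X_t:=\begin{cases}\displaystyle\int_0^t\Big(\frac{T-t}{T-s}\Big)^A\Sigma\,\mathrm{d}B_s & \text{if } t\in[0,T),\\ 0 & \text{if } t=T,\end{cases}$$ is a centered Gauss process with almost surely continuous sample paths (on $[0,T]$).
   Context: For $r>0$ and a real square matrix $A$, $r^A:=\mathrm{e}^{A\log r}=\sum_{k=0}^\infty\frac{(\log r)^k}{k!}A^k$. $\operatorname{ReSpec}(A):=\{\operatorname{Re}\lambda:\lambda\in\operatorname{Spec}(A)\}$, where $\operatorname{Spec}(A)$ is the set of (complex) eigenvalues of $A$. The Wiener process $(B_t)_{t\in[0,T)}$ is defined on a filtered probability space $(\Omega,\mathcal{F},(\mathcal{F}_t)_{t\in[0,T)},P)$, where $(\mathcal{F}_t)$ is the completion of the canonical filtration of $(B_t)$. The process $X_t=\int_0^t\big(\frac{T-t}{T-s}\big)^A\Sigma\,\mathrm{d}B_s=(T-t)^A\int_0^t(T-s)^{-A}\Sigma\,\mathrm{d}B_s$, $t\in[0,T)$ (taken in its continuous version on $[0,T)$), is the unique strong solution of the SDE $\mathrm{d}X_t=-\frac{1}{T-t}AX_t\,\mathrm{d}t+\Sigma\,\mathrm{d}B_t$,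 $t\in[0,T)$, with $X_0=0\in\mathbb{R}^d$. *)

(* Defs.v *)
From HB Require Import structures.
From mathcomp Require Import all_boot all_order all_algebra.
From mathcomp Require Import complex.
From mathcomp Require Import all_classical all_reals all_analysis.

Set Implicit Arguments.
Unset Strict Implicit.
Unset Printing Implicit Defensive.
Import Order.TTheory GRing.Theory Num.Theory.
Import numFieldNormedType.Exports.
Local Open Scope classical_set_scope.
Local Open Scope ring_scope.

Section matrices.
Context {R : realType}.

(* The series converges in the topology of matrices, i.e. entrywise. *)
Definition mxexp d (A : 'M[R]_d) : 'M[R]_d :=
  limn (series (fun k : nat => (k`!%:R)^-1 *: A ^+ k)).

Definition mxpow d (r : R) (A : 'M[R]_d) : 'M[R]_d := mxexp (ln r *: A).

Definition Spec d (A : 'M[R]_d) : set R[i] :=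
  [set l | eigenvalue (map_mx (real_complex R) A) l].

Definition ReSpec d (A : 'M[R]_d) : set R := @complex.Re R @` Spec A.

(* Squared Frobenius norm. *)
Definition sqnorm m n (M : 'M[R]_(m, n)) : R := \sum_i \sum_j M i j ^+ 2.

End matrices.

Section gaussian.
Context {R : realType} {disp : measure_display} {Omega : measurableType disp}.
Variable P : probability Omega R.

(* The library's [normal_prob mu 0] is a junk value (the uniform law on
   [0, 1]), hence the separate treatment of the degenerate case. *)
Definition gauss_law (mu sigma : R) (U : set R) : \bar R :=
  if sigma == 0 then dirac mu U else normal_prob mu sigma U.

Definition is_gaussian (Z : Omega -> R) : Prop :=
  measurable_fun [set: Omega] Z /\
  exists mu sigma : R, forall U : set R, measurable U ->
    P (Z @^-1` U) = gauss_law mu sigma U.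

(* The finite-dimensional distributions are (possibly degenerate) multivariate
   normal: every linear combination of the coordinates of
   (X_{t_0}, ..., X_{t_{n-1}}) is univariate normal. *)
Definition gaussian_process d (D : set R) (X : R -> Omega -> 'cV[R]_d) : Prop :=
  forall (n : nat) (t : 'I_n -> R) (c : 'I_n -> 'rV[R]_d),
    (forall k, D (t k)) ->
    is_gaussian (fun w => \sum_(k < n) (c k *m X (t k) w) ord0 ord0).

Definition centered_process d (D : set R) (X : R -> Omega -> 'cV[R]_d) : Prop :=
  forall t, D t -> forall i, ('E_P[fun w => X t w i ord0] = 0)%E.

End gaussian.

Section filtrations.
Context {R : realType} {disp : measure_display} {Omega : measurableType disp}.
Variable P : probability Omega R.
Implicit Types F : R -> set (set Omega).

Definition measurable_wrt (G : set (set Omega)) (Z : Omega -> R) : Prop :=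
  forall U : set R, measurable U -> G (Z @^-1` U).

Definition is_filtration (T : R) F : Prop :=
  [/\ forall t, 0 <= t < T -> sigma_algebra [set: Omega] (F t),
      forall t, 0 <= t < T -> F t `<=` measurable
    & forall s t, 0 <= s -> s <= t -> t < T -> F s `<=` F t].

Definition sigma_generated_by m (Z : Omega -> 'cV[R]_m) : set (set Omega) :=
  <<s [set E | exists (i : 'I_m) (U : set R),
         measurable U /\ E = [set w | U (Z w i ord0)]] >>.

Definition independent_systems (G H : set (set Omega)) : Prop :=
  forall E E', G E -> H E' -> P (E `&` E') = (P E * P E')%E.

(* Canonical filtration of B, augmented by the null sets of the ambient
   sigma-algebra; these are all the P-negligible sets when the underlying
   probability space is complete. *)
Definition completed_canonical_filtration m (B : R -> Omega -> 'cV[R]_m) :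
    R -> set (set Omega) := fun t =>
  <<s [set E | exists (s : R) (i : 'I_m) (U : set R),
         [/\ 0 <= s <= t, measurable U & E = [set w | U (B s w i ord0)]]]
      `|` [set N | measurable N /\ P N = 0%E] >>.

(* m-dimensional standard Wiener process on the time interval [0, T[ with
   respect to the filtration F. The fourth clause says that the increment
   B_t - B_s has law N(0, (t - s) I_m). *)
Definition is_wiener_process m (T : R) F (B : R -> Omega -> 'cV[R]_m) : Prop :=
  is_filtration T F /\
  [/\ forall t, 0 <= t < T -> forall i,
        measurable_wrt (F t) (fun w => B t w i ord0),
      {ae P, forall w, B 0 w = 0},
      forall s t, 0 <= s -> s < t -> t < T ->
        independent_systems (F s) (sigma_generated_by (fun w => B t w - B s w)),
      forall s t, 0 <= s -> s < t -> t < T ->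
        forall U : 'I_m -> set R, (forall i, measurable (U i)) ->
        P [set w | forall i, U i ((B t w - B s w) i ord0)] =
        (\prod_(i < m) normal_prob 0 (Num.sqrt (t - s)) (U i))%E
    & {ae P, forall w, {within `[0, T[, continuous (B^~ w)}}].

End filtrations.

Section ito_integral.
Context {R : realType} {disp : measure_display} {Omega : measurableType disp}.
Variable P : probability Omega R.
Variable F : R -> set (set Omega).
Variables (d m : nat) (B : R -> Omega -> 'cV[R]_m).

(* xi k is the value of the simple process on ]tau k, tau k.+1], k < len. *)
Record step_process := StepProcess {
  len : nat;
  tau : nat -> R;
  xi : nat -> Omega -> 'M[R]_(d, m) }.

Definition is_simple_process (t : R) (S : step_process) : Prop :=
  [/\ 0 <= tau S 0, tau S (len S) <= t,
      forall k, (k < len S)%N -> tau S k <= tau S k.+1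
    & forall k, (k < len S)%N -> forall i j,
        measurable_wrt (F (tau S k)) (fun w => xi S k w i j) /\
        exists C : R, forall w, `|xi S k w i j| <= C].

Definition step_fun (S : step_process) (s : R) (w : Omega) : 'M[R]_(d, m) :=
  \sum_(k < len S) \1_(`]tau S k, tau S k.+1]) s *: xi S k w.

Definition step_integral (S : step_process) (w : Omega) : 'cV[R]_d :=
  \sum_(k < len S) xi S k w *m (B (tau S k.+1) w - B (tau S k) w).

(* [is_ito_integral t H Y]: the random vector Y is (a version of) the Ito
   integral of H with respect to B over [0, t], i.e. H is measurable, adapted
   and the limit in L^2(ds x P) of a sequence of simple processes whose
   integrals converge to Y in L^2(P). *)
Definition is_ito_integral (t : R) (H : R -> Omega -> 'M[R]_(d, m))
    (Y : Omega -> 'cV[R]_d) : Prop :=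
  [/\ forall i j, measurable_fun (`[0, t]%classic `*` [set: Omega])
        (fun p : R * Omega => H p.1 p.2 i j),
      forall s, 0 <= s <= t -> forall i j,
        measurable_wrt (F s) (fun w => H s w i j),
      forall i, measurable_fun [set: Omega] (fun w => Y w i ord0)
    & exists S : nat -> step_process,
      [/\ forall n, is_simple_process t (S n),
          (fun n => \int[P]_w \int[lebesgue_measure]_(s in `[0%R, t])
             (sqnorm (step_fun (S n) s w - H s w))%:E)%E @ \oo --> 0%E
        & (fun n => \int[P]_w
             (sqnorm (step_integral (S n) w - Y w))%:E)%E @ \oo --> 0%E]].

End ito_integral.

(* Main.v *)
Require Import Defs.
From HB Require Import structures.
From mathcomp Require Import all_boot all_order all_algebra.
From mathcomp Require Import complex.
From mathcomp Require Import all_classical all_reals all_analysis.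
From mathcomp Require Import measurable_realfun ring lra.

(* Removing the factors of the characteristic polynomial of A one at a time
   (Cayley-Hamilton) shows that, for some mu > 0, the entries of r^A Sigma are
   O(r^mu) on ]0, 1] and their increments are dominated by those of a multiple
   of r^mu.  Hence X_t is the L^2-limit, at rate 1/n, of the Riemann sums
     R_n(t) = sum_k ((T - t) / (T - s_k))^A Sigma (B(s_{k+1}) - B(s_k))
   over the mesh s_k = k T / (n + 1).  As the mesh does not depend on t, linear
   combinations of the R_n(t) are linear in the Wiener increments, and limits in
   L^2 of centered Gaussian variables are centered Gaussian.

   For the continuity at T: by Kolmogorov's inequality B is almost surely Cauchy
   at T.  Writing rho(s) = ((T - t) / (T - s))^mu, summation by parts bounds
   |R_n(t)|, uniformly in n, by a multiple of
     rho(u) sup |B| + osc_[u, T[ B   for every u <= t,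
   which is small when u and then t are close to T.  The rate 1/n yields, for
   each rational t, that almost surely X_t is a limit point of the R_n(t), so the
   same bound holds for X_t, and by path continuity for all t < T. *)

Set Implicit Arguments.
Unset Strict Implicit.
Unset Printing Implicit Defensive.
Import Order.TTheory GRing.Theory Num.Theory.
Import numFieldNormedType.Exports.
Local Open Scope classical_set_scope.
Local Open Scope ring_scope.

(** * Decay of the matrix power *)

Section matrix_exponential.
Context {R : realType}.

(** The data on [X] are given one t at a time: X_t is some L^2-limit of simple integrals, with a
    null set that depends on t. Nothing uniform in t can be read off it, which is why pathwise
    estimates are made on sums explicit in B. The process B itself lives on [0, T[ only, so its
    behaviour at T has to be produced. The kernel enters through a single monotone weight. Bounding
    its increments by those of a monotone function makes sums of such bounds telescope; this one
    device yields both the L^2 rate, without regularity of the kernel in s, and the summation by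
    parts. The spectral hypothesis is spent on the positivity of the exponent mu, which makes the
    weight vanish at 0. The matrix A is real but the factors of its characteristic polynomial are
    complex: real and imaginary parts are followed together, and their coupling is a rotation that
    cancels in the sum of squares. All second moments carry the factor [gauss_m2], since every
    estimate tolerates a constant. *)

Lemma mx_cvg_entries m n (f : nat -> 'M[R]_(m, n)) (l : 'M[R]_(m, n)) :
  (forall i j, (fun k => f k i j) @ \oo --> l i j) -> f @ \oo --> l.
Proof.
move=> fl; apply/cvg_ballP => e e0; near=> k; split => //; near: k.
apply: filter_forall => i; apply: filter_forall => j.
by move/cvg_ballP : (fl i j); exact.
Unshelve. all: by end_near. Qed.

(* [mx_series N A i j] are the coefficients of the entire function
   x |-> (N e^{xA})_{ij}. *)
Definition mx_series d (N A : 'M[R]_d) i j (k : nat) : R :=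
  (k`!%:R)^-1 * (N *m A ^+ k) i j.

Definition mx_flow d (N A : 'M[R]_d) i j (x : R) : R :=
  limn (pseries (mx_series N A i j) x).

Lemma norm_entry_le_sum m n (A : 'M[R]_(m, n)) i j :
  `|A i j| <= \sum_i \sum_j `|A i j|.
Proof.
rewrite (bigD1 i)//= (bigD1 j)//= -addrA lerDl addr_ge0 ?sumr_ge0// => *.
exact: sumr_ge0.
Qed.

Lemma norm_mulmx_entry_le m n p (A : 'M[R]_(m, n)) (B : 'M[R]_(n, p)) b i j :
  (forall i j, `|B i j| <= b) ->
  `|(A *m B) i j| <= (\sum_i \sum_j `|A i j|) * b.
Proof.
move=> Bb; rewrite mxE (le_trans (ler_norm_sum _ _ _))//.
apply: (@le_trans _ _ ((\sum_j `|A i j|) * b)).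
  rewrite mulr_suml; apply: ler_sum => k _.
  by rewrite normrM ler_wpM2l.
(* For n = 0 the bound says nothing about the sign of b, but both sides are zero. *)
have [j0 _|n0] := pickP (@predT 'I_n); last first.
  rewrite !big1 ?mul0r// => k _; last by have := n0 k.
  by rewrite big1// => l; have := n0 l.
have b0 : 0 <= b by rewrite (le_trans _ (Bb j0 j)).
rewrite ler_wpM2r// [leRHS](bigD1 i)//= lerDl sumr_ge0// => *.
exact: sumr_ge0.
Qed.

Lemma norm_mx_exp_entry_le d (A : 'M[R]_d) k i j :
  `|(A ^+ k) i j| <= (\sum_i \sum_j `|A i j|) ^+ k.
Proof.
elim: k i j => [|k IH] i j.
  by rewrite !expr0 !mxE; case: eqP => _; rewrite ?normr1 ?normr0.
by rewrite !exprS norm_mulmx_entry_le.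
Qed.

Lemma is_cvg_mx_series d (N A : 'M[R]_d) i j x :
  cvgn (pseries (mx_series N A i j) x).
Proof.
pose a := \sum_i \sum_j `|A i j|; pose b := \sum_i \sum_j `|N i j|.
apply: (@normed_cvg _ R^o).
apply: (@series_le_cvg _ _ (fun k => b * exp_coeff (a * `|x|) k)) => //.
- by move=> k /=; exact: normr_ge0.
- move=> k /=; rewrite /exp_coeff mulr_ge0 ?divr_ge0 ?exprn_ge0 ?mulr_ge0//;
    by apply: sumr_ge0 => *; exact: sumr_ge0.
- move=> k /=; rewrite /mx_series !normrM normrX ger0_norm ?invr_ge0//.
  have := @norm_mulmx_entry_le _ _ _ N _ _ i j (norm_mx_exp_entry_le A k).
  rewrite -/a -/b /exp_coeff/= exprMn => Nk.
  rewrite (_ : b * _ = (k`!%:R)^-1 * (b * a ^+ k) * `|x| ^+ k); last by ring.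
  by rewrite ler_wpM2r ?exprn_ge0// ler_wpM2l ?invr_ge0.
- have := @is_cvg_seriesZ R^o (exp_coeff (a * `|x|)) b.
  by apply; exact: is_cvg_series_exp_coeff.
Qed.

(** The derivative of N e^{xA} is (N A) e^{xA}: this is why the flow keeps the left factor N as a
    parameter. *)
Lemma pseries_diffs_mx_series d (N A : 'M[R]_d) i j :
  pseries_diffs (mx_series N A i j) = mx_series (N *m A) A i j.
Proof.
apply/funext => k; rewrite /pseries_diffs /mx_series factS natrM invfM mulrA.
by rewrite mulVKf ?pnatr_eq0// exprS -mulmxA.
Qed.

Lemma is_derive_mx_flow d (N A : 'M[R]_d) i j x :
  is_derive x (1 : R) (mx_flow N A i j) (mx_flow (N *m A) A i j x).
Proof.
rewrite /mx_flow -pseries_diffs_mx_series.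
(* Termwise differentiation at x asks for convergence at a point of larger modulus; these series
   converge everywhere. *)
apply: (@pseries_snd_diffs _ _ (`|x| + 1)); rewrite ?pseries_diffs_mx_series;
  do ?exact: is_cvg_mx_series.
by rewrite [ltRHS]ger0_norm ?addr_ge0// ltrDl.
Qed.

Lemma mx_flowD d (N M A : 'M[R]_d) i j x :
  mx_flow (N + M) A i j x = mx_flow N A i j x + mx_flow M A i j x.
Proof.
rewrite /mx_flow -lim_seriesD; do ?exact: is_cvg_mx_series.
congr (limn (series _)); apply/funext => k.
by rewrite /GRing.add/= /mx_series mulmxDl mxE mulrDr mulrDl.
Qed.

Lemma mx_flowZ d (N A : 'M[R]_d) a i j x :
  mx_flow (a *: N) A i j x = a * mx_flow N A i j x.
Proof.
rewrite /mx_flow -[RHS]lim_seriesZ; last exact: is_cvg_mx_series.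
congr (limn (series _)); apply/funext => k.
by rewrite /GRing.scale/= /mx_series -scalemxAl mxE mulrCA -mulrA.
Qed.

Lemma mx_flow0 d (A : 'M[R]_d) i j x : mx_flow 0 A i j x = 0.
Proof. by rewrite -[X in mx_flow X](scale0r 0) mx_flowZ mul0r. Qed.

Lemma mx_powerZ d (A : 'M[R]_d) (x : R) k : (x *: A) ^+ k = x ^+ k *: A ^+ k.
Proof.
elim: k => [|k IH]; first by rewrite !expr0 scale1r.
by rewrite !exprS IH -[LHS]scalemxAl -[in LHS]scalemxAr scalerA.
Qed.

Lemma mxexpE d (A : 'M[R]_d) i j x : mxexp (x *: A) i j = mx_flow 1 A i j x.
Proof.
suff -> : mxexp (x *: A) = \matrix_(i, j) mx_flow 1 A i j x by rewrite mxE.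
apply: cvg_lim; first exact: norm_hausdorff.
apply: mx_cvg_entries => k l; rewrite mxE.
have -> : (fun n => series (fun k => (k`!%:R)^-1 *: (x *: A) ^+ k) n k l) =
    pseries (mx_series 1 A k l) x.
  apply/funext => n; rewrite /pseries/series/= summxE.
  apply: eq_bigr => r _.
  by rewrite mx_powerZ /mx_series mul1mx !mxE [x ^+ r * _]mulrC mulrA.
exact: is_cvg_mx_series.
Qed.

(** Energy estimate: in u = g1^2 + g2^2 the rotation terms in b cancel, and Young's inequality
    absorbs the forcing, giving u' <= - (a + mu) u + (h1^2 + h2^2) / (a - mu). *)
Lemma decay_ode (g1 g2 h1 h2 : R -> R) (a b mu C : R) : mu < a ->
  (forall x, is_derive x (1 : R) g1 (- (a * g1 x - b * g2 x) - h1 x)) ->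
  (forall x, is_derive x (1 : R) g2 (- (a * g2 x + b * g1 x) - h2 x)) ->
  (forall x, 0 <= x -> `|h1 x| <= C * expR (- mu * x)) ->
  (forall x, 0 <= x -> `|h2 x| <= C * expR (- mu * x)) ->
  exists K, forall x, 0 <= x ->
    `|g1 x| <= K * expR (- mu * x) /\ `|g2 x| <= K * expR (- mu * x).
Proof.
move=> mua dg1 dg2 h1C h2C.
pose dl := a - mu; have dl0 : 0 < dl by rewrite subr_gt0.
pose M := 2 * C ^+ 2 / dl.
pose u x := g1 x ^+ 2 + g2 x ^+ 2.
(* The exponent [dl + 2 * mu] is the a + mu of the energy estimate; the subtracted term is a
   primitive of the bound on the forcing, so that w is nonincreasing. *)
pose w x := expR ((dl + 2 * mu) * x) * u x - M / dl * expR (dl * x).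
pose w' x := expR ((dl + 2 * mu) * x) * ((dl + 2 * mu) * u x +
  (2 * g1 x * (- (a * g1 x - b * g2 x) - h1 x) +
   2 * g2 x * (- (a * g2 x + b * g1 x) - h2 x))) - M * expR (dl * x).
have dexp c x : is_derive x (1 : R) (fun x => expR (c * x)) (c * expR (c * x)).
  have := @is_derive1_comp _ expR ( *%R c) x _ _ (is_derive_expR (c * x)) _.
  move=> /(_ c); rewrite mulrC; apply.
  apply: is_derive_eq; rewrite ?scaler0 ?addr0.
  by rewrite -[LHS]/(c * 1) mulr1.
have dw x : is_derive x (1 : R) w (w' x).
  have := dg1 x; have := dg2 x => dg2x dg1x.
  have d1 := dexp (dl + 2 * mu) x; have d2 := dexp dl x.
  rewrite /w /u.
  apply: is_derive_eq.
  rewrite /w' /GRing.scale/= /u.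
  have dlN0 : dl != 0 by rewrite gt_eqF.
  by field.
have w'le0 x : 0 <= x -> w' x <= 0.
  move=> x0; rewrite /w' subr_le0.
  set E := expR _; set h := h1 x; set k := h2 x.
  have EE : expR (dl * x) = E * expR (- mu * x) ^+ 2.
    rewrite /E expr2 -!expRD; congr expR; ring.
  rewrite EE mulrCA ler_wpM2l ?expR_ge0//.
  set e := expR (- mu * x).
  have hC : h ^+ 2 <= C ^+ 2 * e ^+ 2.
    rewrite -exprMn -real_normK ?num_real// lerXn2r ?nnegrE// ?h1C//.
    exact: le_trans (h1C _ x0).
  have kC : k ^+ 2 <= C ^+ 2 * e ^+ 2.
    rewrite -exprMn -real_normK ?num_real// lerXn2r ?nnegrE// ?h2C//.
    exact: le_trans (h2C _ x0).
  rewrite /M [leRHS]mulrAC ler_pdivlMr//.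
  (* Young's inequality for each component, as the expansion of a square. *)
  have q1 : 0 <= (dl * g1 x + h) ^+ 2 by exact: sqr_ge0.
  have q2 : 0 <= (dl * g2 x + k) ^+ 2 by exact: sqr_ge0.
  have -> : a = dl + mu by rewrite /dl subrK.
  rewrite /u; nra.
have wle x : 0 <= x -> w x <= w 0.
  move=> x0; apply: (@ler0_derive1_nincry _ w 0) => //.
  - move=> y; rewrite in_itv/= andbT => y0.
    by rewrite derive1E (@derive_val _ _ _ _ _ _ _ (dw y)) w'le0// ltW.
  - apply: continuous_subspaceT => y; apply: differentiable_continuous.
    by apply/derivable1_diffP; have [] := dw y.
pose K := `|w 0| + M / dl.
have M0 : 0 <= M / dl.
  by rewrite /M; apply: divr_ge0 (ltW dl0); apply: divr_ge0 (ltW dl0);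
    rewrite mulr_ge0 ?sqr_ge0.
have ule x : 0 <= x -> u x <= (Num.sqrt K * expR (- mu * x)) ^+ 2.
  move=> x0; rewrite exprMn sqr_sqrtr ?addr_ge0//.
  have := wle _ x0; rewrite {1}/w lerBlDr.
  set E1 := expR ((dl + 2 * mu) * x) => wx.
  rewrite -(ler_pM2l (expR_gt0 ((dl + 2 * mu) * x))) -/E1.
  have -> : E1 * (K * expR (- mu * x) ^+ 2) = K * expR (dl * x).
    rewrite mulrCA /E1 expr2 -!expRD; congr (_ * expR _); ring.
  apply: (le_trans wx); rewrite [leRHS]mulrDl; apply: lerD => //.
  by rewrite (le_trans (ler_norm _))// ler_peMr// -expR0 ler_expR mulr_ge0// ltW.
exists (Num.sqrt K) => x x0.
have sK : 0 <= Num.sqrt K * expR (- mu * x).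
  by rewrite mulr_ge0 ?sqrtr_ge0 ?expR_ge0.
split; rewrite -ler_sqr ?nnegrE// real_normK ?num_real//;
  rewrite (le_trans _ (ule _ x0))// /u ?lerDl ?lerDr sqr_ge0//.
Qed.

Local Notation Rex := (map_mx (@complex.Re R)).
Local Notation Imx := (map_mx (@complex.Im R)).
Local Notation toC := (map_mx (real_complex R)).

(** Decay of the complex matrix M e^{-xA}: as A is real, its real and imaginary parts are the flows
    of those of M. *)
Definition mx_decay d (A : 'M[R]_d) mu (M : 'M[R[i]]_d) :=
  exists K, forall x, 0 <= x -> forall i j,
    `|mx_flow (Rex M) A i j (- x)| <= K * expR (- mu * x) /\
    `|mx_flow (Imx M) A i j (- x)| <= K * expR (- mu * x).

Lemma Re_sum I (r : seq I) (F : I -> R[i]) :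
  complex.Re (\sum_(i <- r) F i) = \sum_(i <- r) complex.Re (F i).
Proof. by apply: big_morph => // -[a b] [a' b']. Qed.

Lemma Im_sum I (r : seq I) (F : I -> R[i]) :
  complex.Im (\sum_(i <- r) F i) = \sum_(i <- r) complex.Im (F i).
Proof. by apply: big_morph => // -[a b] [a' b']. Qed.

(* The entries of M e^{-xA} solve the linear system y' = - l y - h, where h are
   the entries of M (A - l) e^{-xA}. *)
Lemma mx_decay_factor d (A : 'M[R]_d) mu (M : 'M[R[i]]_d) (l : R[i]) :
  mu < complex.Re l -> mx_decay A mu (M *m (toC A - l%:M)) -> mx_decay A mu M.
Proof.
move=> mul [C hC].
pose a := complex.Re l; pose b := complex.Im l.
have MA1 : Rex M *m A = Rex (M *m (toC A - l%:M)) + a *: Rex M - b *: Imx M.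
  apply/matrixP => i j; rewrite mulmxBr mul_mx_scalar !mxE.
  rewrite raddfB/= Re_sum.
  under eq_bigr do rewrite mxE.
  under [in RHS]eq_bigr => k _.
    have -> : complex.Re (M i k * toC A k j) = complex.Re (M i k) * A k j.
      by rewrite mxE; case: (M i k) => ? ? /=; rewrite mulr0 subr0.
    over.
  rewrite /a /b; case: (l) (M i j) => ? ? [? ?] /=; ring.
have MA2 : Imx M *m A = Imx (M *m (toC A - l%:M)) + a *: Imx M + b *: Rex M.
  apply/matrixP => i j; rewrite mulmxBr mul_mx_scalar !mxE.
  rewrite raddfB/= Im_sum.
  under eq_bigr do rewrite mxE.
  under [in RHS]eq_bigr => k _.
    have -> : complex.Im (M i k * toC A k j) = complex.Im (M i k) * A k j.
      by rewrite mxE; case: (M i k) => ? ? /=; rewrite mulr0 add0r.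
    over.
  rewrite /a /b; case: (l) (M i j) => ? ? [? ?] /=; ring.
have dflow N i j x : is_derive x (1 : R) (fun x => mx_flow N A i j (- x))
    (- mx_flow (N *m A) A i j (- x)).
  have := @is_derive1_comp _ (mx_flow N A i j) (fun x => - x) x _ (-1)
    (is_derive_mx_flow N A i j (- x)).
  by rewrite mulrN1; apply; exact: is_deriveN.
have decay_entry i j : exists K, forall x, 0 <= x ->
    `|mx_flow (Rex M) A i j (- x)| <= K * expR (- mu * x) /\
    `|mx_flow (Imx M) A i j (- x)| <= K * expR (- mu * x).
  apply: (@decay_ode (fun x => mx_flow (Rex M) A i j (- x))
    (fun x => mx_flow (Imx M) A i j (- x))
    (fun x => mx_flow (Rex (M *m (toC A - l%:M))) A i j (- x))
    (fun x => mx_flow (Imx (M *m (toC A - l%:M))) A i j (- x)) a b mu C mul).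
  - move=> x; have := dflow (Rex M) i j x.
    rewrite MA1 -scaleNr !mx_flowD !mx_flowZ => ?; apply: is_derive_eq; ring.
  - move=> x; have := dflow (Imx M) i j x.
    rewrite MA2 !mx_flowD !mx_flowZ => ?; apply: is_derive_eq; ring.
  - by move=> x x0; have [] := hC x x0 i j.
  - by move=> x x0; have [] := hC x x0 i j.
pose K i j := projT1 (cid (decay_entry i j)).
have KP i j x : 0 <= x -> `|mx_flow (Rex M) A i j (- x)| <= K i j * expR (- mu * x) /\
    `|mx_flow (Imx M) A i j (- x)| <= K i j * expR (- mu * x).
  by rewrite /K; case: cid => k /= kP; exact: kP.
exists (\sum_i \sum_j `|K i j|) => x x0 i j.
have le : K i j * expR (- mu * x) <= (\sum_i \sum_j `|K i j|) * expR (- mu * x).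
  rewrite ler_wpM2r ?expR_ge0// (le_trans (ler_norm _))//.
  have := @norm_entry_le_sum _ _ (\matrix_(i, j) K i j) i j.
  by under eq_bigr do under eq_bigr do rewrite mxE; rewrite mxE.
by have [? ?] := KP i j _ x0; split; exact: le_trans le.
Qed.

Lemma mxexp_decay d (A : 'M[R]_d) : ReSpec A `<=` `]0, +oo[ ->
  exists mu K, [/\ 0 < mu, 0 <= K & forall x, 0 <= x -> forall i j,
    `|mxexp (- x *: A) i j| <= K * expR (- mu * x)].
Proof.
(* The size 0 is set apart: Cayley-Hamilton is used in the ring of matrices of size [d.+1]. *)
case: d A => [|d] A specA.
  by exists 1, 0; split => // x x0 [].
have [r charE] := closed_field_poly_normal (char_poly (toC A)).
rewrite (monicP (char_poly_monic _)) scale1r in charE.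
have r0 z : z \in r -> 0 < complex.Re z.
  move=> zr; have : ReSpec A (complex.Re z).
    exists z => //; rewrite /Spec/= eigenvalue_root_char charE.
    by rewrite root_prod_XsubC.
  by move=> /specA/=; rewrite in_itv/= andbT.
(* The same mu serves for every factor: the strict margin below each real part absorbs the forcing
   term, so repeated eigenvalues cost no polynomial factor. *)
have [mu mu0 mur] : exists2 mu, 0 < mu & forall z, z \in r -> mu < complex.Re z.
  elim: r r0 {charE} => [|z r IH] r0; first by exists 1.
  have [|mu mu0 mur] := IH; first by move=> y yr; rewrite r0// inE yr orbT.
  exists (Num.min mu (complex.Re z / 2)).
    by rewrite lt_min mu0 divr_gt0// r0 ?inE ?eqxx.
  move=> y; rewrite inE => /predU1P[->|yr].
    have := r0 z; rewrite inE eqxx => /(_ isT) z0.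
    rewrite gt_min; apply/orP; right; lra.
  by rewrite gt_min mur.
have : mx_decay A mu (1 *m horner_mx (toC A) (char_poly (toC A))).
  rewrite mul1mx Cayley_Hamilton; exists 0 => x x0 i j.
  have -> : Rex (0 : 'M[R[i]]_d.+1) = 0 by apply/matrixP => ? ?; rewrite !mxE.
  have -> : Imx (0 : 'M[R[i]]_d.+1) = 0 by apply/matrixP => ? ?; rewrite !mxE.
  by rewrite mx_flow0 normr0 mul0r.
rewrite charE {charE}.
have : mx_decay A mu 1 -> exists mu K, [/\ 0 < mu, 0 <= K &
    forall x, 0 <= x -> forall i j,
    `|mxexp (- x *: A) i j| <= K * expR (- mu * x)].
  move=> [K KP]; exists mu, K; split => //.
    have := KP 0 (lexx _) ord0 ord0; rewrite mulr0 expR0 mulr1 => -[+ _].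
    exact: le_trans.
  move=> x x0 i j; have [+ _] := KP x x0 i j; rewrite mxexpE.
  suff -> : Rex (1 : 'M[R[i]]_d.+1) = 1 by [].
  by apply/matrixP => k l; rewrite !mxE; case: eqP.
(* The left factor 1 is generalized so that the induction can absorb into it the factors of the
   polynomial. *)
move=> + dec; apply; move: dec r0 mur; move: (1 : 'M[R[i]]_d.+1).
elim: r => [|z r IH] M.
  by rewrite big_nil rmorph1 -[X in mx_decay _ _ X]/(M * 1) mulr1.
rewrite big_cons rmorphM/= rmorphB/= horner_mx_X horner_mx_C => dec r0 mur.
apply: (@mx_decay_factor _ _ _ _ z); first by rewrite mur// inE eqxx.
apply: IH; first by move: dec; rewrite -mulmxE mulmxA.
- by move=> y yr; rewrite r0// inE yr orbT.
- by move=> y yr; rewrite mur// inE yr orbT.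
Qed.

(* With r = e^{-x}, both bounds compare the flow with e^{- mu x}: the second
   holds because C r^mu dominates the derivative of r^A. *)
Lemma mxpow_bounds d m (A : 'M[R]_d) (S : 'M[R]_(d, m)) :
  ReSpec A `<=` `]0, +oo[ ->
  exists mu C, [/\ 0 < mu, 0 <= C,
    forall r, 0 < r <= 1 -> forall i j, `|(mxpow r A *m S) i j| <= C * r `^ mu &
    forall r r', 0 < r -> r <= r' -> r' <= 1 -> forall i j,
      `|(mxpow r' A *m S) i j - (mxpow r A *m S) i j| <=
      C * (r' `^ mu - r `^ mu)].
Proof.
move=> /mxexp_decay[mu [K [mu0 K0 KP]]].
pose a := \sum_i \sum_j `|A i j|.
pose s := \sum_i \sum_j `|S i j|.
have a0 : 0 <= a by apply: sumr_ge0 => *; exact: sumr_ge0.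
have s0 : 0 <= s by apply: sumr_ge0 => *; exact: sumr_ge0.
(* [D * mu] is [a * K], a bound for the entries of A e^{-xA} relative to e^{-mu x}; hence D e^{-mu
   x} decreases at least as fast as the flow can vary. *)
pose D := a * K / mu.
have D0 : 0 <= D by rewrite divr_ge0 ?mulr_ge0// ltW.
have mulS (N : 'M[R]_d) b i j : (forall i j, `|N i j| <= b) ->
    `|(N *m S) i j| <= s * b.
  move=> Nb; rewrite -[N *m S]trmxK trmx_mul mxE.
  rewrite (le_trans (@norm_mulmx_entry_le _ _ _ _ _ b _ _ _)) ?mxE//.
    by move=> k l; rewrite mxE.
  rewrite /s exchange_big/=.
  by under eq_bigr do under eq_bigr do rewrite mxE.
have flowle x y i j : 0 <= x -> x <= y ->
    `|mx_flow 1 A i j (- x) - mx_flow 1 A i j (- y)| <=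
    D * (expR (- mu * x) - expR (- mu * y)).
  move=> x0 xy.
  (* The signs 1 and -1 give the two halves of the absolute value. *)
  have key (e : R) : `|e| = 1 -> e * (mx_flow 1 A i j (- x) - mx_flow 1 A i j (- y)) <=
      D * (expR (- mu * x) - expR (- mu * y)).
    move=> e1.
    pose f z := D * expR (- mu * z) - e * mx_flow 1 A i j (- z).
    pose f' z := - (D * mu * expR (- mu * z)) + e * mx_flow (1 *m A) A i j (- z).
    have df z : is_derive z (1 : R) f (f' z).
      have d1 : is_derive z (1 : R) (fun z => mx_flow 1 A i j (- z))
          (- mx_flow (1 *m A) A i j (- z)).
        have := @is_derive1_comp _ (mx_flow 1 A i j) (fun x => - x) z _ (-1)
          (is_derive_mx_flow 1 A i j (- z)).
        by rewrite mulrN1; apply; exact: is_deriveN.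
      have d2 : is_derive z (1 : R) (fun z => expR (- mu * z))
          (- mu * expR (- mu * z)).
        have := @is_derive1_comp _ expR ( *%R (- mu)) z _ _
          (is_derive_expR (- mu * z)) _.
        move=> /(_ (- mu)); rewrite mulrC; apply.
        apply: is_derive_eq; rewrite ?scaler0 ?addr0.
        by rewrite -[LHS]/(- mu * 1) mulr1.
      apply: is_derive_eq; rewrite /GRing.scale/= /f'; ring.
    have f'le0 z : 0 <= z -> f' z <= 0.
      move=> z0; rewrite /f' addrC subr_le0.
      apply: (le_trans (ler_norm _)); rewrite normrM e1 mul1r.
      have -> : mx_flow (1 *m A) A i j (- z) = (A *m mxexp (- z *: A)) i j.
        have flow_sum n (c : 'I_n -> R) (N : 'I_n -> 'M[R]_d) :
            mx_flow (\sum_k c k *: N k) A i j (- z) =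
            \sum_k c k * mx_flow (N k) A i j (- z).
          elim: n c N => [|n IH] c N; first by rewrite !big_ord0 mx_flow0.
          by rewrite !big_ord_recl mx_flowD mx_flowZ IH.
        rewrite mxE; under eq_bigr do rewrite mxexpE.
        (* The flow is linear in its left factor at a fixed entry; multiplying by [delta_mx i k]
           brings row k to row i, so that a sum over rows becomes such a linear combination. *)
        have row_flow k : mx_flow 1 A k j (- z) = mx_flow (delta_mx i k) A i j (- z).
          rewrite /mx_flow; congr (limn (pseries _ _)); apply/funext => q.
          rewrite /mx_series; congr (_ * _); rewrite mul1mx mxE (bigD1 k)//=.
          by rewrite mxE !eqxx mul1r big1 ?addr0// => l lk; rewrite mxE (negbTE lk) andbF mul0r.
        under eq_bigr do rewrite row_flow.
        rewrite -flow_sum /mx_flow; congr (limn (pseries _ _)); apply/funext => q.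
        rewrite /mx_series; congr (_ * _); rewrite mul1mx !mxE.
        apply: eq_bigr => k _; congr (_ * _).
        rewrite summxE (bigD1 k)//= !mxE !eqxx mulr1 big1 ?addr0// => l lk.
        by rewrite !mxE eqxx eq_sym (negbTE lk) mulr0.
      have -> : D * mu = a * K by rewrite /D divfK// gt_eqF.
      by rewrite -mulrA norm_mulmx_entry_le// => k l; exact: KP.
    have := @ler0_derive1_nincry _ f 0.
    move=> /(_ _ _ _ x y x0 xy); rewrite /f.
    move=> h; suff : D * expR (- mu * y) - e * mx_flow 1 A i j (- y) <=
      D * expR (- mu * x) - e * mx_flow 1 A i j (- x) by nra.
    apply: h.
    - by move=> z _; have [] := df z.
    - move=> z; rewrite in_itv/= andbT => z0.
      by rewrite derive1E (@derive_val _ _ _ _ _ _ _ (df z)) f'le0// ltW.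
    - apply: continuous_subspaceT => z; apply: differentiable_continuous.
      by apply/derivable1_diffP; have [] := df z.
  rewrite ler_norml -[X in - X <= _]mul1r.
  have := key 1 (normr1 _); have := key (-1) (normrN1 _).
  by rewrite mul1r mulN1r => k1 k2; apply/andP; split; lra.
have powE (r : R) : 0 < r -> r `^ mu = expR (- mu * (- ln r)).
  by move=> r0; rewrite /powR gt_eqF// mulrNN.
have lnE (r : R) : 0 < r <= 1 -> 0 <= - ln r.
  by move=> /andP[r0 r1]; rewrite oppr_ge0 ln_le0.
exists mu, (s * (D + K)); split => //.
- by rewrite mulr_ge0// addr_ge0.
- move=> r r01 i j; have /andP[r0 r1] := r01.
  rewrite (le_trans (mulS _ (K * r `^ mu) _ _ _))//.
    move=> k l; rewrite powE// /mxpow -[X in mxexp (X *: _)]opprK.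
    by apply: KP; exact: lnE.
  by rewrite -mulrA ler_wpM2l// ler_wpM2r ?powR_ge0// lerDr.
- move=> r r' r0 rr' r'1 i j.
  have r'0 : 0 < r' by rewrite (lt_le_trans r0).
  have := mulS (mxpow r' A - mxpow r A) (D * (r' `^ mu - r `^ mu)) i j.
  rewrite mulmxBl [X in `|X|]mxE [in X in `|_ + X|]mxE.
  move=> h; rewrite (le_trans (h _))//.
    move=> k l; rewrite mxE [X in _ + X]mxE /mxpow !mxexpE.
    rewrite !powE// -[X in mx_flow _ _ _ _ X]opprK.
    rewrite -[X in _ - mx_flow _ _ _ _ X]opprK; apply: flowle.
      by rewrite oppr_ge0 ln_le0.
    by rewrite lerN2 ler_ln.
  rewrite -[leRHS]mulrA ler_wpM2l// ler_wpM2r ?lerDl//.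
  rewrite subr_ge0; apply: ge0_ler_powR => //; first exact: ltW.
    by rewrite nnegrE ltW.
  by rewrite nnegrE ltW.
Qed.

End matrix_exponential.

(** * Gaussian laws *)

(** The pushforward packaged as a measure, so that uniqueness theorems for measures apply to it. *)
Definition image_measure d d' (T1 : measurableType d) (T2 : measurableType d')
    (R : realType) (m : {measure set T1 -> \bar R}) (f : T1 -> T2)
    (mf : measurable_fun setT f) : {measure set T2 -> \bar R} :=
  measure_function_pushforward__canonical__measure_function_Measure m mf.

Section gaussian_laws.
Context {R : realType}.
Local Notation mu := (@lebesgue_measure R).
Local Notation gauss1 := (@normal_prob R 0 1).

Lemma measurable_mulr_fun (a : R) : measurable_fun [set: R] ( *%R a).
Proof. exact: measurable_funM. Qed.

Lemma measurable_addr_fun (a : R) : measurable_fun [set: R] (+%R a).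
Proof. exact: measurable_funD. Qed.

Let mulrT (a : R) :
  measurable_fun setT ( *%R a : measurableTypeR R -> measurableTypeR R).
Proof. exact: measurable_mulr_fun. Qed.

Let addrT (a : R) :
  measurable_fun setT (+%R a : measurableTypeR R -> measurableTypeR R).
Proof. exact: measurable_addr_fun. Qed.

(** Uniqueness of Lebesgue measure reduces this to half-open intervals; a negative a moves the
    closed end to the other side, which does not change the length. *)
Lemma lebesgue_measure_mulr (a : R) (U : set R) : a != 0 -> measurable U ->
  (`|a|%:E * mu ( *%R a @^-1` U) = mu U)%E.
Proof.
move=> a0 mU.
pose nu := mscale (NngNum (normr_ge0 a)) (image_measure mu (mulrT a)).
suff -> : mu U = nu U by [].
apply: lebesgue_measure_unique => // _ [[x y]] _ <-.
rewrite /nu/= /mscale/= /pushforward.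
have [a_gt0|a_lt0] : 0 < a \/ a < 0 by case: (ltgtP a 0) a0 => //; auto.
- have -> : *%R a @^-1` `]x, y] = `]x / a, y / a]%classic.
    apply/seteqP; split => z /=; rewrite !in_itv/=;
      by rewrite ltr_pdivrMr// ler_pdivlMr// ![z * a]mulrC.
  rewrite !lebesgue_measure_itv/= !lte_fin ltr_pM2r ?invr_gt0//.
  case: ifPn => xy; last by rewrite mule0.
  rewrite -!EFinB -EFinM gtr0_norm// -mulrBl mulrC divfK//.
- have -> : *%R a @^-1` `]x, y] = `[y / a, x / a[%classic.
    apply/seteqP; split => z /=; rewrite !in_itv/=;
      by rewrite ler_ndivrMr// ltr_ndivlMr// ![z * a]mulrC andbC.
  rewrite !lebesgue_measure_itv/= !lte_fin ltr_nM2r ?invr_lt0//.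
  case: ifPn => xy; last by rewrite mule0.
  rewrite -!EFinB -EFinM ltr0_norm// -mulrBl; congr EFin.
  by field; exact: a0.
Qed.

Lemma lebesgue_measure_addr (a : R) (U : set R) : measurable U ->
  (mu (+%R a @^-1` U) = mu U)%E.
Proof.
move=> mU; pose nu := image_measure mu (addrT a).
have ma : measurable_fun [set: R] (+%R a) by exact: measurable_funD.
suff -> : mu U = nu U by [].
apply: lebesgue_measure_unique => // _ [[x y]] _ <-.
rewrite /nu/= /pushforward.
have -> : +%R a @^-1` `]x, y] = `]x - a, y - a]%classic.
  by apply/seteqP; split => z /=; rewrite !in_itv/= ltrBlDl lerBrDl.
rewrite !lebesgue_measure_itv/= !lte_fin ltrD2r; case: ifP => // _.
by rewrite -!EFinB; congr EFin; ring.
Qed.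

Lemma normal_prob_mulr (s : R) (U : set R) : s != 0 -> measurable U ->
  normal_prob 0 s U = gauss1 ( *%R s @^-1` U).
Proof.
move=> s0 mU; rewrite /normal_prob.
pose nu := mscale (NngNum (normr_ge0 s)) (image_measure mu (mulrT s)).
have ms := measurable_mulr_fun s.
have mpdf m t (D : set R) : measurable_fun D (fun x : R => (normal_pdf m t x)%:E).
  by apply/measurable_EFinP/measurable_funTS; exact: measurable_normal_pdf.
transitivity (\int[nu]_(x in U) (normal_pdf 0 s x)%:E)%E.
  apply: eq_measure_integral => V mV _.
  by rewrite -[LHS](lebesgue_measure_mulr s0).
rewrite ge0_integral_mscale//=; last by move=> x _; rewrite lee_fin normal_pdf_ge0.
rewrite ge0_integral_pushforward//=; last 2 first.
  exact: mpdf.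
  by move=> x _; rewrite lee_fin normal_pdf_ge0.
rewrite -ge0_integralZl//=.
- apply: eq_integral => x _; rewrite -EFinM; congr EFin.
  rewrite !normal_pdfE ?oner_eq0// /normal_fun /normal_peak.
  rewrite expr1n mul1r -mulrnAr sqrtrM ?sqr_ge0// sqrtr_sqr invfM.
  rewrite !mulrA divff ?normr_eq0// mul1r; congr (_ * expR _).
  by rewrite !subr0 exprMn; field; exact: s0.
- by rewrite -[_ @^-1` _]setTI; exact: ms.
- apply: measurableT_comp (mpdf 0 s setT) _; exact: measurable_funTS.
- by move=> x _; rewrite lee_fin normal_pdf_ge0.
- exact: mpdf.
Qed.

Lemma normal_prob_addr (m s : R) (U : set R) : s != 0 -> measurable U ->
  normal_prob 0 s (+%R m @^-1` U) = normal_prob m s U.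
Proof.
move=> s0 mU; rewrite /normal_prob.
pose nu := image_measure mu (addrT m).
have ms : measurable_fun [set: R] (+%R m) by exact: measurable_funD.
have mpdf m' t (D : set R) : measurable_fun D (fun x : R => (normal_pdf m' t x)%:E).
  by apply/measurable_EFinP/measurable_funTS; exact: measurable_normal_pdf.
transitivity (\int[nu]_(x in U) (normal_pdf m s x)%:E)%E; last first.
  apply: eq_measure_integral => V mV _.
  by rewrite -[RHS](lebesgue_measure_addr m).
rewrite ge0_integral_pushforward//=; last 2 first.
  exact: mpdf.
  by move=> x _; rewrite lee_fin normal_pdf_ge0.
apply: eq_integral => x _; rewrite !normal_pdfE ?oner_eq0// /normal_fun.
by rewrite subr0 [m + x]addrC addrK.
Qed.

(** As an image of N(0, 1), the law is described in the same way for s = 0, where it is a Dirac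
    mass, and for s of either sign. Degenerate variables thus follow the general case. *)
Lemma gauss_lawE (s : R) (U : set R) : measurable U ->
  gauss_law 0 s U = gauss1 ( *%R s @^-1` U).
Proof.
move=> mU; rewrite /gauss_law; case: eqVneq => [->|s0].
  rewrite diracE.
  have -> : *%R 0 @^-1` U = if 0 \in U then setT else set0.
    apply/seteqP; split => z /=; rewrite mul0r; case: ifPn => //.
      by rewrite notin_setE.
    by rewrite inE.
  by case: ifP => _; [exact/esym/probability_setT|exact/esym/measure0].
exact: normal_prob_mulr.
Qed.

Lemma gauss_law_norm (s : R) (U : set R) : gauss_law 0 s U = gauss_law 0 `|s| U.
Proof.
rewrite /gauss_law normr_eq0; have [_|s0] := ifPn; first by [].
apply: eq_integral => x _; congr EFin; rewrite !normal_pdfE ?normr_eq0//.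
by rewrite /normal_fun /normal_peak real_normK// num_real.
Qed.

(** The Radon-Nikodym derivative of the normal law has the same integrals as [normal_pdf] over
    measurable sets, so the two agree almost everywhere. *)
Lemma ge0_integral_normal_prob (m s : R) (f : R -> \bar R) :
  measurable_fun [set: R] f -> (forall x, 0 <= f x)%E ->
  (\int[normal_prob m s]_x f x = \int[mu]_x (f x * (normal_pdf m s x)%:E))%E.
Proof.
move=> mf f0.
have dom := @normal_prob_dominates R m s.
rewrite -(Radon_Nikodym_SigmaFinite.change_of_variables dom)//.
have mpdf : measurable_fun [set: R] (fun x : R => (normal_pdf m s x)%:E).
  by apply/measurable_EFinP; exact: measurable_normal_pdf.
have iRN := Radon_Nikodym_SigmaFinite.f_integrable dom.
apply: ge0_ae_eq_integral => //.
- by apply: emeasurable_funM => //; exact: measurable_int iRN.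
- by apply: emeasurable_funM.
- by move=> x _; rewrite mule_ge0// Radon_Nikodym_SigmaFinite.f_ge0.
- by move=> x _; rewrite mule_ge0// lee_fin normal_pdf_ge0.
- apply: ae_eqe_mul2l; apply: integral_ae_eq => // E _ mE.
  by rewrite -Radon_Nikodym_SigmaFinite.f_integral.
Qed.

Lemma normal_peakE (s : R) : normal_peak s = (`|s| * Num.sqrt (pi *+ 2))^-1.
Proof. by rewrite /normal_peak -mulrnAr sqrtrM ?sqr_ge0// sqrtr_sqr. Qed.

(* Completing the square in x. *)
Lemma normal_pdf_square (a b x z : R) : b != 0 ->
  let s := Num.sqrt (a ^+ 2 + b ^+ 2) in
  normal_pdf (a * x) b z * normal_pdf 0 1 x =
  normal_pdf 0 s z * normal_pdf (a / s ^+ 2 * z) (b / s) x.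
Proof.
move=> b0 s.
have s2 : s ^+ 2 = a ^+ 2 + b ^+ 2 by rewrite sqr_sqrtr// addr_ge0// sqr_ge0.
have s_gt0 : 0 < s.
  by rewrite sqrtr_gt0 ltr_wpDl ?sqr_ge0// exprn_even_gt0.
have sN0 : s != 0 by rewrite gt_eqF.
have bs0 : b / s != 0 by rewrite mulf_neq0// invr_eq0.
rewrite !normal_pdfE ?oner_eq0// mulrACA [RHS]mulrACA; congr (_ * _).
  have pN0 : Num.sqrt (pi *+ 2) != 0 :> R.
    by rewrite gt_eqF// sqrtr_gt0 pmulrn_lgt0// pi_gt0.
  rewrite !normal_peakE normr1 normrM normrV ?unitfE// (gtr0_norm s_gt0).
  by field; rewrite pN0 sN0 normr_eq0 b0.
rewrite /normal_fun -!expRD; congr expR.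
have b2 : b ^+ 2 = s ^+ 2 - a ^+ 2 by rewrite s2 addrC addKr.
have bN : s ^+ 2 - a ^+ 2 != 0 by rewrite -b2 expf_neq0.
rewrite expr_div_n b2; field.
by rewrite bN sN0.
Qed.

(** Given the first coordinate x, the combination has law N(a x, b^2). Tonelli's theorem lets x be
    integrated first, and once the square is completed the part that depends on x is a probability
    density. For b = 0 there is no such density, and the combination is a x. *)
Lemma gauss_law_conv (a b : R) (U : set R) : measurable U ->
  (gauss1 \x gauss1)%E [set p | U (a * p.1 + b * p.2)] =
  gauss_law 0 (Num.sqrt (a ^+ 2 + b ^+ 2)) U.
Proof.
move=> mU; set E := [set p | _].
have mab : measurable_fun [set: R * R] (fun p : R * R => a * p.1 + b * p.2).
  by apply: measurable_funD; apply: measurable_funM.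
have mE : measurable E by rewrite -[E]setTI; exact: mab.
have [b0|b0] := eqVneq b 0.
  have -> : E = ( *%R a @^-1` U) `*` setT.
    by apply/seteqP; split => -[x y]; rewrite /E/= b0 mul0r addr0// => -[].
  have mUa : measurable ( *%R a @^-1` U).
    by rewrite -[_ @^-1` _]setTI; exact: measurable_mulr_fun.
  rewrite product_measure1E// [X in (_ * X)%E]probability_setT mule1.
  by rewrite b0 expr0n addr0 sqrtr_sqr -gauss_law_norm gauss_lawE.
set s := Num.sqrt _.
have s_gt0 : 0 < s.
  by rewrite sqrtr_gt0 ltr_wpDl ?sqr_ge0// exprn_even_gt0.
have sN0 : s != 0 by rewrite gt_eqF.
have mpdf m t (D : set R) : measurable_fun D (fun x : R => (normal_pdf m t x)%:E).
  by apply/measurable_EFinP/measurable_funTS; exact: measurable_normal_pdf.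
transitivity (\int[gauss1]_x normal_prob (a * x) b U)%E.
  rewrite /product_measure1; apply: eq_integral => x _.
  have mUx : measurable (+%R (a * x) @^-1` U).
    by rewrite -[_ @^-1` _]setTI; exact: measurable_addr_fun.
  rewrite -(normal_prob_addr (a * x) b0 mU) (normal_prob_mulr b0 mUx).
  congr (gauss1 _); apply/seteqP; split => y /=.
    by rewrite xsectionP.
  by move=> ?; apply/xsectionP.
pose F (p : R * R) := ((\1_U p.2)%:E * (normal_pdf (a * p.1) b p.2)%:E *
   (normal_pdf 0 1 p.1)%:E)%E.
have F0 p : (0 <= F p)%E.
  by rewrite /F !mule_ge0// lee_fin// normal_pdf_ge0.
have mpdf2 : measurable_fun [set: R * R]
    (fun p : R * R => (normal_pdf (a * p.1) b p.2)%:E).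
  apply/measurable_EFinP; rewrite (_ : (fun _ => _) =
    normal_pdf 0 b \o (fun p : R * R => p.2 - a * p.1)); last first.
    by apply/funext => p /=; rewrite !normal_pdfE// /normal_fun subr0.
  apply: measurableT_comp; first exact: measurable_normal_pdf.
  by apply: measurable_funB => //; apply: measurable_funM.
have mF1 : measurable_fun [set: R * R]
    (fun p : R * R => (\1_U p.2)%:E * (normal_pdf (a * p.1) b p.2)%:E)%E.
  apply: emeasurable_funM => //.
  by apply/measurable_EFinP; apply: measurableT_comp (measurable_snd).
have mF : measurable_fun [set: R * R] F.
  apply: emeasurable_funM => //.
  by apply: measurableT_comp (mpdf 0 1 setT) measurable_fst.
have indicE' x : (normal_prob (a * x) b U)%E =
    (\int[mu]_z ((\1_U z)%:E * (normal_pdf (a * x) b z)%:E))%E.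
  rewrite /normal_prob integral_mkcond; apply: eq_integral => z _.
  by rewrite epatch_indic muleC.
rewrite ge0_integral_normal_prob//; last first.
  under eq_fun do rewrite indicE'.
  have F1 (p : R * R) :
      (0 <= (\1_U p.2)%:E * (normal_pdf (a * p.1) b p.2)%:E)%E.
    by rewrite mule_ge0// lee_fin ?normal_pdf_ge0.
  exact: (@measurable_fun_fubini_tonelli_F _ _ (measurableTypeR R)
    (measurableTypeR R) R mu _ mF1 F1).
transitivity (\int[mu]_x \int[mu]_z F (x, z))%E.
  apply: eq_integral => x _; rewrite indicE' -ge0_integralZr//.
  - apply: emeasurable_funM; last exact: mpdf.
    by apply/measurable_EFinP; exact: measurable_indic.
  - by move=> z _; rewrite mule_ge0// lee_fin ?normal_pdf_ge0.
  - by rewrite lee_fin normal_pdf_ge0.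
rewrite fubini_tonelli//.
transitivity (\int[mu]_z ((\1_U z)%:E * (normal_pdf 0 s z)%:E))%E; last first.
  rewrite /gauss_law (negbTE sN0) /normal_prob [RHS]integral_mkcond.
  by apply: eq_integral => z _; rewrite epatch_indic muleC.
apply: eq_integral => z _; rewrite /F/=.
under eq_integral => x _.
  rewrite -muleA -(EFinM (normal_pdf (a * x) b z)) normal_pdf_square// -/s.
  rewrite (EFinM (normal_pdf 0 s z)) muleA. over.
rewrite ge0_integralZl//=.
- by rewrite integral_normal_pdf mule1.
- exact: mpdf.
- by move=> x _; rewrite lee_fin normal_pdf_ge0.
- by rewrite mule_ge0// lee_fin normal_pdf_ge0.
Qed.

End gaussian_laws.

(** * Expectation and independence *)

Section expectation_calculus.
Context {R : realType} {disp : measure_display} {Omega : measurableType disp}.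
Variable P : probability Omega R.
Implicit Types f g Z W : Omega -> R.

Definition L1 f : Prop := P.-integrable [set: Omega] (EFin \o f).

Definition L2 f : Prop :=
  measurable_fun [set: Omega] f /\ L1 (fun w => f w ^+ 2).

Definition Ex f : R := \int[P]_w f w.

Lemma L1_measurable f : L1 f -> measurable_fun [set: Omega] f.
Proof. by move=> /measurable_int/measurable_EFinP. Qed.

Lemma L1_le f g : measurable_fun [set: Omega] f ->
  (forall w, `|f w| <= g w) -> L1 g -> L1 f.
Proof.
move=> mf fg; apply: le_integrable => //; first exact/measurable_EFinP.
by move=> w _ /=; rewrite lee_fin (le_trans (fg w))// ler_norm.
Qed.

Lemma L1_cst (c : R) : L1 (fun=> c).
Proof. exact: finite_measure_integrable_cst. Qed.

Lemma L1D f g : L1 f -> L1 g -> L1 (fun w => f w + g w).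
Proof. by move=> fi gi; have := integrableD measurableT fi gi. Qed.

Lemma L1Z (c : R) f : L1 f -> L1 (fun w => c * f w).
Proof. by move=> fi; have := integrableZl measurableT c fi. Qed.

Lemma L1B f g : L1 f -> L1 g -> L1 (fun w => f w - g w).
Proof. by move=> fi gi; have := integrableB measurableT fi gi. Qed.

Lemma L1_sum I (r : seq I) (F : I -> Omega -> R) :
  (forall i, L1 (F i)) -> L1 (fun w => \sum_(i <- r) F i w).
Proof.
move=> Fi; elim: r => [|i r IH].
  by under eq_fun do rewrite big_nil; exact: L1_cst.
by under eq_fun do rewrite big_cons; exact: L1D.
Qed.

Lemma ExD f g : L1 f -> L1 g -> Ex (fun w => f w + g w) = Ex f + Ex g.
Proof. by move=> fi gi; exact: RintegralD. Qed.

Lemma ExB f g : L1 f -> L1 g -> Ex (fun w => f w - g w) = Ex f - Ex g.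
Proof. by move=> fi gi; exact: RintegralB. Qed.

Lemma ExZ (c : R) f : L1 f -> Ex (fun w => c * f w) = c * Ex f.
Proof. by move=> fi; exact: RintegralZl. Qed.

Lemma Ex_cst (c : R) : Ex (fun=> c) = c.
Proof.
rewrite /Ex Rintegral_cst//.
by rewrite -[RHS]mulr1; congr (_ * _); exact: (congr1 fine (probability_setT P)). Qed.

Lemma Ex_sum I (r : seq I) (F : I -> Omega -> R) :
  (forall i, L1 (F i)) ->
  Ex (fun w => \sum_(i <- r) F i w) = \sum_(i <- r) Ex (F i).
Proof.
move=> Fi; elim: r => [|i r IH].
  by under eq_fun do rewrite big_nil; rewrite Ex_cst big_nil.
under eq_fun do rewrite big_cons.
by rewrite ExD ?big_cons ?IH//; exact: L1_sum.
Qed.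

Lemma Ex_ge0 f : (forall w, 0 <= f w) -> 0 <= Ex f.
Proof. by move=> f0; exact: Rintegral_ge0. Qed.

Lemma Ex_le f g : L1 f -> L1 g -> (forall w, f w <= g w) -> Ex f <= Ex g.
Proof. by move=> fi gi fg; exact: le_Rintegral. Qed.

Lemma Ex_abs f : L1 f -> `|Ex f| <= Ex (fun w => `|f w|).
Proof. by move=> fi; exact: le_normr_Rintegral. Qed.

Lemma L1_abs f : L1 f -> L1 (fun w => `|f w|).
Proof. by move=> fi; have := integrable_norm fi. Qed.

Lemma EFin_Ex f : L1 f -> (\int[P]_w (f w)%:E)%E = (Ex f)%:E.
Proof.
by move=> fi; rewrite /Ex /Rintegral fineK//; exact: integrable_fin_num.
Qed.

Lemma L2_L2M f g : L2 f -> L2 g -> L1 (fun w => f w * g w).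
Proof.
move=> [mf fi] [mg gi].
apply: L1_le (L1D fi gi); first exact: measurable_funM.
move=> w; rewrite normrM -[f w ^+ 2]real_normK ?num_real//.
rewrite -[g w ^+ 2]real_normK ?num_real//.
have : 0 <= (`|f w| - `|g w|) ^+ 2 by exact: sqr_ge0.
have := normr_ge0 (f w); have := normr_ge0 (g w); nra.
Qed.

Lemma L2_cst (c : R) : L2 (fun=> c).
Proof. by split => //; exact: L1_cst. Qed.

Lemma L2_L1 f : L2 f -> L1 f.
Proof.
move=> f2; have := L2_L2M f2 (L2_cst 1).
by under eq_fun do rewrite mulr1.
Qed.

Lemma L2D f g : L2 f -> L2 g -> L2 (fun w => f w + g w).
Proof.
move=> f2 g2; have [mf fi] := f2; have [mg gi] := g2.
split; first exact: measurable_funD.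
have -> : (fun w => (f w + g w) ^+ 2) =
    fun w => (f w ^+ 2 + g w ^+ 2) + 2 * (f w * g w).
  by apply/funext => w; ring.
by apply: L1D; [exact: L1D|apply: L1Z; exact: L2_L2M].
Qed.

Lemma L2Z (c : R) f : L2 f -> L2 (fun w => c * f w).
Proof.
move=> [mf fi]; split; first exact: measurable_funM.
by under eq_fun do rewrite exprMn; exact: L1Z.
Qed.

Lemma L2B f g : L2 f -> L2 g -> L2 (fun w => f w - g w).
Proof.
move=> f2 g2; have := L2D f2 (L2Z (-1) g2).
by under eq_fun do rewrite mulN1r.
Qed.

Lemma L2_sum I (r : seq I) (F : I -> Omega -> R) :
  (forall i, L2 (F i)) -> L2 (fun w => \sum_(i <- r) F i w).
Proof.
move=> Fi; elim: r => [|i r IH].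
  by under eq_fun do rewrite big_nil; exact: L2_cst.
by under eq_fun do rewrite big_cons; exact: L2D.
Qed.

Lemma L2_boundedM f g (C : R) : measurable_fun [set: Omega] f ->
  (forall w, `|f w| <= C) -> L2 g -> L2 (fun w => f w * g w).
Proof.
move=> mf fC [mg gi]; split; first exact: measurable_funM.
apply: (@L1_le _ (fun w => C ^+ 2 * g w ^+ 2)) (L1Z _ gi).
  by apply: measurable_funX; exact: measurable_funM.
move=> w; rewrite ger0_norm ?sqr_ge0// exprMn ler_wpM2r ?sqr_ge0//.
rewrite -[f w ^+ 2]real_normK ?num_real// ler_sqr ?nnegrE//.
exact: le_trans (fC w).
Qed.

Lemma bounded_L2 f (C : R) : measurable_fun [set: Omega] f ->
  (forall w, `|f w| <= C) -> L2 f.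
Proof.
move=> mf fC; have := L2_boundedM mf fC (L2_cst 1).
by under eq_fun do rewrite mulr1.
Qed.

Lemma ge0_integral_lty_L2 f : measurable_fun [set: Omega] f ->
  (\int[P]_w (f w ^+ 2)%:E < +oo)%E -> L2 f.
Proof.
move=> mf fi; split => //; apply/integrableP; split.
  by apply/measurable_EFinP; exact: measurable_funX.
by under eq_integral do rewrite /= ger0_norm ?sqr_ge0//.
Qed.

Lemma L1_indic (A : set Omega) : measurable A -> L1 \1_A.
Proof.
move=> mA; apply: (@L1_le _ (fun=> 1)) (L1_cst 1); first exact: measurable_indic.
by move=> w; rewrite indicE; case: (_ \in _); rewrite ?normr1 ?normr0.
Qed.

Lemma EFin_Ex_indic (A : set Omega) : measurable A -> (Ex \1_A)%:E = P A.
Proof.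
by move=> mA; rewrite -EFin_Ex; [rewrite integral_indic// setIT|exact: L1_indic].
Qed.

Lemma measurable_norm_ge f (e : R) : measurable_fun [set: Omega] f ->
  measurable [set w | (e <= `|f w|)%R].
Proof.
move=> mf; rewrite -[X in measurable X]setTI.
rewrite (_ : [set w | _] = (Num.norm \o f) @^-1` `[e, +oo[%classic).
  by apply: measurableT_comp => //; exact: measurable_itv.
by apply/seteqP; split => w /=; rewrite in_itv/= andbT.
Qed.

Lemma Ex_chebyshev f (e : R) : L2 f -> 0 < e ->
  (P [set w | (e <= `|f w|)%R] <= (Ex (fun w => f w ^+ 2) / e ^+ 2)%:E)%E.
Proof.
move=> [mf fi] e0; have mA := measurable_norm_ge e mf.
rewrite -EFin_Ex_indic// lee_fin mulrC -ExZ//.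
apply: Ex_le; [exact: L1_indic|exact: L1Z|move=> w].
rewrite indicE; case: (boolP (w \in _)) => [|_]; last first.
  by rewrite mulr_ge0 ?sqr_ge0// invr_ge0 exprn_ge0// ltW.
rewrite inE/= => ew; rewrite mulrC ler_pdivlMr ?exprn_gt0// mul1r.
by rewrite -[leRHS]real_normK ?num_real// ler_sqr ?nnegrE// ltW.
Qed.

End expectation_calculus.

Section rectangles.
Context d1 d2 (T1 : measurableType d1) (T2 : measurableType d2) (R : realType).

(** Rectangles form a generating pi-system. The lemma serves for a joint law restricted to an event,
    which is finite but in general not a probability. *)
Lemma measure_rectangles_unique (m m' : {measure set (T1 * T2) -> \bar R}) :
  (m setT < +oo)%E ->
  (forall U V, measurable U -> measurable V -> m (U `*` V) = m' (U `*` V)) ->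
  forall E, measurable E -> m E = m' E.
Proof.
move=> mT mm'.
pose C : set (set (T1 * T2)) :=
  [set C | exists A, measurable A /\ exists B, measurable B /\ C = A `*` B].
have CI : setI_closed C.
  move=> /= _ _ [X1 [mX1 [X2 [mX2 ->]]]] [Y1 [mY1 [Y2 [mY2 ->]]]].
  rewrite -setXI; exists (X1 `&` Y1); split; first exact: measurableI.
  by exists (X2 `&` Y2); split => //; exact: measurableI.
move=> E mE; apply: (measure_unique C (fun=> setT)) => //.
- rewrite measurable_prod_measurableType //; congr (<<s _ >>).
  rewrite predeqE; split => [[A mA [B mB <-]]|[A [mA [B [mB ->]]]]].
    by exists A; split => //; exists B.
  by exists A => //; exists B.
- by move=> n; exists setT; split => //; exists setT; split => //; rewrite setXTT.
- by rewrite bigcup_const.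
- by move=> A [A1 [mA1 [A2 [mA2 ->]]]]; exact: mm'.
Qed.

End rectangles.

Section independence.
Context {R : realType} {disp : measure_display} {Omega : measurableType disp}.
Variable P : probability Omega R.
Implicit Types X Y : Omega -> R.

Definition independent_rv X Y : Prop :=
  forall U V : set R, measurable U -> measurable V ->
  P (X @^-1` U `&` Y @^-1` V) = (P (X @^-1` U) * P (Y @^-1` V))%E.

(** Independence says that the joint law is the product of the marginals; Tonelli's theorem for |x
    y| gives integrability, and Fubini's the value. *)
Lemma independent_rv_Ex X Y : independent_rv X Y -> L1 P X -> L1 P Y ->
  L1 P (fun w => X w * Y w) /\ Ex P (fun w => X w * Y w) = Ex P X * Ex P Y.
Proof.
move=> XY Xi Yi.
have mX := L1_measurable Xi; have mY := L1_measurable Yi.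
pose X' : {RV P >-> R} := HB.pack X (isMeasurableFun.Build _ _ _ _ _ mX).
pose Y' : {RV P >-> R} := HB.pack Y (isMeasurableFun.Build _ _ _ _ _ mY).
pose m1 := distribution P X'; pose m2 := distribution P Y'.
have mXY := measurable_fun_pair mX mY.
pose m := image_measure P mXY.
have joint E : measurable E -> (m1 \x m2)%E E = m E.
  apply: product_measure_unique => U V mU mV.
  by rewrite -[RHS](XY _ _ mU mV).
have mmul : measurable_fun [set: R * R] (fun p : R * R => p.1 * p.2).
  exact: measurable_funM.
pose h (p : R * R) := (p.1 * p.2)%:E.
have mh : measurable_fun [set: R * R] h by exact/measurable_EFinP.
have absE : (\int[m1]_x \int[m2]_y `|h (x, y)| =
    (\int[P]_w `|(X w)%:E|) * (\int[P]_w `|(Y w)%:E|))%E.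
  have mabs : measurable_fun [set: R] (fun y : R => `|y%:E|%E).
    by apply: measurableT_comp.
  have inner x : (\int[m2]_y `|h (x, y)| = `|x%:E| * \int[P]_w `|(Y w)%:E|)%E.
    rewrite -(@ge0_integral_distribution _ _ _ _ _ P Y' (fun y => `|y%:E|%E))//.
    rewrite -ge0_integralZl//.
    by apply: eq_integral => y _; rewrite /h/= normrM.
  under eq_integral do rewrite inner.
  rewrite ge0_integralZr//; last exact: integral_ge0.
  by rewrite (@ge0_integral_distribution _ _ _ _ _ P X' (fun y => `|y%:E|%E)).
have fin_abs (Z : Omega -> R) : L1 P Z -> (\int[P]_w `|(Z w)%:E|)%E \is a fin_num.
  by move=> Zi; apply: integrable_fin_num => //; exact: integrable_abse.
have intm : (m1 \x m2)%E.-integrable setT h.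
  apply/(integrable12ltyP m1 m2 mh); rewrite absE ltey_eq fin_numM//;
    exact: fin_abs.
have iXY : L1 P (fun w => X w * Y w).
  apply/integrableP; split; first by apply/measurable_EFinP; exact: measurable_funM.
  have /integrableP[_] := intm.
  rewrite (eq_measure_integral m)//; last by move=> E mE _; exact: joint.
  by rewrite ge0_integral_pushforward//; apply: measurableT_comp.
split => //; apply: EFin_inj; rewrite -(EFin_Ex iXY) EFinM -(EFin_Ex Xi) -(EFin_Ex Yi).
transitivity (\int[m1 \x m2]_p h p)%E.
  rewrite (eq_measure_integral m)//; last by move=> E mE _; exact: joint.
  by rewrite integral_pushforward.
rewrite -integral12_prod_meas1// /fubini_F.
have inner x : (\int[m2]_y h (x, y) = x%:E * \int[P]_w (Y w)%:E)%E.
  have mid : measurable_fun [set: R] (fun y : R => y%:E) by exact/measurable_EFinP.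
  rewrite -(@integral_distribution _ _ _ _ _ P Y' (fun y => y%:E))//.
  rewrite -integralZl//.
  by apply: integrable_pushforward.
under eq_integral do rewrite inner.
have mid : measurable_fun [set: R] (fun y : R => y%:E) by exact/measurable_EFinP.
rewrite (EFin_Ex Yi) integralZr//; last exact: integrable_pushforward.
by rewrite (@integral_distribution _ _ _ _ _ P X' (fun y => y%:E)).
Qed.

End independence.

(** * Centered Gaussian variables *)

Section centered_gaussian.
Context {R : realType}.
Local Notation gauss1 := (@normal_prob R 0 1).
Local Notation mu := (@lebesgue_measure R).

Lemma normal_prob_itv_le (a b : R) : a <= b ->
  (gauss1 `[a, b[ <= (normal_peak 1 * (b - a))%:E)%E.
Proof.
move=> ab; rewrite /normal_prob.
have -> : (normal_peak 1 * (b - a))%:E =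
    (\int[mu]_(x in `[a, b[) (normal_peak (1 : R))%:E)%E.
  rewrite integral_cst//= lebesgue_measure_itv/= lte_fin.
  rewrite lt_neqAle ab andbT; case: eqVneq => [->|_] /=.
    by rewrite subrr mulr0 mule0.
  by rewrite -EFinB -EFinM.
apply: ge0_le_integral => //=.
- by move=> x _; rewrite lee_fin normal_pdf_ge0.
- by apply/measurable_EFinP/measurable_funTS; exact: measurable_normal_pdf.
- by move=> x _; rewrite lee_fin normal_pdf_ub ?oner_eq0.
Qed.

(** Open rays are chosen to match the generators of the Borel sets in [centered_gaussian_of_cdf]. *)
Definition gauss_cdf (x : R) : R := fine (gauss1 `]-oo, x[).

Lemma EFin_gauss_cdf x : (gauss_cdf x)%:E = gauss1 `]-oo, x[.
Proof. by rewrite fineK// fin_num_measure. Qed.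

Lemma gauss_cdf_lip (x y : R) :
  `|gauss_cdf x - gauss_cdf y| <= normal_peak 1 * `|x - y|.
Proof.
wlog xy : x y / x <= y.
  move=> h; have [xy|/ltW yx] := leP x y; first exact: h.
  by rewrite distrC [X in _ * X]distrC h.
have -> : gauss_cdf y = gauss_cdf x + fine (gauss1 `[x, y[).
  apply: EFin_inj; rewrite EFinD !EFin_gauss_cdf fineK ?fin_num_measure//.
  rewrite -measureU//.
    congr (gauss1 _); apply/seteqP; split => z /=; rewrite !in_itv/=.
      by move=> zy; have [xz|zx] := leP x z; [right; rewrite ?xz|left].
    by move=> [|/andP[]//]; move=> /lt_le_trans; exact.
  apply/seteqP; split => // z [] /=; rewrite !in_itv/= => zx /andP[xz _].
  by move: (lt_le_trans zx xz); rewrite ltxx.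
rewrite opprD addrA subrr sub0r normrN ger0_norm ?fine_ge0//.
rewrite -lee_fin fineK ?fin_num_measure// (le_trans (normal_prob_itv_le xy))//.
by rewrite lee_fin ler_wpM2l ?normal_peak_ge0// distrC ler_norm.
Qed.

(** By 1 + y <= e^y at y = x^2 / 4, x^2 e^{-x^2/2} <= 4 e^{-x^2/4}, and the right-hand side is a
    multiple of the density of N(0, 2). *)
Lemma L2_gauss1 : L2 gauss1 (fun x : measurableTypeR R => x : R).
Proof.
apply: ge0_integral_lty_L2; first exact: measurable_id.
rewrite ge0_integral_normal_prob//; last 2 first.
- by apply/measurable_EFinP; exact: measurable_funX.
- by move=> x; rewrite lee_fin sqr_ge0.
pose t : R := Num.sqrt 2.
have t0 : t != 0 by rewrite gt_eqF// sqrtr_gt0.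
pose K : R := 4 * normal_peak 1 / normal_peak t.
have K0 : 0 <= K by rewrite divr_ge0// ?mulr_ge0 ?normal_peak_ge0.
have mpdf m u : measurable_fun [set: R] (fun x : R => (normal_pdf m u x)%:E).
  by apply/measurable_EFinP; exact: measurable_normal_pdf.
apply: (@le_lt_trans _ _ (\int[mu]_x (K%:E * (normal_pdf 0 t x)%:E))%E).
  apply: ge0_le_integral => //.
  - by move=> x _; rewrite mule_ge0// lee_fin ?sqr_ge0 ?normal_pdf_ge0.
  - apply: emeasurable_funM; last exact: mpdf.
    by apply/measurable_EFinP; exact: measurable_funX.
  - by apply: emeasurable_funM; [exact: measurable_cst|exact: mpdf].
  move=> x _; rewrite -!EFinM lee_fin !normal_pdfE ?oner_eq0//.
  rewrite /K.
  have -> : 4 * normal_peak 1 / normal_peak t * (normal_peak t * normal_fun 0 t x) =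
      normal_peak 1 * (4 * normal_fun 0 t x).
    by field; rewrite gt_eqF// normal_peak_gt0.
  rewrite [leLHS]mulrCA ler_wpM2l ?normal_peak_ge0// /normal_fun.
  rewrite sqr_sqrtr// expr1n subr0.
  set e := expR (- x ^+ 2 / (2 *+ 2)).
  have -> : expR (- x ^+ 2 / (1 *+ 2)) = e * e.
    by rewrite /e -expRD; congr expR; field.
  rewrite mulrA ler_pM2r ?expR_gt0// /e mulNr expRN.
  rewrite ler_pdivrMr ?expR_gt0//.
  have := expR_ge1Dx (x ^+ 2 / (2 *+ 2)); lra.
rewrite ge0_integralZl//; last by move=> x _; rewrite lee_fin normal_pdf_ge0.
  by rewrite integral_normal_pdf mule1 ltry.
exact: mpdf.
Qed.

(* The second moment of N(0, 1): it equals 1, but only its positivity is needed. *)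
Definition gauss_m2 : R := Ex gauss1 (fun x : measurableTypeR R => (x : R) ^+ 2).

(** If the moment vanished, Chebyshev's inequality would put the whole mass in [-e, e[ for every e >
    0; but the density is at most [normal_peak 1], so for e = 1 / (4 [normal_peak 1]) this interval
    has mass at most 1/2. *)
Lemma gauss_m2_gt0 : 0 < gauss_m2.
Proof.
rewrite lt_neqAle eq_sym Ex_ge0 ?andbT; last by move=> x; exact: sqr_ge0.
apply/eqP => m20.
have p0 : 0 < normal_peak (1 : R) by rewrite normal_peak_gt0// oner_eq0.
pose e : R := (4 * normal_peak 1)^-1.
have e0 : 0 < e by rewrite invr_gt0 mulr_gt0.
have := Ex_chebyshev L2_gauss1 e0; rewrite [Ex _ _]m20 mul0r => h.
have /esym := probability_setT gauss1.
have -> : [set: measurableTypeR R] =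
    [set w : R | (e <= `|w|)%R] `|` `[- e, e[%classic.
  apply/seteqP; split => // x _ /=; rewrite in_itv/=.
  have [ex|xe] := leP e `|x|; first by left.
  by right; move: xe; rewrite ltr_norml => /andP[/ltW -> ->].
move/eqP; apply/negP; rewrite gt_eqF//.
apply: (@le_lt_trans _ _ (gauss1 [set w : R | (e <= `|w|)%R] + gauss1 `[(- e)%R, e[)%E).
  apply: measureU2 => //.
  exact: (@measurable_norm_ge R _ (measurableTypeR R) (fun x => x) e (@measurable_id _ _ _)).
apply: (@le_lt_trans _ _ (0 + (normal_peak 1 * (e - - e))%:E)%E).
  by apply: leeD => //; apply: normal_prob_itv_le; rewrite ge0_cp// ltW.
rewrite add0e lte_fin opprK /e.
have -> : normal_peak 1 * ((4 * normal_peak 1)^-1 + (4 * normal_peak 1)^-1) = 2^-1 :> R.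
  by field; rewrite gt_eqF.
by rewrite invf_lt1// ltr1n.
Qed.

Section random_variable.
Context {disp : measure_display} {Omega : measurableType disp}.
Variable P : probability Omega R.
Implicit Types Z W : Omega -> R.

Definition centered_gaussian Z (s : R) : Prop :=
  measurable_fun [set: Omega] Z /\
  forall U : set R, measurable U -> P (Z @^-1` U) = gauss_law 0 s U.

Lemma centered_gaussian_norm Z s :
  centered_gaussian Z s -> centered_gaussian Z `|s|.
Proof. by move=> [mZ Zs]; split=> // U mU; rewrite -gauss_law_norm Zs. Qed.

Lemma centered_gaussian_is_gaussian Z s : centered_gaussian Z s -> is_gaussian P Z.
Proof. by move=> [mZ Zs]; split => //; exists 0, s. Qed.

Lemma centered_gaussian_comp Z s (f : R -> R) : centered_gaussian Z s ->
  measurable_fun [set: R] f ->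
  L1 gauss1 (fun x : measurableTypeR R => f (s * x)) ->
  L1 P (fun w => f (Z w)) /\
  Ex P (fun w => f (Z w)) = Ex gauss1 (fun x : measurableTypeR R => f (s * x)).
Proof.
move=> [mZ Zs] mf fi.
have ms : measurable_fun [set: measurableTypeR R]
    (fun x : measurableTypeR R => s * x : R) by exact: measurable_mulr_fun.
pose m := image_measure P mZ; pose m' := image_measure gauss1 ms.
have mm' (E : set R) : measurable E -> E `<=` setT -> m' E = m E.
  by move=> mE _; exact: etrans (esym (gauss_lawE s mE)) (esym (Zs _ mE)).
have mEf : measurable_fun [set: R] (EFin \o f) by exact/measurable_EFinP.
have L1f : L1 P (fun w => f (Z w)).
  apply/integrableP; split; first by apply/measurable_EFinP; exact: measurableT_comp.
  have /integrableP[_] := fi.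
  have <- := @ge0_integral_pushforward _ _ _ _ _ _ ms gauss1 setT
    (fun y => `|(f y)%:E|%E) measurableT (measurableT_comp _ mEf) _ => //.
  have <- := @ge0_integral_pushforward _ _ _ _ _ _ mZ P setT
    (fun y => `|(f y)%:E|%E) measurableT (measurableT_comp _ mEf) _ => //.
  by rewrite (@eq_measure_integral _ _ R setT m m' _ mm').
split => //; apply: EFin_inj; rewrite -!EFin_Ex//.
have /= <- := @integral_pushforward _ _ _ _ _ _ mZ P setT _ mEf L1f measurableT.
have /= <- := @integral_pushforward _ _ _ _ _ _ ms gauss1 setT _ mEf fi measurableT.
by rewrite (@eq_measure_integral _ _ R setT m m' _ mm').
Qed.

Lemma centered_gaussian_L2 Z s : centered_gaussian Z s ->
  L2 P Z /\ Ex P (fun w => Z w ^+ 2) = s ^+ 2 * gauss_m2.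
Proof.
move=> Zs; have [mZ _] := Zs.
have sqi : L1 gauss1 (fun x : measurableTypeR R => (s * x) ^+ 2).
  have [_ h] := L2Z s L2_gauss1; exact: h.
have msq : measurable_fun [set: R] (fun x : R => x ^+ 2) by exact: measurable_funX.
have [Z2 EZ2] := centered_gaussian_comp Zs msq sqi.
split; first by split.
rewrite EZ2 -ExZ; last by have [] := L2_gauss1.
by congr Ex; apply/funext => x; rewrite exprMn.
Qed.

End random_variable.

(** Symmetry: the identity is also centered Gaussian with s = -1, so the mean equals its
    opposite. *)
Lemma gauss1_Ex : Ex gauss1 (fun x : measurableTypeR R => x : R) = 0.
Proof.
have cg : centered_gaussian gauss1 (fun x : measurableTypeR R => x : R) (-1).
  split; first exact: measurable_id.
  move=> U mU; rewrite gauss_law_norm normrN normr1 /gauss_law.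
  by rewrite (negbTE (oner_neq0 _)).
have gi := L2_L1 (L2Z (-1) L2_gauss1).
have [_ /=] := centered_gaussian_comp cg (@measurable_id _ R setT) gi.
rewrite ExZ; last exact: L2_L1 L2_gauss1.
by rewrite mulN1r => /eqP; rewrite -addr_eq0 -mulr2n mulrn_eq0 => /eqP.
Qed.

Section random_variable2.
Context {disp : measure_display} {Omega : measurableType disp}.
Variable P : probability Omega R.
Implicit Types Z W : Omega -> R.

Lemma centered_gaussian_Ex Z s : centered_gaussian P Z s -> Ex P Z = 0.
Proof.
move=> Zs; have gi := L2_L1 (L2Z s L2_gauss1).
have [_ ->] := centered_gaussian_comp Zs (@measurable_id _ R setT) gi.
by rewrite ExZ ?gauss1_Ex ?mulr0//; exact: L2_L1 L2_gauss1.
Qed.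

(* The event Q carries the remaining coordinates of an increment, so that the
   product formula for a vector can be consumed one coordinate at a time. *)
Lemma centered_gaussian_conv (Q : set Omega) (S Y : Omega -> R) (a b c : R) :
  measurable Q -> measurable_fun [set: Omega] S -> measurable_fun [set: Omega] Y ->
  (forall U V : set R, measurable U -> measurable V ->
    P (S @^-1` U `&` (Y @^-1` V `&` Q)) =
    (gauss_law 0 a U * gauss_law 0 b V * P Q)%E) ->
  forall U : set R, measurable U ->
    P ((fun w => S w + c * Y w) @^-1` U `&` Q) =
    (gauss_law 0 (Num.sqrt (a ^+ 2 + (c * b) ^+ 2)) U * P Q)%E.
Proof.
move=> mQ mS mY SYQ U mU.
have mSY := measurable_fun_pair mS mY.
have mab : measurable_fun [set: measurableTypeR R * measurableTypeR R]
    (fun p : measurableTypeR R * measurableTypeR R => (a * p.1, b * p.2) : R * R).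
  apply: measurable_fun_pair.
    by apply: measurableT_comp (measurable_fst); exact: measurable_mulr_fun.
  by apply: measurableT_comp (measurable_snd); exact: measurable_mulr_fun.
pose m := image_measure (mrestr P mQ) mSY.
have PQ0 : 0 <= fine (P Q) by rewrite fine_ge0.
pose m' := mscale (NngNum PQ0) (image_measure (gauss1 \x gauss1)%E mab).
have mm' E : measurable E -> m E = m' E.
  apply: measure_rectangles_unique.
    rewrite /m/= /pushforward/= /mrestr/= preimage_setT setTI.
    by rewrite (le_lt_trans (probability_le1 _ mQ))// ltry.
  move=> V W mV mW; rewrite /m/= /pushforward/= /mrestr/=.
  transitivity (P (S @^-1` V `&` (Y @^-1` W `&` Q))).
    by congr (P _); rewrite setIA.
  rewrite SYQ// /m'/= /mscale/= fineK ?fin_num_measure// muleC; congr (_ * _)%E.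
  rewrite !gauss_lawE// -product_measure1E//;
    by rewrite -[X in measurable X]setTI; exact: measurable_mulr_fun.
have mE : measurable [set p : R * R | U (p.1 + c * p.2)].
  rewrite -[X in measurable X]setTI.
  by apply: (measurable_funD measurable_fst (measurable_funM _ measurable_snd)).
apply: etrans (mm' _ mE) _.
rewrite /m'/= /mscale/= fineK ?fin_num_measure// muleC.
congr (_ * _)%E; rewrite -(gauss_law_conv a (c * b) mU).
congr ((gauss1 \x gauss1)%E _); apply/seteqP; split => -[x y] /=; by rewrite mulrA.
Qed.

Lemma continuous_gauss_cdf : continuous gauss_cdf.
Proof.
move=> x; apply/cvgrPdist_lt => e e0.
have p0 : 0 < normal_peak (1 : R) by rewrite normal_peak_gt0// oner_eq0.
apply/nbhs_ballP; exists (e / normal_peak 1); first exact: divr_gt0.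
move=> y xy; rewrite (le_lt_trans (gauss_cdf_lip _ _))//.
by rewrite mulrC -ltr_pdivlMr.
Qed.

Lemma centered_gaussian_cdf Z s x : centered_gaussian P Z s -> 0 < s ->
  P (Z @^-1` `]-oo, x[) = (gauss_cdf (x / s))%:E.
Proof.
move=> [mZ Zs] s0; rewrite Zs; last exact: measurable_itv.
rewrite gauss_lawE; last exact: measurable_itv.
rewrite EFin_gauss_cdf; congr (gauss1 _).
by apply/seteqP; split => y /=; rewrite !in_itv/= ltr_pdivlMr// mulrC.
Qed.

Lemma centered_gaussian_of_cdf Z s : measurable_fun [set: Omega] Z -> 0 < s ->
  (forall x, P (Z @^-1` `]-oo, x[) = (gauss_cdf (x / s))%:E) ->
  centered_gaussian P Z s.
Proof.
move=> mZ s0 ZF; split => // U mU; rewrite gauss_lawE//.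
have ms : measurable_fun [set: measurableTypeR R]
    (fun x : measurableTypeR R => s * x : R) by exact: measurable_mulr_fun.
change (image_measure P mZ U = image_measure gauss1 ms U).
apply: (measure_unique (@RGenInftyO.G R) (fun n => `]-oo, n%:R[%classic)) => //.
- exact: RGenInftyO.measurableE.
- move=> _ _ [x ->] [y ->]; exists (Num.min x y).
  by apply/seteqP; split => z /=; rewrite !in_itv/= lt_min => /andP.
- by move=> n; exists n%:R.
- apply/seteqP; split => // x _; exists (Num.truncn `|x|).+1 => //=.
  rewrite in_itv/= (le_lt_trans (ler_norm x))//.
  by have /andP[] := truncn_itv (normr_ge0 x).
- move=> _ [x ->]; apply: (etrans (ZF x)); rewrite EFin_gauss_cdf.
  congr (gauss1 _); apply/seteqP; split => y /=; by rewrite !in_itv/= ltr_pdivlMr// mulrC.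
- move=> n; apply: (@le_lt_trans _ _ 1%E); last by rewrite ltry.
  apply: probability_le1; rewrite -[X in measurable X]setTI.
  by apply: mZ => //; exact: measurable_itv.
Qed.

Lemma L2_eq0 Z : L2 P Z -> Ex P (fun w => Z w ^+ 2) = 0 ->
  centered_gaussian P Z 0.
Proof.
move=> Z2 EZ; have [mZ iZ] := Z2; split => // U mU; rewrite /gauss_law eqxx.
have Z0 : {ae P, forall w, Z w = 0}.
  have : ae_eq P setT (fun w => (Z w ^+ 2)%:E) (cst 0%E).
    apply/(ae_eq_integral_abs P measurableT).
      by apply/measurable_EFinP; exact: measurable_funX.
    under eq_integral do rewrite gee0_abs ?lee_fin ?sqr_ge0//.
    by rewrite EFin_Ex// EZ.
  apply: filterS => w /(_ I)/= [] /eqP.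
  by rewrite sqrf_eq0 => /eqP.
have PV0 (V : set R) : measurable V -> ~ V 0 -> P (Z @^-1` V) = 0%E.
  move=> mV V0; apply: measure_negligible.
    by rewrite -[X in measurable X]setTI; exact: mZ.
  apply: negligibleS Z0 => w /= Vw Zw; apply: V0; by rewrite -Zw.
rewrite diracE; case: (boolP (0 \in U)) => [/set_mem U0|/negP/= U0].
  rewrite -[Z @^-1` U]setCK preimage_setC probability_setC.
    by rewrite PV0 ?sube0//; exact: measurableC.
  rewrite -[X in measurable X]setTI; apply: mZ => //; exact: measurableC.
by rewrite PV0// => /mem_set.
Qed.

(** The scales s_n converge because s_n^2 [gauss_m2] = E W_n^2 tends to E Z^2. Then P(Z < x) is
    squeezed, up to e_n, between P(W_n < x - e_n) and P(W_n < x + e_n), and both tend to the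
    Gaussian distribution function at x / sg. *)
Lemma centered_gaussian_closure Z : measurable_fun [set: Omega] Z ->
  (forall e : R, 0 < e -> exists W s, [/\ centered_gaussian P W s,
    L2 P (fun w => W w - Z w) & Ex P (fun w => (W w - Z w) ^+ 2) < e]) ->
  exists s, centered_gaussian P Z s.
Proof.
move=> mZ cl.
pose e n : R := n.+1%:R^-1.
have e0 n : 0 < e n by rewrite invr_gt0.
have e1 n : e n <= 1 by rewrite invf_le1// ler1n.
(* With the cube, Chebyshev's inequality at level e_n leaves a probability of at most e_n. *)
have cl' n : exists Ws : (Omega -> R) * R, [/\ centered_gaussian P Ws.1 Ws.2,
    0 <= Ws.2, L2 P (fun w => Ws.1 w - Z w) &
    Ex P (fun w => (Ws.1 w - Z w) ^+ 2) < e n ^+ 3].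
  have [W [s [Ws WZ WZe]]] := cl _ (exprn_gt0 3 (e0 n)).
  by exists (W, `|s|); split => //=; exact: (centered_gaussian_norm Ws).
have [Ws WsP] := choice cl'.
pose W n := (Ws n).1; pose s n := (Ws n).2.
have Wg n : centered_gaussian P (W n) (s n) by have [] := WsP n.
have s0 n : 0 <= s n by have [] := WsP n.
have D2 n : L2 P (fun w => W n w - Z w) by have [] := WsP n.
have De n : Ex P (fun w => (W n w - Z w) ^+ 2) < e n ^+ 3 by have [] := WsP n.
have W2 n : L2 P (W n) by have [] := centered_gaussian_L2 (Wg n).
have WE n : Ex P (fun w => W n w ^+ 2) = s n ^+ 2 * gauss_m2.
  by have [] := centered_gaussian_L2 (Wg n).
have Z2 : L2 P Z.
  have := L2B (W2 0%N) (D2 0%N).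
  by under eq_fun do rewrite subKr.
pose a := Ex P (fun w => Z w ^+ 2).
have a0 : 0 <= a by apply: Ex_ge0 => w; exact: sqr_ge0.
have m0 := gauss_m2_gt0.
pose sg := Num.sqrt (a / gauss_m2).
have s2 n : `|s n ^+ 2 * gauss_m2 - a| <= e n * (a + 2).
  rewrite -WE /a -ExB; [|by have [] := W2 n|by have [] := Z2].
  apply: le_trans (Ex_abs _) _.
    by apply: L1B; [have [] := W2 n|have [] := Z2].
  (* For d > 0, |x^2 - y^2| <= d y^2 + (1 + 1/d) (x - y)^2; with d = e_n and the cubic bound both
     terms are O(e_n). *)
  apply: (@le_trans _ _ (Ex P (fun w => e n * Z w ^+ 2 +
      (1 + (e n)^-1) * (W n w - Z w) ^+ 2))).
    apply: Ex_le.
    - by apply: L1_abs; apply: L1B; [have [] := W2 n|have [] := Z2].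
    - by apply: L1D; apply: L1Z; [have [] := Z2|have [] := D2 n].
    move=> w; set x := W n w; set y := Z w; set d := e n.
    have d0 : 0 < d := e0 n.
    have h1 : 0 <= (d * y - (x - y)) ^+ 2 by exact: sqr_ge0.
    have h2 : 0 <= (d * y + (x - y)) ^+ 2 by exact: sqr_ge0.
    rewrite ler_norml -(ler_pM2l d0) -[X in _ && X](ler_pM2l d0).
    have -> : d * (d * y ^+ 2 + (1 + d^-1) * (x - y) ^+ 2) =
        d ^+ 2 * y ^+ 2 + (d + 1) * (x - y) ^+ 2 by field; rewrite gt_eqF.
    apply/andP; split; last by have := sqr_ge0 (x - y); nra.
    rewrite mulrN.
    have -> : d * (d * y ^+ 2 + (1 + d^-1) * (x - y) ^+ 2) =
        d ^+ 2 * y ^+ 2 + (d + 1) * (x - y) ^+ 2 by field; rewrite gt_eqF.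
    by have := sqr_ge0 (x - y); nra.
  rewrite ExD ?ExZ; [|by have [] := D2 n|by have [] := Z2|
    by apply: L1Z; have [] := Z2|by apply: L1Z; have [] := D2 n].
  rewrite mulrDr lerD2l.
  apply: (@le_trans _ _ ((1 + (e n)^-1) * e n ^+ 3)).
    by rewrite ler_wpM2l ?addr_ge0 ?invr_ge0 ?ltW.
  have := e0 n; have := e1 n; set d := e n => d1 d0.
  have -> : (1 + d^-1) * d ^+ 3 = d ^+ 3 + d ^+ 2 by field; rewrite gt_eqF.
  nra.
have ecvg : e @ \oo --> (0 : R) by exact: cvg_harmonic.
have s2cvg : (fun n => s n ^+ 2) @ \oo --> a / gauss_m2.
  have Kcvg : (fun n => e n * ((a + 2) / gauss_m2)) @ \oo --> (0 : R).
    by rewrite -[X in _ --> X](mul0r ((a + 2) / gauss_m2)); apply: cvgM => //; exact: cvg_cst.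
  apply: (@squeeze_cvgr _ _ _ _ (fun n => a / gauss_m2 - e n * ((a + 2) / gauss_m2))
      (fun n => a / gauss_m2 + e n * ((a + 2) / gauss_m2))).
  - near=> n; move: (s2 n); rewrite ler_distl => /andP[h1 h2].
    by rewrite mulrA -mulrBl -mulrDl ler_pdivrMr// ler_pdivlMr// h1 h2.
  - by rewrite -[X in _ --> X]subr0; apply: cvgB => //; exact: cvg_cst.
  - by rewrite -[X in _ --> X]addr0; apply: cvgD => //; exact: cvg_cst.
have scvg : s @ \oo --> sg.
  have -> : s = Num.sqrt \o (fun n => s n ^+ 2).
    by apply/funext => n /=; rewrite sqrtr_sqr ger0_norm.
  by apply: continuous_cvg => //; exact: sqrt_continuous.
(* A vanishing limit scale is settled directly: the limit law is a Dirac mass, and dividing by s_n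
   gives nothing to pass to the limit in. *)
have [a_eq0|aN0] := eqVneq a 0; first by exists 0; exact: L2_eq0.
have sg0 : 0 < sg by rewrite sqrtr_gt0 divr_gt0// lt_neqAle eq_sym aN0.
exists sg; apply: centered_gaussian_of_cdf => // x.
have mI (V : Omega -> R) y : measurable_fun [set: Omega] V ->
    measurable (V @^-1` `]-oo, y[).
  by move=> mV; rewrite -[X in measurable X]setTI; apply: mV => //; exact: measurable_itv.
pose p := fine (P (Z @^-1` `]-oo, x[)).
have pE : p%:E = P (Z @^-1` `]-oo, x[) by rewrite fineK// fin_num_measure//; exact: mI.
rewrite -pE; congr EFin.
have bad n : (P [set w | (e n <= `|W n w - Z w|)%R] <= (e n)%:E)%E.
  apply: le_trans (Ex_chebyshev (D2 n) (e0 n)) _.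
  rewrite lee_fin ler_pdivrMr ?exprn_gt0// -exprS; exact/ltW.
have mbad n : measurable [set w | (e n <= `|W n w - Z w|)%R].
  by apply: measurable_norm_ge; have [] := D2 n.
have up n : 0 < s n -> p <= gauss_cdf ((x + e n) / s n) + e n.
  move=> sn0; rewrite -lee_fin EFinD pE -(centered_gaussian_cdf _ (Wg n))//.
  apply: le_trans (leeD (le_refl _) (bad n)).
  apply: (@le_trans _ _ (P (W n @^-1` `]-oo, (x + e n)%R[ `|`
      [set w | (e n <= `|W n w - Z w|)%R]))); last first.
    by apply: measureU2 => //; apply: mI; have [] := Wg n.
  apply: le_measure; rewrite ?inE; first exact: mI.
    by apply: measurableU => //; apply: mI; have [] := Wg n.
  move=> w /=; rewrite !in_itv/= => Zx.
  have [|h] := leP (e n) `|W n w - Z w|; [by right|left].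
  by move: h; rewrite ltr_norml => /andP[]; lra.
have lo n : 0 < s n -> gauss_cdf ((x - e n) / s n) - e n <= p.
  move=> sn0; rewrite lerBlDr -lee_fin EFinD pE -(centered_gaussian_cdf _ (Wg n))//.
  apply: le_trans (leeD (le_refl _) (bad n)).
  apply: (@le_trans _ _ (P (Z @^-1` `]-oo, x[ `|`
      [set w | (e n <= `|W n w - Z w|)%R]))); last first.
    by apply: measureU2 => //; exact: mI.
  apply: le_measure; rewrite ?inE; first by apply: mI; have [] := Wg n.
    by apply: measurableU => //; exact: mI.
  move=> w /=; rewrite !in_itv/= => Zx.
  have [|h] := leP (e n) `|W n w - Z w|; [by right|left].
  by move: h; rewrite ltr_norml => /andP[]; lra.
have sN0 : \forall n \near \oo, 0 < s n by apply: (cvgr_gt sg).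
have sVcvg : (fun n => (s n)^-1) @ \oo --> sg^-1.
  by apply: cvgV => //; rewrite gt_eqF.
have upcvg : (fun n => gauss_cdf ((x + e n) / s n) + e n) @ \oo --> gauss_cdf (x / sg).
  rewrite -[X in _ --> X]addr0; apply: cvgD => //.
  apply: continuous_cvg; first exact: continuous_gauss_cdf.
  apply: cvgM => //; rewrite -[X in _ --> X]addr0; apply: cvgD => //; exact: cvg_cst.
have locvg : (fun n => gauss_cdf ((x - e n) / s n) - e n) @ \oo --> gauss_cdf (x / sg).
  rewrite -[X in _ --> X]subr0; apply: cvgB => //.
  apply: continuous_cvg; first exact: continuous_gauss_cdf.
  apply: cvgM => //; rewrite -[X in _ --> X]subr0; apply: cvgB => //; exact: cvg_cst.
apply/eqP; rewrite eq_le; apply/andP; split.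
  rewrite -(cvg_lim _ upcvg)//; apply: limr_ge; first by apply/cvg_ex; eexists; exact: upcvg.
  by near=> n; apply: up; near: n.
rewrite -(cvg_lim _ locvg)//; apply: limr_le; first by apply/cvg_ex; eexists; exact: locvg.
by near=> n; apply: lo; near: n.
Unshelve. all: by end_near. Qed.

End random_variable2.
End centered_gaussian.

(** * Wiener increments *)

Section measurable_wrt_theory.
Context {R : realType} {disp : measure_display} {Omega : measurableType disp}.
Variable G : set (set Omega).
Hypothesis sG : sigma_algebra [set: Omega] G.
Implicit Types f g : Omega -> R.

(** A sigma-algebra generates itself, so adaptedness is ordinary measurability on
    [g_sigma_algebraType G], and the closure properties below are inherited. *)
Lemma measurable_wrtP f :
  measurable_wrt G f <-> measurable_fun [set: g_sigma_algebraType G] f.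
Proof.
have GE : G.-sigma.-measurable = G.
  exact: sigma_algebra_id.
split=> [Gf _ U mU|mf U mU].
  rewrite setTI; suff : (G.-sigma.-measurable : set (set Omega)) (f @^-1` U) by [].
  by rewrite GE; exact: Gf.
have := mf measurableT _ mU; rewrite setTI => h.
have : (G.-sigma.-measurable : set (set Omega)) (f @^-1` U) by exact: h.
by rewrite GE.
Qed.

Lemma measurable_wrtD f g : measurable_wrt G f -> measurable_wrt G g ->
  measurable_wrt G (fun w => f w + g w).
Proof.
by move=> /measurable_wrtP mf /measurable_wrtP mg; apply/measurable_wrtP;
  exact: measurable_funD.
Qed.

Lemma measurable_wrtB f g : measurable_wrt G f -> measurable_wrt G g ->
  measurable_wrt G (fun w => f w - g w).
Proof.
by move=> /measurable_wrtP mf /measurable_wrtP mg; apply/measurable_wrtP;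
  exact: measurable_funB.
Qed.

Lemma measurable_wrtM f g : measurable_wrt G f -> measurable_wrt G g ->
  measurable_wrt G (fun w => f w * g w).
Proof.
by move=> /measurable_wrtP mf /measurable_wrtP mg; apply/measurable_wrtP;
  exact: measurable_funM.
Qed.

Lemma measurable_wrt_cst (c : R) : measurable_wrt G (fun=> c).
Proof. by apply/measurable_wrtP; exact: measurable_cst. Qed.

Lemma measurable_wrt_comp f (h : R -> R) : measurable_fun [set: R] h ->
  measurable_wrt G f -> measurable_wrt G (fun w => h (f w)).
Proof.
by move=> mh /measurable_wrtP mf; apply/measurable_wrtP; exact: measurableT_comp.
Qed.

Lemma measurable_wrt_sum I (r : seq I) (f : I -> Omega -> R) :
  (forall i, measurable_wrt G (f i)) ->
  measurable_wrt G (fun w => \sum_(i <- r) f i w).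
Proof.
move=> mf; elim: r => [|i r IH].
  by under eq_fun do rewrite big_nil; exact: measurable_wrt_cst.
by under eq_fun do rewrite big_cons; exact: measurable_wrtD.
Qed.

End measurable_wrt_theory.

Section wiener_increments.
Context {R : realType} {disp : measure_display} {Omega : measurableType disp}.
Variables (P : probability Omega R) (m : nat) (T : R).
Variables (F : R -> set (set Omega)) (B : R -> Omega -> 'cV[R]_m).
Hypothesis W : is_wiener_process P T F B.
Local Notation m2 := (@gauss_m2 R).

Definition incr (j : 'I_m) (a b : R) (w : Omega) : R := (B b w - B a w) j ord0.

Lemma incrD j a b c w : incr j a c w = incr j a b w + incr j b c w.
Proof. by rewrite /incr !mxE; ring. Qed.

Lemma incrxx j a w : incr j a a w = 0.
Proof. by rewrite /incr subrr mxE. Qed.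

Let sF t : 0 <= t -> t < T -> sigma_algebra [set: Omega] (F t).
Proof. by move=> t0 tT; have [[h _ _] _] := W; apply: h; rewrite t0. Qed.

Let subF s t : 0 <= s -> s <= t -> t < T -> F s `<=` F t.
Proof. by move=> s0 st tT; have [[_ _ h] _] := W; exact: h. Qed.

Lemma filtration_measurable t (f : Omega -> R) : 0 <= t -> t < T ->
  measurable_wrt (F t) f -> measurable_fun [set: Omega] f.
Proof.
move=> t0 tT mf _ U mU; rewrite setTI; have [[_ h _] _] := W.
by apply: (h t); [rewrite t0|exact: mf].
Qed.

Lemma filtration_mono s t (f : Omega -> R) : 0 <= s -> s <= t -> t < T ->
  measurable_wrt (F s) f -> measurable_wrt (F t) f.
Proof. by move=> s0 st tT mf U mU; apply: (subF s0 st tT); exact: mf. Qed.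

Lemma incr_adapted j a b t : 0 <= a -> a <= b -> b <= t -> t < T ->
  measurable_wrt (F t) (incr j a b).
Proof.
move=> a0 ab bt tT; have [_ [ad _ _ _ _]] := W.
have tb : 0 <= b < T by rewrite (le_trans a0)//= (le_lt_trans bt).
have ta : 0 <= a < T by rewrite a0 (le_lt_trans (le_trans ab bt)).
rewrite (_ : incr j a b = fun w => B b w j ord0 - B a w j ord0); last first.
  by apply/funext => w; rewrite /incr !mxE.
apply: measurable_wrtB; first exact: sF (le_trans a0 (le_trans ab bt)) tT.
  by apply: (@filtration_mono b) => //; [exact: le_trans ab|exact: ad].
by apply: (@filtration_mono a) => //; [exact: le_trans bt|exact: ad].
Qed.

Lemma incr_measurable j a b : 0 <= a -> a <= b -> b < T ->
  measurable_fun [set: Omega] (incr j a b).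
Proof.
move=> a0 ab bT; apply: (filtration_measurable (le_trans a0 ab) bT).
exact: incr_adapted.
Qed.

Let vec a b w := B b w - B a w.
Let sV a b : sigma_algebra [set: Omega] (sigma_generated_by (vec a b)).
Proof. exact: smallest_sigma_algebra. Qed.

Lemma incr_generated j a b :
  measurable_wrt (sigma_generated_by (vec a b)) (incr j a b).
Proof. by move=> U mU; apply: sub_sigma_algebra; exists j, U. Qed.

Lemma indep_past a b (f g : Omega -> R) : 0 <= a -> a < b -> b < T ->
  measurable_wrt (F a) f -> measurable_wrt (sigma_generated_by (vec a b)) g ->
  independent_rv P f g.
Proof.
move=> a0 ab bT mf mg U V mU mV; have [_ [_ _ ind _ _]] := W.
by apply: (ind _ _ a0 ab bT); [exact: mf|exact: mg].
Qed.

Lemma incr_law a b (U : 'I_m -> set R) : 0 <= a -> a < b -> b < T ->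
  (forall i, measurable (U i)) ->
  P [set w | forall i, U i (incr i a b w)] =
  (\prod_(i < m) gauss_law 0 (Num.sqrt (b - a)) (U i))%E.
Proof.
move=> a0 ab bT mU; have [_ [_ _ _ law _]] := W; rewrite law//.
apply: eq_bigr => i _; rewrite /gauss_law ifF//.
by rewrite gt_eqF// sqrtr_gt0 subr_gt0.
Qed.

Let gauss_lawT (s : R) : gauss_law 0 s [set: R] = 1%E.
Proof. by rewrite gauss_lawE// preimage_setT; exact: probability_setT. Qed.

Lemma incr_gaussian j a b : 0 <= a -> a <= b -> b < T ->
  centered_gaussian P (incr j a b) (Num.sqrt (b - a)).
Proof.
move=> a0 ab bT; split; first exact: incr_measurable.
move=> U mU; move: ab; rewrite le_eqVlt => /predU1P[ab|ab].
  rewrite -ab subrr sqrtr0 /gauss_law eqxx diracE.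
  have -> : incr j a a @^-1` U = if 0 \in U then setT else set0.
    apply/seteqP; split => w /=; rewrite incrxx; case: ifPn => //.
      by rewrite notin_setE.
    by rewrite inE.
  by case: ifP => _; [exact: probability_setT|exact: measure0].
pose V i := if i == j then U else setT.
have -> : incr j a b @^-1` U = [set w | forall i, V i (incr i a b w)].
  apply/seteqP; split => w /=.
    by move=> Uw i; rewrite /V; case: eqP => // ->.
  by move=> /(_ j); rewrite /V eqxx.
rewrite incr_law//; last by move=> i; rewrite /V; case: eqP.
rewrite (bigD1 j)//= big1 ?mule1; first by rewrite /V eqxx.
by move=> i /negbTE ij; rewrite /V ij gauss_lawT.
Qed.

Lemma incr_L2 j a b : 0 <= a -> a <= b -> b < T -> L2 P (incr j a b).
Proof.
by move=> a0 ab bT; have [] := centered_gaussian_L2 (incr_gaussian j a0 ab bT).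
Qed.

Lemma incr_indep i j a b : i != j -> 0 <= a -> a < b -> b < T ->
  independent_rv P (incr i a b) (incr j a b).
Proof.
move=> ij a0 ab bT U V mU mV.
pose Z k := if k == i then U else if k == j then V else setT.
have mZ k : measurable (Z k) by rewrite /Z; case: eqP => // _; case: eqP.
have -> : incr i a b @^-1` U `&` incr j a b @^-1` V =
    [set w | forall k, Z k (incr k a b w)].
  apply/seteqP; split => w /=.
    by move=> [Uw Vw] k; rewrite /Z; case: eqP => [->//|_]; case: eqP => // ->.
  by move=> h; split; [have := h i|have := h j]; rewrite /Z eqxx// eq_sym (negbTE ij).
rewrite incr_law// (bigD1 i)//= (bigD1 j)//=; last by rewrite eq_sym.
rewrite big1 ?mule1; last first.
  by move=> k /andP[/negbTE ki /negbTE kj]; rewrite /Z ki kj gauss_lawT.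
rewrite /Z eqxx eq_sym (negbTE ij) eqxx.
have [_ ->//] := incr_gaussian i a0 (ltW ab) bT.
by have [_ ->//] := incr_gaussian j a0 (ltW ab) bT.
Qed.

(** The increment is centered and independent of [F a]. Independence is available for a < b, so the
    zero increment is treated apart. *)
Lemma Ex_past_incr j a b (G : Omega -> R) : 0 <= a -> a <= b -> b < T ->
  measurable_wrt (F a) G -> L1 P G ->
  L1 P (fun w => G w * incr j a b w) /\ Ex P (fun w => G w * incr j a b w) = 0.
Proof.
move=> a0 ab bT mG iG; have D2 := incr_L2 j a0 ab bT.
move: (ab); rewrite le_eqVlt => /predU1P[eab|ltab].
  have -> : (fun w => G w * incr j a b w) = fun=> 0.
    by apply/funext => w; rewrite -eab incrxx mulr0.
  by rewrite Ex_cst; split => //; exact: L1_cst.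
have [h1 h2] := independent_rv_Ex (indep_past a0 ltab bT mG (@incr_generated j a b)) iG (L2_L1 D2).
by split; rewrite // h2 (centered_gaussian_Ex (incr_gaussian j a0 ab bT)) mulr0.
Qed.

Lemma Ex_past_incr2 i j a b (G : Omega -> R) : 0 <= a -> a <= b -> b < T ->
  measurable_wrt (F a) G -> L1 P G ->
  L1 P (fun w => G w * (incr i a b w * incr j a b w)) /\
  Ex P (fun w => G w * (incr i a b w * incr j a b w)) =
  Ex P G * (i == j)%:R * (b - a) * m2.
Proof.
move=> a0 ab bT mG iG.
have Di := incr_L2 i a0 ab bT; have Dj := incr_L2 j a0 ab bT.
move: (ab); rewrite le_eqVlt => /predU1P[eab|ltab].
  have -> : (fun w => G w * (incr i a b w * incr j a b w)) = fun=> 0.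
    by apply/funext => w; rewrite -eab incrxx mul0r mulr0.
  by rewrite Ex_cst -eab subrr mulr0 mul0r; split => //; exact: L1_cst.
have mij := measurable_wrtM (sV a b) (@incr_generated i a b) (@incr_generated j a b).
have [h1 h2] := independent_rv_Ex (indep_past a0 ltab bT mG mij) iG (L2_L2M Di Dj).
split => //; rewrite h2 -!mulrA; congr (_ * _).
case: eqVneq => [<-|ij].
  have [_ E2] := centered_gaussian_L2 (incr_gaussian i a0 ab bT).
  under eq_fun do rewrite -expr2.
  by rewrite E2 sqr_sqrtr ?subr_ge0// mul1r.
rewrite mul0r; have [_ ->] := independent_rv_Ex (incr_indep ij a0 ltab bT) (L2_L1 Di) (L2_L1 Dj).
by rewrite (centered_gaussian_Ex (incr_gaussian i a0 ab bT)) mul0r.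
Qed.

(** The length of the intersection of ]a, b] and ]a', b']. *)
Definition overlap (a b a' b' : R) : R :=
  Num.max 0 (Num.min b b' - Num.max a a').

(** With a <= a', the first increment is cut at a': the part before a' belongs to the past and
    contributes nothing, and what remains is a pair of increments with a common origin. Arbitrary
    pairs of intervals are allowed so that simple processes on different partitions can be
    compared. *)
Lemma Ex_incr_bilinear i j a b a' b' (xi eta : Omega -> R) :
  0 <= a -> a <= b -> b < T -> 0 <= a' -> a' <= b' -> b' < T ->
  measurable_wrt (F a) xi -> measurable_wrt (F a') eta ->
  (exists C, forall w, `|xi w| <= C) -> (exists C, forall w, `|eta w| <= C) ->
  Ex P (fun w => (xi w * incr i a b w) * (eta w * incr j a' b' w)) =
  Ex P (fun w => xi w * eta w) * (i == j)%:R * overlap a b a' b' * m2.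
Proof.
wlog aa' : i j a b a' b' xi eta / a <= a'.
  move=> h a0 ab bT a'0 a'b' b'T mxi meta bxi beta.
  have [aa'|/ltW a'a] := leP a a'; first exact: h.
  have := h j i a' b' a b eta xi a'a a'0 a'b' b'T a0 ab bT meta mxi beta bxi.
  under [in X in X = _ -> _]eq_fun do rewrite mulrC.
  under [in X in _ = X * _ * _ * _ -> _]eq_fun do rewrite mulrC.
  move=> ->; rewrite eq_sym /overlap.
  by rewrite [Num.min b' b]minC [Num.max a' a]maxC.
move=> a0 ab bT a'0 a'b' b'T mxi meta [C xiC] [C' etaC'].
have a'T : a' < T by exact: le_lt_trans b'T.
have mxi' := filtration_mono a0 aa' a'T mxi.
have Mxi := filtration_measurable a'0 a'T mxi'.
have Meta := filtration_measurable a'0 a'T meta.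
have xi2 := bounded_L2 P Mxi xiC.
have eta2 := bounded_L2 P Meta etaC'.
have sa' := sF a'0 a'T.
have mG := measurable_wrtM sa' mxi' meta.
have iG := L2_L2M xi2 eta2.
(* A product of an [F a']-measurable factor with an increment after [a'] has
   mean zero. *)
have past c d e : 0 <= c -> c <= d -> d <= a' -> a' <= e -> e < T ->
    L1 P (fun w => (xi w * incr i c d w) * (eta w * incr j a' e w)) /\
    Ex P (fun w => (xi w * incr i c d w) * (eta w * incr j a' e w)) = 0.
  move=> c0 cd da' a'e eT.
  have -> : (fun w => (xi w * incr i c d w) * (eta w * incr j a' e w)) =
      fun w => ((xi w * incr i c d w) * eta w) * incr j a' e w.
    by apply/funext => w; ring.
  apply: Ex_past_incr => //.
    by do 2 (apply: measurable_wrtM => //); exact: incr_adapted.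
  apply: L2_L2M => //; apply: L2_boundedM xiC _ => //.
  by apply: incr_L2 => //; exact: le_lt_trans a'T.
have [ba'|a'b] := leP b a'.
  have [_ ->] := past a b b' a0 ab ba' a'b' b'T.
  rewrite /overlap (_ : Num.max 0 _ = 0) ?mulr0 ?mul0r//.
  apply/max_idPl; rewrite subr_le0 ge_min; apply/orP; left.
  by rewrite le_max ba' orbT.
have splitE : (fun w => (xi w * incr i a b w) * (eta w * incr j a' b' w)) =
    fun w => (xi w * incr i a a' w) * (eta w * incr j a' b' w) +
    (xi w * eta w) * (incr i a' b w * incr j a' b' w).
  by apply/funext => w; rewrite (incrD i a a' b); ring.
have [i1 E1] := past a a' b' a0 aa' (lexx _) a'b' b'T.
have Dib := incr_L2 i a'0 (ltW a'b) bT.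
have Djb' := incr_L2 j a'0 a'b' b'T.
have i2 : L1 P (fun w => (xi w * eta w) * (incr i a' b w * incr j a' b' w)).
  have := L2_L2M (L2_boundedM Mxi xiC Dib) (L2_boundedM Meta etaC' Djb').
  congr (L1 P _); apply/funext => w; ring.
rewrite splitE ExD// E1 add0r.
have -> : overlap a b a' b' = Num.min b b' - a'.
  rewrite /overlap (max_idPr aa'); apply/max_idPr.
  by rewrite subr_ge0 le_min (ltW a'b) a'b'.
(* Both increments start at a'. The longer one is cut at the end c of the shorter, and its piece
   after c has mean zero against everything up to c. *)
have nested k l c e : a' <= c -> c <= e -> e < T ->
    Ex P (fun w => (xi w * eta w) * (incr k a' c w * incr l a' e w)) =
    Ex P (fun w => xi w * eta w) * (k == l)%:R * (c - a') * m2.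
  move=> a'c ce eT; have cT := le_lt_trans ce eT.
  have c0 := le_trans a'0 a'c.
  have [j1 F1] := Ex_past_incr2 k l a'0 a'c cT mG iG.
  have Dk := incr_L2 k a'0 a'c cT.
  have G2 : L2 P (fun w => xi w * eta w * incr k a' c w).
    under eq_fun do rewrite -mulrA.
    by apply: L2_boundedM xiC _ => //; exact: L2_boundedM etaC' _.
  have [|j2 F2] := Ex_past_incr l c0 ce eT _ (L2_L1 G2).
    apply: measurable_wrtM; first exact: sF c0 cT.
      exact: filtration_mono a'0 a'c cT mG.
    exact: incr_adapted.
  rewrite -F1 -[RHS]addr0 -F2 -ExD//.
  by congr Ex; apply/funext => w; rewrite (incrD l a' c e); ring.
have [bb'|/ltW b'b] := leP b b'; first exact: nested (ltW a'b) bb' b'T.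
under eq_fun do rewrite [X in _ * X]mulrC.
by rewrite (nested _ _ _ _ a'b' b'b bT) eq_sym.
Qed.

(** The joint law of the coordinates is known on boxes only. The induction moves the coordinates one
    by one from the box into the sum, each time by a convolution. *)
Lemma lin_incr_gaussian (c : 'I_m -> R) a b : 0 <= a -> a <= b -> b < T ->
  exists s, centered_gaussian P (fun w => \sum_j c j * incr j a b w) s.
Proof.
move=> a0; rewrite le_eqVlt => /predU1P[<-|ab] bT.
  exists 0; rewrite (_ : (fun _ => _) = fun=> 0).
    apply: L2_eq0; first exact: L2_cst.
    by rewrite expr0n Ex_cst.
  by apply/funext => w; rewrite big1// => j _; rewrite incrxx mulr0.
pose h := Num.sqrt (b - a).
pose S l w := \sum_(j < m | (j < l)%N) c j * incr j a b w.
have mincr j : measurable_fun [set: Omega] (incr j a b).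
  exact: incr_measurable (ltW ab) bT.
have mS l : measurable_fun [set: Omega] (S l).
  rewrite /S; under eq_fun do rewrite big_mkcond.
  have mf (j : 'I_m) : measurable_fun [set: Omega]
      (fun w => if (j < l)%N then c j * incr j a b w else 0).
    by case: (j < l)%N => //; exact: measurable_funM.
  exact: measurable_sum.
(* The partial sum of the first l terms has a Gaussian law jointly with, and independently of, the
   coordinates that remain in the box. *)
have claim l : (l <= m)%N -> exists s, forall (U : set R) (V : 'I_m -> set R),
    measurable U -> (forall i, measurable (V i)) ->
    P (S l @^-1` U `&` [set w | forall i : 'I_m, (l <= i)%N -> V i (incr i a b w)]) =
    (gauss_law 0 s U * \prod_(i < m | (l <= i)%N) gauss_law 0 h (V i))%E.
  elim: l => [_|l IH lm].
    exists 0 => U V mU mV.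
    rewrite /gauss_law eqxx diracE.
    have S0 w : S 0%N w = 0 by rewrite /S big_pred0.
    case: (boolP (0 \in U)) => [/set_mem U0|/negP U0].
      rewrite mul1e -incr_law//; congr (P _); apply/seteqP; split => w /=.
        by move=> [_ Vw] i; exact: Vw.
      by move=> Vw; split => [|i _]; rewrite ?S0.
    rewrite mul0e -[RHS](measure0 P); congr (P _).
    by apply/seteqP; split => // w /= [+ _]; rewrite S0 => /mem_set.
  have [s IHs] := IH (ltnW lm).
  pose il := Ordinal lm.
  exists (Num.sqrt (s ^+ 2 + (c il * h) ^+ 2)) => U V mU mV.
  set Q := [set w | _].
  have mQ : measurable Q.
    apply: (@fin_bigcap_measurable _ _ _ [set i : 'I_m | (l < i)%N]
      (fun i => incr i a b @^-1` V i)) => // i _.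
    by rewrite -[X in measurable X]setTI; exact: mincr.
  have SE w : S l.+1 w = S l w + c il * incr il a b w.
    rewrite /S (bigD1 il)//= addrC; congr (_ + _); apply: eq_bigl => j.
    by rewrite ltnS ltn_neqAle andbC.
  have SQ U' V' : measurable U' -> measurable V' ->
      P (S l @^-1` U' `&` (incr il a b @^-1` V' `&` Q)) =
      (gauss_law 0 s U' * (gauss_law 0 h V' *
       \prod_(i < m | (l < i)%N) gauss_law 0 h (V i)))%E.
    move=> mU' mV'.
    pose V2 i := if i == il then V' else V i.
    have mV2 i : measurable (V2 i) by rewrite /V2; case: eqP.
    have H := IHs U' V2 mU' mV2.
    rewrite (bigD1 il)//= in H.
    transitivity (P (S l @^-1` U' `&`
        [set w | forall i : 'I_m, (l <= i)%N -> V2 i (incr i a b w)])).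
      congr (P _); apply/seteqP; split => w /= [SU hV]; split => //.
        move: hV => [h1 h2] i li; rewrite /V2; case: eqVneq => [->//|ne].
        by apply: h2; rewrite ltn_neqAle li andbT eq_sym; exact: ne.
      split; first by have := hV il (leqnn _); rewrite /V2 eqxx.
      move=> i li; have := hV i (ltnW li); rewrite /V2; case: eqP => // ei.
      by move: li; rewrite ei ltnn.
    rewrite H; congr (_ * (_ * _))%E; first by rewrite /V2 eqxx.
    apply: eq_big => [i|i /andP[_ /negbTE ie]]; last by rewrite /V2 ie.
    by rewrite ltn_neqAle andbC eq_sym.
  (* Full sets for the other two factors identify the remaining product with [P Q]. *)
  have PQ : P Q = (\prod_(i < m | (l < i)%N) gauss_law 0 h (V i))%E.
    have := SQ setT setT measurableT measurableT.
    by rewrite !preimage_setT !setTI !gauss_lawT !mul1e.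
  have SQ' U' V' : measurable U' -> measurable V' ->
      P (S l @^-1` U' `&` (incr il a b @^-1` V' `&` Q)) =
      (gauss_law 0 s U' * gauss_law 0 h V' * P Q)%E.
    by move=> mU' mV'; rewrite SQ// -PQ muleA.
  rewrite -PQ -(centered_gaussian_conv (c il) mQ (mS l) (mincr il) SQ' mU).
  by congr (P (_ `&` _)); apply/seteqP; split => w /=; rewrite SE.
have [s hs] := claim m (leqnn m); exists s; split.
  by have := mS m; congr measurable_fun; apply/funext => w; apply: eq_bigl => j; rewrite ltn_ord.
move=> U mU; have := hs U (fun=> setT) mU (fun=> measurableT).
rewrite big_pred0 ?mule1 => [<-|i]; last by rewrite leqNgt ltn_ord.
congr (P _); apply/seteqP; split => w /=.
  move=> Uw; split => //; rewrite /S; congr (U _): Uw; apply: eq_bigl => j.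
  by rewrite ltn_ord.
by move=> [Uw _]; congr (U _): Uw; apply: eq_bigl => j; rewrite ltn_ord.
Qed.

(** * Sums over a grid and Kolmogorov's inequality *)

Section grid.
Variable s : nat -> R.
Hypothesis s0 : 0 <= s 0.
Hypothesis s_mono : forall k, s k <= s k.+1.

Let s_ge0 k : 0 <= s k.
Proof. by elim: k => // k IH; exact: le_trans (s_mono k). Qed.

(** Each new block of increments is independent of the sum before it, so the laws convolve.
    Measurability of the partial sum with respect to [F (s N)] is carried in the induction because
    it is what gives this independence. *)
Lemma grid_gaussian (c : nat -> 'I_m -> R) N : s N < T ->
  exists sg, centered_gaussian P
    (fun w => \sum_(k < N) \sum_j c k j * incr j (s k) (s k.+1) w) sg.
Proof.
suff : s N < T -> measurable_wrt (F (s N))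
      (fun w => \sum_(k < N) \sum_j c k j * incr j (s k) (s k.+1) w) /\
    exists sg, centered_gaussian P
      (fun w => \sum_(k < N) \sum_j c k j * incr j (s k) (s k.+1) w) sg.
  by move=> h sT; have [] := h sT.
elim: N => [|N IH] sT.
  under eq_fun do rewrite big_ord0.
  split; first exact: measurable_wrt_cst (sF s0 sT) _.
  by exists 0; apply: L2_eq0; [exact: L2_cst|rewrite expr0n Ex_cst].
have sNT : s N < T := le_lt_trans (s_mono N) sT.
have [mZ [sg Zg]] := IH sNT.
have [t Yt] := lin_incr_gaussian (c N) (s_ge0 N) (s_mono N) sT.
set Z := fun w => _ in mZ Zg; set Y := fun w => _ in Yt.
have -> : (fun w => \sum_(k < N.+1) \sum_j c k j * incr j (s k) (s k.+1) w) =
    fun w => Z w + 1 * Y w.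
  by apply/funext => w; rewrite big_ord_recr/= mul1r.
split.
  under eq_fun do rewrite mul1r.
  apply: measurable_wrtD; first exact: sF (s_ge0 N.+1) sT.
    exact: filtration_mono (s_ge0 N) (s_mono N) sT mZ.
  apply: measurable_wrt_sum; first exact: sF (s_ge0 N.+1) sT.
  move=> j; apply: measurable_wrtM; first exact: sF (s_ge0 N.+1) sT.
    exact: measurable_wrt_cst (sF (s_ge0 N.+1) sT) _.
  by apply: incr_adapted => //; exact: s_mono.
have ZY : independent_rv P Z Y.
  have := s_mono N; rewrite le_eqVlt => /predU1P[e|lt].
    move=> U V mU mV.
    have Y0 w : Y w = 0 by rewrite /Y -e big1// => j _; rewrite incrxx mulr0.
    have -> : Y @^-1` V = if 0 \in V then setT else set0.
      apply/seteqP; split => w /=; rewrite Y0; case: ifPn => //.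
        by rewrite notin_setE.
      by rewrite inE.
    case: ifP => _; first by rewrite setIT probability_setT mule1.
    by rewrite setI0 measure0 mule0.
  apply: (indep_past (s_ge0 N) lt sT mZ).
  apply: measurable_wrt_sum; first exact: sV.
  move=> j; apply: measurable_wrtM; first exact: sV.
    exact: measurable_wrt_cst (sV _ _) _.
  exact: incr_generated.
exists (Num.sqrt (sg ^+ 2 + (1 * t) ^+ 2)); split.
  by apply: measurable_funD; [have [] := Zg|apply: measurable_funM => //; have [] := Yt].
move=> U mU.
have [mZ' Zlaw] := Zg; have [mY' Ylaw] := Yt.
have ZYT U' V' : measurable U' -> measurable V' ->
    P (Z @^-1` U' `&` (Y @^-1` V' `&` setT)) =
    (gauss_law 0 sg U' * gauss_law 0 t V' * P setT)%E.
  by move=> mU' mV'; rewrite setIT probability_setT mule1 ZY// Zlaw// Ylaw.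
have := centered_gaussian_conv 1 measurableT mZ' mY' ZYT mU.
by rewrite setIT probability_setT mule1.
Qed.

(* The walk frozen as soon as it leaves ]-e, e[; it replaces the stopping time
   in the proof of Kolmogorov's inequality. *)
Fixpoint frozen (j : 'I_m) (e : R) (n : nat) (w : Omega) : R :=
  if n is k.+1 then
    frozen j e k w + \1_`]- e, e[ (frozen j e k w) * incr j (s k) (s k.+1) w
  else 0.

Let s_homo k n : (k <= n)%N -> s k <= s n.
Proof.
elim: n => [|n IH]; first by rewrite leqn0 => /eqP ->.
rewrite leq_eqVlt => /predU1P[->//|]; rewrite ltnS => /IH kn.
exact: le_trans (s_mono n).
Qed.

(** Whether the next increment is added is decided at its left end, so the cross term has mean zero;
    the indicator is at most 1, so a step adds at most the variance of the increment. *)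
Lemma frozen_L2 j e n : s n < T ->
  [/\ measurable_wrt (F (s n)) (frozen j e n), L2 P (frozen j e n) &
      Ex P (fun w => frozen j e n w ^+ 2) <= m2 * (s n - s 0)].
Proof.
elim: n => [|n IH] sT.
  split; [exact: measurable_wrt_cst (sF s0 sT) _|exact: L2_cst|].
  by rewrite /= expr0n Ex_cst subrr mulr0.
have snT := le_lt_trans (s_mono n) sT.
have [mZ Z2 EZ] := IH snT.
set Z := frozen j e n in mZ Z2 EZ.
pose xi w : R := \1_`]- e, e[ (Z w).
pose D := incr j (s n) (s n.+1).
have sFn := sF (s_ge0 n) snT; have sFn1 := sF (s_ge0 n.+1) sT.
have mxi : measurable_wrt (F (s n)) xi.
  by apply: measurable_wrt_comp => //; exact: measurable_indic.
have xi1 w : `|xi w| <= 1.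
  by rewrite /xi indicE; case: (_ \in _); rewrite ?normr1 ?normr0.
have Mxi := filtration_measurable (s_ge0 n) snT mxi.
have D2 : L2 P D := incr_L2 j (s_ge0 n) (s_mono n) sT.
have xi2 : L2 P xi := bounded_L2 P Mxi xi1.
have xiZ2 : L2 P (fun w => xi w * Z w) := L2_boundedM Mxi xi1 Z2.
have xiD2 : L2 P (fun w => xi w * D w) := L2_boundedM Mxi xi1 D2.
split.
- apply: measurable_wrtD => //.
    exact: filtration_mono (s_ge0 n) (s_mono n) sT mZ.
  apply: measurable_wrtM => //.
    exact: filtration_mono (s_ge0 n) (s_mono n) sT mxi.
  exact: incr_adapted.
- exact: L2D.
have [i1 E1] := Ex_past_incr j (s_ge0 n) (s_mono n) sT
  (measurable_wrtM sFn mxi mZ) (L2_L1 xiZ2).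
have [i2 E2] := Ex_past_incr2 j j (s_ge0 n) (s_mono n) sT
  (measurable_wrtM sFn mxi mxi) (L2_L2M xi2 xi2).
have -> : (fun w => frozen j e n.+1 w ^+ 2) = fun w => (Z w ^+ 2 +
    2 * (xi w * Z w * D w)) + (xi w * xi w) * (D w * D w).
  by apply/funext => w; rewrite /= -/(Z w) -/(xi w) -/(D w); ring.
have iZ : L1 P (fun w => Z w ^+ 2) by have [] := Z2.
rewrite ExD//; last by apply: L1D => //; exact: L1Z.
rewrite ExD//; last exact: L1Z.
rewrite ExZ// E1 mulr0 addr0 E2 eqxx mulr1.
have xile : Ex P (fun w => xi w * xi w) <= 1.
  rewrite -[leRHS](Ex_cst P); apply: Ex_le; [exact: L2_L2M|exact: L1_cst|].
  move=> w; rewrite -expr2 -real_normK ?num_real// expr_le1//.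
have := s_mono n; rewrite -subr_ge0 => d0.
have m0 := @gauss_m2_gt0 R.
have : Ex P (fun w => xi w * xi w) * ((s n.+1 - s n) * m2) <=
    1 * ((s n.+1 - s n) * m2) by rewrite ler_wpM2r// mulr_ge0// ltW.
by nra.
Qed.

Lemma frozen_exit j e n w :
  e <= `|frozen j e n w| \/ frozen j e n w = incr j (s 0) (s n) w /\
    forall k, (k <= n)%N -> `|incr j (s 0) (s k) w| < e.
Proof.
elim: n => [|n [IH|[IH IHk]]] /=.
- have [|lt] := leP e `|0 : R|; first by left.
  right; split; first by rewrite incrxx.
  by move=> k; rewrite leqn0 => /eqP ->; rewrite incrxx.
- left; rewrite indicE memNset ?mul0r ?addr0//= in_itv/= => /andP[h1 h2].
  by move: IH; rewrite leNgt ltr_norml h1 h2.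
- have ltn : `|incr j (s 0) (s n) w| < e by exact: IHk.
  have -> : frozen j e n w + \1_`]- e, e[ (frozen j e n w) * incr j (s n) (s n.+1) w
      = incr j (s 0) (s n.+1) w.
    rewrite IH indicE mem_set ?mul1r -?incrD//=.
    by rewrite in_itv/= -ltr_norml.
  have [|lt] := leP e `|incr j (s 0) (s n.+1) w|; first by left.
  right; split => // k; rewrite leq_eqVlt => /predU1P[->//|].
  by rewrite ltnS; exact: IHk.
Qed.

Definition exit_event (j : 'I_m) (e : R) (n : nat) : set Omega :=
  \bigcup_(k in [set k | (k <= n)%N]) [set w | (e <= `|incr j (s 0) (s k) w|)%R].

Lemma measurable_exit_event j e n : s n < T -> measurable (exit_event j e n).
Proof.
move=> sT; apply: bigcup_measurable => k /= kn.
apply: measurable_norm_ge; apply: incr_measurable => //.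
  exact: s_homo.
exact: le_lt_trans (s_homo kn) sT.
Qed.

Lemma kolmogorov_inequality j e n : 0 < e -> s n < T ->
  (P (exit_event j e n) <= (m2 * (s n - s 0) / e ^+ 2)%:E)%E.
Proof.
move=> e0 sT; have [mZ Z2 EZ] := frozen_L2 j e sT.
apply: (@le_trans _ _ (P [set w | (e <= `|frozen j e n w|)%R])).
  apply: le_measure; rewrite ?inE.
  - exact: measurable_exit_event.
  - by apply: measurable_norm_ge; have [] := Z2.
  - move=> w [k /= kn ek]; have [//|[_ /(_ k kn)]] := frozen_exit j e n w.
    by rewrite ltNge ek.
apply: le_trans (Ex_chebyshev Z2 e0) _.
by rewrite lee_fin ler_pM2r// invr_gt0 exprn_gt0.
Qed.

End grid.

(** * Oscillation of the Wiener process near T *)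

Definition dyadic (u : R) n (k : nat) : R := u + (T - u) * (k%:R / 2 ^+ n).

Lemma dyadic_lt u n k : u < T -> (k < 2 ^ n)%N -> dyadic u n k < T.
Proof.
move=> uT kn; rewrite /dyadic -ltrBrDl -[ltRHS]mulr1 ltr_pM2l ?subr_gt0//.
by rewrite ltr_pdivrMr ?exprn_gt0// mul1r -natrX ltr_nat.
Qed.

Lemma dyadic_mono u n k : u < T -> dyadic u n k <= dyadic u n k.+1.
Proof.
move=> uT; have d0 : 0 <= T - u by rewrite subr_ge0 ltW.
by rewrite lerD2l ler_wpM2l// ler_wpM2r ?invr_ge0 ?exprn_ge0// ler_nat.
Qed.

Lemma dyadic0 u n : dyadic u n 0 = u.
Proof. by rewrite /dyadic mul0r mulr0 addr0. Qed.

(** The index stops at 2^n - 1 because the dyadic point of index 2^n is T, where B is not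
    considered. *)
Definition oscillates (j : 'I_m) (u e : R) n : set Omega :=
  exit_event (dyadic u n) j e (2 ^ n).-1.

Let last_lt u n : u < T -> dyadic u n (2 ^ n).-1 < T.
Proof. by move=> uT; apply: dyadic_lt => //; rewrite prednK// expn_gt0. Qed.

Lemma measurable_oscillates j u e n : 0 <= u -> u < T ->
  measurable (oscillates j u e n).
Proof.
move=> u0 uT; apply: measurable_exit_event; rewrite ?dyadic0//.
  by move=> k; exact: dyadic_mono.
exact: last_lt.
Qed.

Lemma oscillates_homo j u e : {homo oscillates j u e : n k / (n <= k)%N >-> (n <= k)%O}.
Proof.
suff h n : oscillates j u e n `<=` oscillates j u e n.+1.
  move=> n k nk; apply/subsetPset; elim: k nk => [|k IH].
    by rewrite leqn0 => /eqP ->.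
  rewrite leq_eqVlt => /predU1P[->//|]; rewrite ltnS => /IH nk.
  exact: subset_trans nk (h k).
move=> w [k /= kn ek]; exists (2 * k)%N => /=.
  have k2 : (k < 2 ^ n)%N by rewrite (leq_ltn_trans kn)// prednK// expn_gt0.
  by rewrite -ltnS prednK ?expn_gt0// expnS ltn_pmul2l.
rewrite !dyadic0; rewrite dyadic0 in ek.
suff -> : dyadic u n.+1 (2 * k) = dyadic u n k by [].
by rewrite /dyadic natrM exprS invfM mulrACA divff// mul1r.
Qed.

(** The dyadic grids are nested, so the events increase with n, while Kolmogorov's bound is
    independent of n and passes to the union. *)
Lemma oscillates_le j u e : 0 <= u -> u < T -> 0 < e ->
  (P (\bigcup_n oscillates j u e n) <= (m2 * (T - u) / e ^+ 2)%:E)%E.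
Proof.
move=> u0 uT e0.
have mo n : measurable (oscillates j u e n) by exact: measurable_oscillates.
have cv := nondecreasing_cvg_mu (mu := P) mo (bigcup_measurable (fun n _ => mo n))
  (@oscillates_homo j u e).
rewrite -(cvg_lim _ cv)//; apply: lime_le; first by apply/cvg_ex; eexists; exact: cv.
near=> n; rewrite /= /oscillates.
have dm k : dyadic u n k <= dyadic u n k.+1 by exact: dyadic_mono.
have d0 : 0 <= dyadic u n 0 by rewrite dyadic0.
apply: le_trans (kolmogorov_inequality d0 dm j e0 (last_lt n uT)) _.
rewrite lee_fin ler_pM2r ?invr_gt0 ?exprn_gt0// ler_pM2l ?gauss_m2_gt0//.
by rewrite dyadic0 lerD2r ltW// last_lt.
Unshelve. all: by end_near. Qed.

(** The bound m2 (T - u) / e^2 vanishes as u tends to T, so for fixed e the paths that oscillate by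
    e after every u_q = T - T / (q + 1) form a null set; the levels e = 1 / (p + 1) leave countably
    many of these. Only dyadic times are controlled here, continuity of the paths supplies the
    others later. *)
Lemma wiener_cauchy j : 0 < T -> {ae P, forall w, forall e, 0 < e ->
  exists u, [/\ 0 <= u, u < T & forall n k, (k < 2 ^ n)%N ->
    `|incr j u (dyadic u n k) w| < e]}.
Proof.
move=> T0.
pose u q : R := T - T * q.+1%:R^-1.
have u0 q : 0 <= u q.
  by rewrite subr_ge0 -[leRHS]mulr1 ler_pM2l// invf_le1// ler1n.
have uT q : u q < T by rewrite ltrBlDr ltrDl mulr_gt0// invr_gt0.
pose e p : R := p.+1%:R^-1.
have e0 p : 0 < e p by rewrite invr_gt0.
pose A p q := \bigcup_n oscillates j (u q) (e p) n.
have mA p q : measurable (A p q).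
  by apply: bigcup_measurable => n _; exact: measurable_oscillates.
have A0 p : P.-negligible (\bigcap_q A p q).
  have mcap : measurable (\bigcap_q A p q) by exact: bigcap_measurable.
  apply/negligibleP => //; apply/eqP; rewrite eq_le measure_ge0 andbT.
  pose K := m2 * T / e p ^+ 2.
  have K0 : 0 <= K by rewrite !mulr_ge0 ?invr_ge0 ?exprn_ge0 ?ltW// gauss_m2_gt0.
  apply/lee_addgt0Pr => d d0; rewrite add0e.
  have [q Kq] : exists q, K * q.+1%:R^-1 <= d.
    exists (Num.truncn (K / d)); rewrite ler_pdivrMr// mulrC -ler_pdivrMr//.
    by have /andP[_ /ltW] := truncn_itv (divr_ge0 K0 (ltW d0)).
  apply: (@le_trans _ _ (P (A p q))).
    by apply: le_measure; rewrite ?inE// => w; exact.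
  apply: le_trans (oscillates_le j (u0 q) (uT q) (e0 p)) _.
  rewrite lee_fin (le_trans _ Kq)// /K /u opprB addrC subrK.
  by rewrite mulrA mulrAC.
have N := negligible_bigcup A0; apply: negligibleS N => w /= /existsNP[d /not_implyP[d0 nw]].
exists (Num.truncn d^-1) => //= q _; apply: contrapT => nA; apply: nw.
exists (u q); split => // n k kn.
rewrite ltNge; apply/negP => dk; apply: nA; exists n => //; exists k => /=.
  by rewrite -ltnS prednK// expn_gt0.
rewrite dyadic0 (le_trans _ dk)// /e invf_ple ?posrE//.
have dV : 0 <= d^-1 by rewrite invr_ge0 ltW.
by have /andP[_ /ltW] := truncn_itv dV.
Qed.

End wiener_increments.

(** * Ito isometry *)

Section ito_isometry.
Context {R : realType} {disp : measure_display} {Omega : measurableType disp}.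
Variables (P : probability Omega R) (m : nat) (T : R).
Variables (F : R -> set (set Omega)) (B : R -> Omega -> 'cV[R]_m).
Hypothesis W : is_wiener_process P T F B.
Local Notation m2 := (@gauss_m2 R).
Local Notation mu := (@lebesgue_measure R).
Local Notation incr := (incr B).

Lemma overlap_measure (t a b a' b' : R) : 0 <= a -> b <= t ->
  mu (`]a, b] `&` `]a', b'] `&` `[0, t]) = (overlap a b a' b')%:E.
Proof.
move=> a0 bt.
have -> : `]a, b]%classic `&` `]a', b'] `&` `[0, t] =
    `]Num.max a a', Num.min b b']%classic :> set R.
  apply/seteqP; split => x /=; rewrite !in_itv/=.
    by move=> [[/andP[h1 h2] /andP[h3 h4]] _]; rewrite gt_max le_min h1 h2 h3 h4.
  rewrite gt_max le_min => /andP[/andP[h1 h2] /andP[h3 h4]]; rewrite h1 h2 h3 h4.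
  by rewrite (le_trans a0 (ltW h1)) (le_trans h3 bt).
rewrite lebesgue_measure_itv/= lte_fin /overlap; case: ltP => h.
  by rewrite -EFinB; congr EFin; apply/esym/max_idPr; rewrite subr_ge0 ltW.
by congr EFin; apply/esym/max_idPl; rewrite subr_le0.
Qed.

Section family.
Variables (I : finType) (a b : I -> R) (jj : I -> 'I_m) (t : R).
Hypothesis tT : t < T.
Hypothesis ab : forall q, [/\ 0 <= a q, a q <= b q & b q <= t].

Let a0 q : 0 <= a q. Proof. by have [] := ab q. Qed.
Let aleb q : a q <= b q. Proof. by have [] := ab q. Qed.
Let bt q : b q <= t. Proof. by have [] := ab q. Qed.
Let bT q : b q < T. Proof. exact: le_lt_trans (bt q) tT. Qed.

(** The squared L^2(ds) norm of an integrand made of finitely many terms, where term q has value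
    [c q] on ]a_q, b_q] in the coordinate [jj q]. The intervals may overlap. *)
Definition energy (c : I -> R) : R :=
  \sum_q \sum_r c q * c r * (jj q == jj r)%:R * overlap (a q) (b q) (a r) (b r).

Lemma energyE (c : I -> R) :
  (\int[mu]_(s in `[0%R, t])
    (\sum_j (\sum_q (jj q == j)%:R * (\1_`]a q, b q] s * c q)) ^+ 2)%:E)%E =
  (energy c)%:E.
Proof.
transitivity (\int[mu]_(s in `[0%R, t]) (\sum_(p : I * I)
   (c p.1 * c p.2 * (jj p.1 == jj p.2)%:R)%:E *
   (\1_(`]a p.1, b p.1] `&` `]a p.2, b p.2]) s)%:E))%E.
  apply: eq_integral => s _.
  under [RHS]eq_bigr do rewrite -EFinM.
  rewrite sumEFin; congr EFin.
  rewrite -(pair_bigA _ (fun q r => c q * c r * (jj q == jj r)%:R *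
     \1_(`]a q, b q] `&` `]a r, b r]) s))/=.
  under eq_bigr => j _ do rewrite expr2 mulr_suml.
  rewrite exchange_big/=; apply: eq_bigr => q _.
  under eq_bigr => j _ do rewrite mulr_sumr.
  rewrite exchange_big/=; apply: eq_bigr => r _.
  rewrite (bigD1 (jj q))//= eqxx big1 ?addr0; last first.
    by move=> j jq; rewrite eq_sym (negbTE jq) !mul0r.
  by rewrite indicI/= [jj r == _]eq_sym; ring.
have mI p : measurable (`]a p.1, b p.1] `&` `]a p.2, b p.2] : set R).
  exact: measurableI.
have iE p : (\int[mu]_(s in `[0%R, t]) (\1_(`]a p.1, b p.1] `&` `]a p.2, b p.2]) s)%:E =
    (overlap (a p.1) (b p.1) (a p.2) (b p.2))%:E)%E.
  rewrite integral_indic//; last exact: mI.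
  exact: overlap_measure (a0 _) (bt _).
have iI p : mu.-integrable `[0, t] (fun s =>
    (\1_(`]a p.1, b p.1] `&` `]a p.2, b p.2]) s)%:E).
  have mind : measurable_fun [set: R] (\1_(`]a p.1, b p.1] `&` `]a p.2, b p.2]) : R -> R).
    exact: measurable_indic (mI p).
  apply/integrableP; split.
    by apply/measurable_EFinP; apply: measurable_funTS; exact: mind.
  under eq_integral do rewrite gee0_abs ?lee_fin//.
  by have := ltry (overlap (a p.1) (b p.1) (a p.2) (b p.2)); rewrite -iE.
rewrite integral_sum//; last by move=> p; exact: integrableZl.
under eq_bigr => p _.
  rewrite integralZl// iE -EFinM; over.
by rewrite sumEFin /energy pair_bigA.
Qed.

Variable xi : I -> Omega -> R.
Hypothesis mxi : forall q, measurable_wrt (F (a q)) (xi q).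
Hypothesis bxi : forall q, exists C, forall w, `|xi q w| <= C.

Let Mxi q : measurable_fun [set: Omega] (xi q).
Proof.
apply: (filtration_measurable W (a0 q) _ (mxi q)).
exact: le_lt_trans (aleb q) (bT q).
Qed.

Let xi2 q : L2 P (xi q).
Proof. by have [C xiC] := bxi q; exact: bounded_L2 xiC. Qed.

Lemma term_L2 q : L2 P (fun w => xi q w * incr (jj q) (a q) (b q) w).
Proof.
have [C xiC] := bxi q; apply: L2_boundedM xiC _ => //.
by apply: (incr_L2 W).
Qed.

Lemma Ex_family :
  L1 P (fun w => energy (xi^~ w)) /\
  Ex P (fun w => (\sum_q xi q w * incr (jj q) (a q) (b q) w) ^+ 2) =
  m2 * Ex P (fun w => energy (xi^~ w)).
Proof.
have sqE : (fun w => (\sum_q xi q w * incr (jj q) (a q) (b q) w) ^+ 2) =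
    fun w => \sum_q \sum_r (xi q w * incr (jj q) (a q) (b q) w) *
                           (xi r w * incr (jj r) (a r) (b r) w).
  apply/funext => w; rewrite expr2 mulr_suml; apply: eq_bigr => q _.
  by rewrite mulr_sumr.
have enE : (fun w => energy (xi^~ w)) = fun w => \sum_q \sum_r
    ((jj q == jj r)%:R * overlap (a q) (b q) (a r) (b r)) * (xi q w * xi r w).
  by apply/funext => w; apply: eq_bigr => q _; apply: eq_bigr => r _; ring.
rewrite sqE enE.
have i1 q r : L1 P (fun w => ((jj q == jj r)%:R * overlap (a q) (b q) (a r) (b r)) *
    (xi q w * xi r w)) by apply: L1Z; exact: L2_L2M.
have i2 q r : L1 P (fun w => (xi q w * incr (jj q) (a q) (b q) w) *
    (xi r w * incr (jj r) (a r) (b r) w)) by apply: L2_L2M; exact: term_L2.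
split; first by apply: L1_sum => q; exact: L1_sum.
rewrite !Ex_sum; do ?by [move=> q; exact: L1_sum].
rewrite mulr_sumr; apply: eq_bigr => q _.
rewrite !Ex_sum// mulr_sumr; apply: eq_bigr => r _.
rewrite ExZ; last exact: L2_L2M.
rewrite (Ex_incr_bilinear W (jj q) (jj r) (a0 q) (aleb q) (bT q) (a0 r) (aleb r) (bT r))//.
by ring.
Qed.

Lemma isometry_family :
  (\int[P]_w ((\sum_q xi q w * incr (jj q) (a q) (b q) w) ^+ 2)%:E =
   m2%:E * \int[P]_w \int[mu]_(s in `[0%R, t])
    (\sum_j (\sum_q (jj q == j)%:R * (\1_`]a q, b q] s * xi q w)) ^+ 2)%:E)%E.
Proof.
have [ie EE] := Ex_family.
under [in RHS]eq_integral do rewrite energyE.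
rewrite (EFin_Ex ie) -EFinM -EE EFin_Ex//.
by have [] : L2 P (fun w => \sum_q xi q w * incr (jj q) (a q) (b q) w)
  by apply: L2_sum => q; exact: term_L2.
Qed.

End family.

Variable d : nat.
Implicit Types S D : @step_process R disp Omega d m.

Lemma step_integralE S w i : step_integral B S w i ord0 =
  \sum_(k < len S) \sum_j xi S k w i j * incr j (tau S k) (tau S k.+1) w.
Proof. by rewrite summxE; apply: eq_bigr => k _; rewrite mxE. Qed.

Lemma step_funE S s w i j : step_fun S s w i j =
  \sum_(k < len S) \1_`]tau S k, tau S k.+1] s * xi S k w i j.
Proof. by rewrite summxE; apply: eq_bigr => k _; rewrite !mxE. Qed.

Lemma simple_tau t S : is_simple_process F t S -> forall k, (k < len S)%N ->
  [/\ 0 <= tau S k, tau S k <= tau S k.+1 & tau S k.+1 <= t].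
Proof.
move=> [t0 tlen mono _] k kl.
have le k1 k2 : (k1 <= k2 <= len S)%N -> tau S k1 <= tau S k2.
  elim: k2 => [|k2 IH] /andP[h1 h2]; first by move: h1; rewrite leqn0 => /eqP ->.
  move: h1; rewrite leq_eqVlt => /predU1P[->//|]; rewrite ltnS => h1.
  by apply: le_trans (mono _ h2); apply: IH; rewrite h1 ltnW.
split; last by apply: le_trans tlen; apply: le; rewrite kl leqnn.
  by apply: le_trans t0 _; apply: le; rewrite /= ltnW.
exact: mono.
Qed.

Lemma simple_measurable t S : t < T -> is_simple_process F t S ->
  forall k, (k < len S)%N -> forall i j, measurable_fun [set: Omega] (fun w => xi S k w i j).
Proof.
move=> tT St k kl i j; have [h1 h2 h3] := simple_tau St kl.
have [_ _ _ h] := St; have [mx _] := h _ kl i j.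
apply: (filtration_measurable W h1 _ mx).
exact: le_lt_trans (le_trans h2 h3) tT.
Qed.

Lemma step_integral_L2 t S i : t < T -> is_simple_process F t S ->
  L2 P (fun w => step_integral B S w i ord0).
Proof.
move=> tT St; under eq_fun do rewrite step_integralE.
apply: L2_sum => k; apply: L2_sum => j.
have [h1 h2 h3] := simple_tau St (ltn_ord k).
have [_ _ _ h] := St; have [mx [C xC]] := h _ (ltn_ord k) i j.
apply: L2_boundedM xC _; first exact: simple_measurable tT St _ (ltn_ord k) i j.
by apply: (incr_L2 W) => //; exact: le_lt_trans tT.
Qed.

(** The terms of [S], and those of [D] with the opposite sign, form one finite family indexed by a
    disjoint sum. As overlapping intervals are allowed there, the two partitions are never
    refined. *)
Lemma step_isometry t S D i : t < T ->
  is_simple_process F t S -> is_simple_process F t D ->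
  (\int[P]_w ((step_integral B S w i ord0 - step_integral B D w i ord0) ^+ 2)%:E =
   m2%:E * \int[P]_w \int[mu]_(s in `[0%R, t])
     (\sum_j (step_fun S s w i j - step_fun D s w i j) ^+ 2)%:E)%E.
Proof.
move=> tT St Dt.
pose I := ((('I_(len S) + 'I_(len D)) * 'I_m)%type : finType).
pose a (q : I) := match q.1 with inl k => tau S k | inr k => tau D k end.
pose b (q : I) := match q.1 with inl k => tau S k.+1 | inr k => tau D k.+1 end.
pose x (q : I) w := match q.1 with inl k => xi S k w i q.2 | inr k => - xi D k w i q.2 end.
have ab q : [/\ 0 <= a q, a q <= b q & b q <= t].
  by case: q => -[k|k] j; rewrite /a /b/=; [exact: simple_tau St _ _|exact: simple_tau Dt _ _].
have mx q : measurable_wrt (F (a q)) (x q).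
  case: q => -[k|k] j; rewrite /a /x/=.
    by have [_ _ _ h] := St; have [] := h _ (ltn_ord k) i j.
  have [_ _ _ h] := Dt; have [mxk _] := h _ (ltn_ord k) i j.
  have [h1 h2 h3] := simple_tau Dt (ltn_ord k).
  have mopp : measurable_fun [set: R] (fun y : R => - y) by exact: measurable_funN.
  have [[sF _ _] _] := W.
  have sFk : sigma_algebra setT (F (tau D k)).
    by apply: sF; rewrite h1 (le_lt_trans (le_trans h2 h3)).
  exact: (measurable_wrt_comp sFk (h := fun y : R => - y) mopp mxk).
have bx q : exists C, forall w, `|x q w| <= C.
  case: q => -[k|k] j; rewrite /x/=.
    by have [_ _ _ h] := St; have [] := h _ (ltn_ord k) i j.
  have [_ _ _ h] := Dt; have [_ [C xC]] := h _ (ltn_ord k) i j.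
  by exists C => w; rewrite normrN.
have := isometry_family (fun q : I => q.2) tT ab mx bx.
have sumI (G : I -> R) : \sum_q G q =
    \sum_(k < len S) \sum_j G (inl k, j) + \sum_(k < len D) \sum_j G (inr k, j).
  transitivity (\sum_k \sum_j G (k, j)); last by rewrite big_sumType.
  by rewrite pair_bigA/=; apply: eq_bigr => -[].
have -> : (fun w => ((\sum_q x q w * incr q.2 (a q) (b q) w) ^+ 2)%:E) =
    fun w => ((step_integral B S w i ord0 - step_integral B D w i ord0) ^+ 2)%:E.
  apply/funext => w; rewrite sumI !step_integralE /x /a /b/=; congr (_ ^+ 2)%:E.
  congr (_ + _); rewrite -sumrN; apply: eq_bigr => k _; rewrite -sumrN.
  by apply: eq_bigr => j _; rewrite mulNr.
move=> ->; congr (_ * _)%E; apply: eq_integral => w _; apply: eq_integral => s _.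
congr EFin; apply: eq_bigr => j _; congr (_ ^+ 2).
rewrite sumI !step_funE; congr (_ + _).
  apply: eq_bigr => k _; rewrite (bigD1 j)//= eqxx mul1r big1 ?addr0//.
  by move=> j' /negbTE ->; rewrite mul0r.
rewrite -sumrN; apply: eq_bigr => k _; rewrite (bigD1 j)//= eqxx mul1r big1 ?addr0.
  by rewrite /a /b /x/= mulrN.
by move=> j' /negbTE ->; rewrite mul0r.
Qed.

(** * Iterated integrals and the distance to an Ito integral *)

Definition dint (t : R) (K : R -> Omega -> R) : \bar R :=
  (\int[P]_w \int[mu]_(s in `[0%R, t]) (K s w)%:E)%E.

Definition joint_measurable (t : R) (K : R -> Omega -> R) : Prop :=
  measurable_fun (`[0, t]%classic `*` [set: Omega]) (fun p : R * Omega => K p.1 p.2).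

Let mDom t : measurable (`[0, t]%classic `*` [set: Omega] : set (R * Omega)).
Proof. exact: measurableX. Qed.

(** Tonelli's theorem is applied on the whole product space, to the extension of the integrand by 0
    outside [0, t]. *)
Lemma measurable_inner t K : (forall s w, 0 <= K s w) -> joint_measurable t K ->
  measurable_fun [set: Omega] (fun w => \int[mu]_(s in `[0%R, t]) (K s w)%:E)%E.
Proof.
move=> K0 mK.
pose f := ((fun p : R * Omega => (K p.1 p.2)%:E) \_ (`[0, t] `*` setT)).
have mf : measurable_fun [set: R * Omega] f.
  by apply/(measurable_restrictT _ (mDom t)); exact/measurable_EFinP.
have f0 p : (0 <= f p)%E.
  by rewrite /f patchE; case: ifP => // _; rewrite lee_fin.
have := @measurable_fun_fubini_tonelli_G _ _ (measurableTypeR R) Omega R mu f mf f0.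
congr measurable_fun; apply/funext => w; rewrite /fubini_G [RHS]integral_mkcond.
apply: eq_integral => s _; rewrite /f !patchE.
by congr (if _ then _ else _); rewrite in_setX in_setT andbT.
Qed.

Lemma measurable_section t K w : joint_measurable t K ->
  measurable_fun (`[0, t]%classic : set R) (fun s => K s w).
Proof.
move=> mK; apply: (measurable_comp (mDom t) _ mK (g := fun s : R => (s, w))).
  by move=> _ [s st <-].
by apply: measurable_funTS; exact: measurable_fun_pair.
Qed.

Lemma dint_le t K K1 K2 : (forall s w, 0 <= K s w) ->
  (forall s w, 0 <= K1 s w) -> (forall s w, 0 <= K2 s w) ->
  joint_measurable t K -> joint_measurable t K1 -> joint_measurable t K2 ->
  (forall s w, K s w <= 2 * (K1 s w + K2 s w)) ->
  (dint t K <= 2%:E * (dint t K1 + dint t K2))%E.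
Proof.
move=> K0 K10 K20 mK mK1 mK2 Kle.
have mi H := @measurable_inner t H.
have ig0 (H : R -> Omega -> R) : (forall s w, 0 <= H s w) -> forall w,
    (0 <= \int[mu]_(s in `[0%R, t]) (H s w)%:E)%E.
  by move=> H0 w; apply: integral_ge0 => s _; rewrite lee_fin.
rewrite /dint -ge0_integralD//;
  [|by move=> w _; exact: ig0|exact: mi|by move=> w _; exact: ig0|exact: mi].
rewrite -ge0_integralZl//; last 2 first.
- by apply: emeasurable_funD; exact: mi.
- by move=> w _; apply: adde_ge0; exact: ig0.
apply: ge0_le_integral => //.
- by move=> w _; exact: ig0.
- exact: mi.
- by apply: emeasurable_funM => //; apply: emeasurable_funD; exact: mi.
move=> w _.
have ms H : joint_measurable t H -> measurable_fun (`[0, t]%classic : set R)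
    (fun s => (H s w)%:E).
  by move=> mH; apply/measurable_EFinP; exact: measurable_section.
rewrite -ge0_integralD//;
  [|by move=> s _; rewrite lee_fin|exact: ms|by move=> s _; rewrite lee_fin|exact: ms].
rewrite -ge0_integralZl//; last 2 first.
- by apply: emeasurable_funD; exact: ms.
- by move=> s _; rewrite -EFinD lee_fin addr_ge0.
apply: ge0_le_integral => //.
- by move=> s _; rewrite lee_fin.
- exact: ms.
- by apply: emeasurable_funM => //; apply: emeasurable_funD; exact: ms.
by move=> s _; rewrite -EFinD -EFinM lee_fin.
Qed.

Lemma sqnorm_ge0 p q (M : 'M[R]_(p, q)) : 0 <= sqnorm M.
Proof. by apply: sumr_ge0 => i _; apply: sumr_ge0 => j _; exact: sqr_ge0. Qed.

Lemma sqnorm_row p q (M : 'M[R]_(p, q)) i : \sum_j M i j ^+ 2 <= sqnorm M.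
Proof.
rewrite /sqnorm [leRHS](bigD1 i)//= lerDl; apply: sumr_ge0 => k _.
by apply: sumr_ge0 => j _; exact: sqr_ge0.
Qed.

Lemma sqnorm_entry p (M : 'cV[R]_p) i : M i ord0 ^+ 2 <= sqnorm M.
Proof. by apply: le_trans (sqnorm_row M i); rewrite big_ord1. Qed.

Lemma sqnorm_tri p q (M N K : 'M[R]_(p, q)) :
  sqnorm (M - K) <= 2 * (sqnorm (M - N) + sqnorm (N - K)).
Proof.
rewrite /sqnorm -big_split/= mulr_sumr; apply: ler_sum => i _.
rewrite -big_split/= mulr_sumr; apply: ler_sum => j _; rewrite !mxE.
have := sqr_ge0 ((M i j - N i j) - (N i j - K i j)); nra.
Qed.

Lemma joint_measurable_sqnorm t (K : R -> Omega -> 'M[R]_(d, m)) :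
  (forall i j, joint_measurable t (fun s w => K s w i j)) ->
  joint_measurable t (fun s w => sqnorm (K s w)).
Proof.
move=> mK; rewrite /joint_measurable /sqnorm.
apply: measurable_sum => i; apply: measurable_sum => j.
by apply: measurable_funX; exact: mK.
Qed.

Lemma joint_measurable_step t S i j : t < T -> is_simple_process F t S ->
  joint_measurable t (fun s w => step_fun S s w i j).
Proof.
move=> tT St; rewrite /joint_measurable; apply: measurable_funTS.
under eq_fun do rewrite step_funE.
have mk (k : 'I_(len S)) : measurable_fun [set: R * Omega] (fun p : R * Omega =>
    \1_`]tau S k, tau S k.+1] p.1 * xi S k p.2 i j).
  apply: measurable_funM.
    by apply: measurableT_comp measurable_fst; exact: measurable_indic.
  apply: (measurableT_comp (f := fun w => xi S k w i j)) measurable_snd.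
  exact: simple_measurable tT St _ (ltn_ord k) i j.
exact: measurable_sum.
Qed.

(** The approximating simple processes of the Ito integral link the two sides: the isometry compares
    them with [D], and their own errors vanish in the limit. The factor 4 comes from using (x + y)^2
    <= 2 (x^2 + y^2) twice, for the integrals and for the integrands. *)
Lemma ito_distance t (H : R -> Omega -> 'M[R]_(d, m)) Y D i : t < T ->
  is_ito_integral P F B t H Y -> is_simple_process F t D ->
  (\int[P]_w ((Y w i ord0 - step_integral B D w i ord0) ^+ 2)%:E <=
   (4 * m2)%:E * dint t (fun s w => sqnorm (H s w - step_fun D s w)))%E.
Proof.
move=> tT [mH _ mY [S [Ss SH SY]]] Dt.
set V := dint _ _.
have V0 : (0 <= V)%E.
  apply: integral_ge0 => w _; apply: integral_ge0 => s _.
  by rewrite lee_fin sqnorm_ge0.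
have m20 := @gauss_m2_gt0 R.
pose u n := (\int[P]_w (sqnorm (step_integral B (S n) w - Y w))%:E)%E.
pose v n := dint t (fun s w => sqnorm (step_fun (S n) s w - H s w)).
have jH i' j : joint_measurable t (fun s w => H s w i' j) by exact: mH.
have jS (E : @step_process R disp Omega d m) i' j : is_simple_process F t E ->
    joint_measurable t (fun s w => step_fun E s w i' j).
  exact: (joint_measurable_step i' j tT).
have jB (K1 K2 : R -> Omega -> 'M[R]_(d, m)) :
    (forall i j, joint_measurable t (fun s w => K1 s w i j)) ->
    (forall i j, joint_measurable t (fun s w => K2 s w i j)) ->
    joint_measurable t (fun s w => sqnorm (K1 s w - K2 s w)).
  move=> h1 h2; apply: joint_measurable_sqnorm => i' j.
  have -> : (fun s w => (K1 s w - K2 s w) i' j) = fun s w => K1 s w i' j - K2 s w i' j.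
    by apply/funext => s; apply/funext => w; rewrite !mxE.
  by apply: measurable_funB; [exact: h1|exact: h2].
have step2 n : (\int[P]_w ((step_integral B (S n) w i ord0 -
    step_integral B D w i ord0) ^+ 2)%:E <= (2 * m2)%:E * (v n + V))%E.
  rewrite (step_isometry i tT (Ss n) Dt).
  rewrite [(2 * m2)%:E]EFinM [(2%:E * _)%E]muleC -muleA.
  apply: lee_wpmul2l; first by rewrite lee_fin ltW.
  pose K s w := step_fun (S n) s w - step_fun D s w.
  have jK : joint_measurable t (fun s w => sqnorm (K s w)).
    by apply: jB => i' j; exact: jS.
  have r0 s w : 0 <= \sum_j K s w i j ^+ 2.
    by apply: sumr_ge0 => j _; exact: sqr_ge0.
  have jr : joint_measurable t (fun s w => \sum_j K s w i j ^+ 2).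
    apply: measurable_sum => j; apply: measurable_funX.
    have -> : (fun p : R * Omega => K p.1 p.2 i j) =
        fun p => step_fun (S n) p.1 p.2 i j - step_fun D p.1 p.2 i j.
      by apply/funext => p; rewrite !mxE.
    by apply: measurable_funB; exact: jS.
  apply: (@le_trans _ _ (dint t (fun s w => sqnorm (K s w)))).
    have -> : (fun w => \int[mu]_(s in `[0%R, t])
         (\sum_j (step_fun (S n) s w i j - step_fun D s w i j) ^+ 2)%:E)%E =
        fun w => (\int[mu]_(s in `[0%R, t]) (\sum_j K s w i j ^+ 2)%:E)%E.
      apply/funext => w; apply: eq_integral => s _; congr EFin.
      by apply: eq_bigr => j _; rewrite !mxE.
    apply: ge0_le_integral => //.
    - by move=> w _; apply: integral_ge0 => s _; rewrite lee_fin.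
    - exact: measurable_inner r0 jr.
    - by apply: measurable_inner jK => s w; exact: sqnorm_ge0.
    move=> w _; apply: ge0_le_integral => //.
    - by move=> s _; rewrite lee_fin.
    - by apply/measurable_EFinP; exact: measurable_section jr.
    - by apply/measurable_EFinP; exact: measurable_section jK.
    by move=> s _; rewrite lee_fin sqnorm_row.
  apply: dint_le => //.
  - by move=> s w; exact: sqnorm_ge0.
  - by move=> s w; exact: sqnorm_ge0.
  - by move=> s w; exact: sqnorm_ge0.
  - by apply: jB => i' j; [exact: jS|exact: jH].
  - by apply: jB => i' j; [exact: jH|exact: jS].
  - by move=> s w; exact: sqnorm_tri.
have le_n n : (\int[P]_w ((Y w i ord0 - step_integral B D w i ord0) ^+ 2)%:E <=
    2%:E * u n + (4 * m2)%:E * (v n + V))%E.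
  have mS (E : @step_process R disp Omega d m) k : is_simple_process F t E ->
      measurable_fun [set: Omega] (fun w => step_integral B E w k ord0).
    by move=> Et; have [] := step_integral_L2 k tT Et.
  have mSY k : measurable_fun [set: Omega]
      (fun w => (step_integral B (S n) w k ord0 - Y w k ord0) ^+ 2).
    by apply: measurable_funX; apply: measurable_funB; [exact: mS|exact: mY].
  have mSD : measurable_fun [set: Omega]
      (fun w => (step_integral B (S n) w i ord0 - step_integral B D w i ord0) ^+ 2).
    by apply: measurable_funX; apply: measurable_funB; exact: mS.
  have msq : measurable_fun [set: Omega]
      (fun w => sqnorm (step_integral B (S n) w - Y w)).
    have -> : (fun w => sqnorm (step_integral B (S n) w - Y w)) = fun w =>
        \sum_k (step_integral B (S n) w k ord0 - Y w k ord0) ^+ 2.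
      by apply/funext => w; apply: eq_bigr => k _; rewrite big_ord1 !mxE.
    exact: measurable_sum.
  have -> : ((4 * m2)%:E * (v n + V) = 2%:E * ((2 * m2)%:E * (v n + V)))%E.
    by rewrite muleA -EFinM; congr (_%:E * _)%E; ring.
  apply: (@le_trans _ _ (2%:E * u n + 2%:E * \int[P]_w ((step_integral B (S n) w i ord0 -
    step_integral B D w i ord0) ^+ 2)%:E)%E); last first.
    by apply: leeD2l; apply: lee_wpmul2l => //; exact: step2.
  rewrite /u -!ge0_integralZl//; last 4 first.
  - exact/measurable_EFinP.
  - by move=> w _; rewrite lee_fin sqr_ge0.
  - exact/measurable_EFinP.
  - by move=> w _; rewrite lee_fin sqnorm_ge0.
  rewrite -ge0_integralD//; last 4 first.
  - by move=> w _; rewrite -EFinM lee_fin mulr_ge0// sqnorm_ge0.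
  - by apply: emeasurable_funM => //; exact/measurable_EFinP.
  - by move=> w _; rewrite -EFinM lee_fin mulr_ge0// sqr_ge0.
  - by apply: emeasurable_funM => //; exact/measurable_EFinP.
  apply: ge0_le_integral => //.
  - by move=> w _; rewrite lee_fin sqr_ge0.
  - apply/measurable_EFinP; apply: measurable_funX.
    by apply: measurable_funB; [exact: mY|exact: mS].
  - by apply: emeasurable_funD; apply: emeasurable_funM => //; exact/measurable_EFinP.
  move=> w _; rewrite -!EFinM -EFinD lee_fin.
  have := sqnorm_entry (step_integral B (S n) w - Y w) i; rewrite !mxE.
  set x := step_integral B (S n) w i ord0; set y := Y w i ord0.
  set z := step_integral B D w i ord0 => h.
  have := sqr_ge0 ((x - y) + (x - z)); nra.
(* For an infinite distance the bound is trivial; finiteness makes the sums below pass to the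
   limit. *)
have [Vfin|] := boolP (V \is a fin_num); last first.
  rewrite ge0_fin_numE// -leNgt leye_eq => /eqP ->.
  by rewrite gt0_muley ?leey// lte_fin mulr_gt0.
have cu : (fun n => 2%:E * u n + (4 * m2)%:E * (v n + V))%E @ \oo -->
    (2%:E * 0 + (4 * m2)%:E * (0 + V))%E.
  apply: cvgeD; first by apply: fin_num_adde_defr; rewrite mule0.
    exact: cvgeZl.
  by apply: cvgeZl => //; apply: cvgeD => //; exact: cvg_cst.
rewrite mule0 !add0e in cu.
by apply: cvge_ge cu; apply: nearW.
Qed.

End ito_isometry.

(** * Riemann sums and sample paths *)

Section paths.
Context {R : realType}.

Lemma within_continuousP (A : set R) (f : R -> R) :
  {within A, continuous f} <-> forall x, A x -> forall e, 0 < e ->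
    exists2 r, 0 < r & forall y, A y -> `|x - y| < r -> `|f x - f y| < e.
Proof.
rewrite subspace_continuousP; split => h x Ax.
  move=> e e0; have /cvgrPdist_lt /(_ e e0) := h x Ax.
  move=> /nbhs_ballP[r /= r0 xr]; exists r => // y Ay xy.
  exact: xr.
apply/cvgrPdist_lt => e e0; have [r r0 xr] := h x Ax e e0.
by apply/nbhs_ballP; exists r => //= y xy Ay; exact: xr.
Qed.

Lemma within_continuous_cVP n (A : set R) (f : R -> 'cV[R]_n) :
  {within A, continuous f} <-> forall i, {within A, continuous (fun x => f x i ord0)}.
Proof.
split => [h i|h].
  apply/within_continuousP => x Ax e e0; move/subspace_continuousP : h => h.
  have /cvg_ballP /(_ e e0) := h x Ax.
  move=> /nbhs_ballP[r /= r0 xr]; exists r => // y Ay xy.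
  by have [_ /(_ i ord0)] := xr y xy Ay.
apply/subspace_continuousP => x Ax; apply/cvg_ballP => e e0.
have : \forall y \near within A (nbhs x), forall i, `|f x i ord0 - f y i ord0| < e.
  apply: filter_forall => i; have /within_continuousP/(_ x Ax e e0)[r r0 xr] := h i.
  by apply/nbhs_ballP; exists r => //= y xy Ay; exact: xr.
by apply: filterS => y hy; split => // i j; rewrite (ord1 j); exact: hy.
Qed.

Lemma summation_by_parts (h x : nat -> R) K :
  \sum_(k < K) h k * (x k.+1 - x k) =
  h K * x K - h 0%N * x 0%N - \sum_(k < K) (h k.+1 - h k) * x k.+1.
Proof.
elim: K => [|K IH]; first by rewrite !big_ord0 subrr subr0.
by rewrite !big_ord_recr/= IH; ring.
Qed.

(* [early k] stands for s_k < u, where the weight p is at most q = p(u); the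
   proof compares the partial sums with D min(p, q) + e p. *)
Lemma abel_bound (h x p : nat -> R) (C D e q : R) (early : pred nat) K :
  0 <= C -> 0 <= D -> 0 <= e -> x K = 0 ->
  `|h 0%N| <= C * p 0%N ->
  (forall k, (k < K)%N -> `|h k.+1 - h k| <= C * (p k.+1 - p k)) ->
  (forall k, 0 <= p k) -> (forall k, (k < K)%N -> p k <= p k.+1) -> p K <= 1 ->
  (forall k, (k <= K)%N -> early k -> p k <= q) ->
  0 <= q ->
  (forall k, (k <= K)%N -> `|x k| <= D) ->
  (forall k, (k <= K)%N -> ~~ early k -> `|x k| <= e) ->
  `|\sum_(k < K) h k * (x k.+1 - x k)| <= C * (D * q + e).
Proof.
move=> C0 D0 e0 xK h0 dh p0 mp p1 pq q0 xD xe.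
rewrite summation_by_parts xK mulr0 sub0r -opprD normrN.
apply: le_trans (ler_normD _ _) _.
apply: (@le_trans _ _ (C * (p 0%N * `|x 0%N| + \sum_(k < K) (p k.+1 - p k) * `|x k.+1|))).
  rewrite mulrDr; apply: lerD.
    by rewrite normrM mulrA ler_wpM2r.
  rewrite mulr_sumr; apply: le_trans (ler_norm_sum _ _ _) _.
  by apply: ler_sum => k _; rewrite normrM mulrA ler_wpM2r// dh.
rewrite ler_wpM2l//.
suff S N : (N <= K)%N -> p 0%N * `|x 0%N| + \sum_(k < N) (p k.+1 - p k) * `|x k.+1| <=
    D * Num.min (p N) q + e * p N.
  apply: le_trans (S K (leqnn K)) _; apply: lerD.
    by rewrite ler_wpM2l// ge_min lexx orbT.
  by rewrite ler_piMr.
elim: N => [|N IH] NK.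
  rewrite big_ord0 addr0; have [s0|s0] := boolP (early 0%N).
    rewrite (min_idPl (pq _ _ s0))// -[leLHS]addr0 lerD ?mulr_ge0// mulrC.
    by rewrite ler_wpM2r// xD.
  rewrite -[leLHS]add0r lerD//; last by rewrite mulrC ler_wpM2r// xe.
  by rewrite mulr_ge0// le_min p0.
have {}IH := IH (ltnW NK); have mN := mp _ NK.
rewrite big_ord_recr/=; rewrite addrA; have [sN|sN] := boolP (early N.+1).
  have pN := pq _ NK sN; rewrite (min_idPl pN).
  rewrite (min_idPl (le_trans mN pN)) in IH.
  have h1 : (p N.+1 - p N) * `|x N.+1| <= (p N.+1 - p N) * D.
    by rewrite ler_wpM2l ?subr_ge0// xD.
  have h2 : e * p N <= e * p N.+1 by rewrite ler_wpM2l.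
  by move: IH h1 h2; lra.
have h1 : (p N.+1 - p N) * `|x N.+1| <= (p N.+1 - p N) * e.
  by rewrite ler_wpM2l ?subr_ge0// xe.
have h2 : D * Num.min (p N) q <= D * Num.min (p N.+1) q.
  by rewrite ler_wpM2l// le_min !ge_min lexx mN orbT.
by move: IH h1 h2; lra.
Qed.

End paths.

Section riemann.
Context {R : realType} {disp : measure_display} {Omega : measurableType disp}.
Variables (P : probability Omega R) (d m : nat) (T : R).
Variables (F : R -> set (set Omega)) (B : R -> Omega -> 'cV[R]_m).
Hypothesis W : is_wiener_process P T F B.
Hypothesis T_gt0 : 0 < T.
Variables (M : R -> 'M[R]_(d, m)) (lam C : R).
Hypotheses (lam_gt0 : 0 < lam) (C_ge0 : 0 <= C).
Hypothesis M_le : forall r, 0 < r <= 1 -> forall i j, `|M r i j| <= C * r `^ lam.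
Hypothesis M_incr : forall r r', 0 < r -> r <= r' -> r' <= 1 ->
  forall i j, `|M r' i j - M r i j| <= C * (r' `^ lam - r `^ lam).
Local Notation m2 := (@gauss_m2 R).
Local Notation mu := (@lebesgue_measure R).
Local Notation incr := (incr B).

(** * The kernel and its Riemann sums *)

Definition kernel (t s : R) : 'M[R]_(d, m) := M ((T - t) / (T - s)).
(** The monotone weight: nondecreasing in s with value 1 at s = t, while for fixed s it tends to 0
    as t tends to T. *)
Definition rho (t s : R) : R := ((T - t) / (T - s)) `^ lam.

Lemma ratio_itv t s : s <= t -> t < T -> 0 < (T - t) / (T - s) <= 1.
Proof.
move=> st tT; have sT := le_lt_trans st tT.
rewrite divr_gt0 ?subr_gt0//= ler_pdivrMr ?subr_gt0// mul1r.
by rewrite lerD2l lerN2.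
Qed.

Lemma ratio_mono t s s' : s <= s' -> s' <= t -> t < T ->
  (T - t) / (T - s) <= (T - t) / (T - s').
Proof.
move=> ss st tT; have sT := le_lt_trans st tT.
have sT' := le_lt_trans ss sT.
rewrite ler_pM2l ?subr_gt0// lef_pV2 ?posrE ?subr_gt0//.
by rewrite lerD2l lerN2.
Qed.

Lemma rho_ge0 t s : 0 <= rho t s. Proof. exact: powR_ge0. Qed.

Lemma rho_mono t s s' : s <= s' -> s' <= t -> t < T -> rho t s <= rho t s'.
Proof.
move=> ss st tT; have st' := le_trans ss st.
have /andP[h _] := ratio_itv st' tT; have /andP[h' _] := ratio_itv st tT.
apply: ge0_ler_powR; rewrite ?nnegrE; [exact: ltW|exact: ltW|exact: ltW|].
exact: ratio_mono.
Qed.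

Lemma rho_le1 t s : s <= t -> t < T -> rho t s <= 1.
Proof.
move=> st tT; apply: le_trans (rho_mono st (lexx t) tT) _.
by rewrite /rho divff ?powR1// gt_eqF// subr_gt0.
Qed.

Lemma kernel_le t s i j : s <= t -> t < T -> `|kernel t s i j| <= C * rho t s.
Proof. by move=> st tT; apply: M_le; exact: ratio_itv. Qed.

Lemma kernel_incr t s s' i j : s <= s' -> s' <= t -> t < T ->
  `|kernel t s' i j - kernel t s i j| <= C * (rho t s' - rho t s).
Proof.
move=> ss st tT; have st' := le_trans ss st.
have /andP[h h1] := ratio_itv st' tT; have /andP[h' h1'] := ratio_itv st tT.
by apply: M_incr => //; exact: ratio_mono.
Qed.

Definition mesh (n k : nat) : R := T * (k%:R / n.+1%:R).

Lemma mesh0 n : mesh n 0 = 0. Proof. by rewrite /mesh mul0r mulr0. Qed.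

Lemma meshS n k : mesh n k.+1 = mesh n k + T / n.+1%:R.
Proof. by rewrite /mesh -[k.+1]addn1 natrD; ring. Qed.

Lemma mesh_step_gt0 n : 0 < T / n.+1%:R. Proof. by rewrite divr_gt0. Qed.

Lemma mesh_le n k l : (k <= l)%N -> mesh n k <= mesh n l.
Proof.
by move=> kl; rewrite /mesh ler_pM2l// ler_pM2r ?invr_gt0// ler_nat.
Qed.

Lemma mesh_ge0 n k : 0 <= mesh n k. Proof. by rewrite -(mesh0 n) mesh_le. Qed.

Lemma mesh_lt n k : (k <= n)%N -> mesh n k < T.
Proof.
by move=> kn; rewrite /mesh -[ltRHS]mulr1 ltr_pM2l// ltr_pdivrMr// mul1r ltr_nat ltnS.
Qed.

Definition mesh_floor (n : nat) (t : R) : nat := Num.truncn (t / T * n.+1%:R).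

Lemma mesh_floorP n t : 0 <= t ->
  mesh n (mesh_floor n t) <= t < mesh n (mesh_floor n t).+1.
Proof.
move=> t0; have : 0 <= t / T * n.+1%:R by rewrite mulr_ge0// divr_ge0// ltW.
move=> /truncn_itv /andP[h1 h2].
rewrite /mesh mulrC -ler_pdivlMr// ler_pdivrMr// h1/=.
by rewrite mulrC -ltr_pdivrMr// ltr_pdivlMr.
Qed.

Lemma mesh_floor_le n t : 0 <= t -> t < T -> (mesh_floor n t <= n)%N.
Proof.
move=> t0 tT; have /andP[h _] := mesh_floorP n t0.
rewrite leqNgt; apply/negP => hn.
have := le_lt_trans (le_trans (mesh_le n hn) h) tT.
by rewrite /mesh divff// mulr1 ltxx.
Qed.

Lemma mesh_itv n s N : 0 < s -> s <= mesh n N ->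
  exists k, [/\ (k < N)%N, mesh n k < s & s <= mesh n k.+1].
Proof.
move=> s0; elim: N => [|N IH]; first by rewrite mesh0 leNgt s0.
have [/IH [k [kN h1 h2]] _|h1 h2] := leP s (mesh n N); last by exists N.
by exists k; split => //; exact: ltnW.
Qed.

Lemma mesh_itv_uniq n s k l : mesh n k < s -> s <= mesh n k.+1 ->
  (s \in `]mesh n l, mesh n l.+1]) = (l == k).
Proof.
move=> h1 h2; apply/idP/eqP => [|->]; last by rewrite in_itv/= h1.
rewrite in_itv/= => /andP[h3 h4]; apply/eqP; rewrite eqn_leq.
apply/andP; split; rewrite leqNgt; apply/negP => /(mesh_le n) h.
  by have := lt_le_trans h3 (le_trans h2 h); rewrite ltxx.
by have := lt_le_trans h1 (le_trans h4 h); rewrite ltxx.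
Qed.

(** The steps stop at the last mesh point not after t, so the process vanishes on the incomplete
    step that ends at t. *)
Definition riemann (n : nat) (t : R) : @step_process R disp Omega d m :=
  StepProcess (mesh_floor n t) (mesh n) (fun k _ => kernel t (mesh n k)).

Lemma riemann_simple n t : 0 <= t -> t < T -> is_simple_process F t (riemann n t).
Proof.
move=> t0 tT; have /andP[h _] := mesh_floorP n t0; split => //=.
- by rewrite mesh0.
- by move=> k _; exact: mesh_le.
move=> k kK i j; split; last by exists `|kernel t (mesh n k) i j|.
have [[sF _ _] _] := W; apply: measurable_wrt_cst; apply: sF.
by rewrite mesh_ge0 (le_lt_trans _ tT)// (le_trans _ h)// mesh_le// ltnW.
Qed.

Lemma integral_steps_le t N (a b c : nat -> R) : (forall k, a k <= b k) ->
  (forall k, 0 <= c k) ->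
  (\int[mu]_(s in `[0%R, t]) (\sum_(k < N) c k * \1_`]a k, b k] s)%:E <=
   (\sum_(k < N) c k * (b k - a k))%:E)%E.
Proof.
move=> ab c0.
have mI k : measurable_fun (`[0, t]%classic : set R)
    (fun s => (c k)%:E * (\1_`]a k, b k] s)%:E)%E.
  apply: emeasurable_funM => //; apply/measurable_EFinP; apply: measurable_funTS.
  exact: measurable_indic.
under eq_integral => s _.
  rewrite -sumEFin; under eq_bigr do rewrite EFinM; over.
rewrite ge0_integral_sum//; last 2 first.
- by move=> k; exact: mI.
- by move=> k s _; rewrite mule_ge0// lee_fin.
rewrite -sumEFin; apply: lee_sum => k _.
rewrite ge0_integralZl//; last 2 first.
- apply/measurable_EFinP; apply: measurable_funTS; exact: measurable_indic.
- by rewrite lee_fin.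
rewrite EFinM; apply: lee_wpmul2l; first by rewrite lee_fin.
rewrite integral_indic//.
apply: (@le_trans _ _ (mu `]a k, b k])).
  by apply: le_measure; rewrite ?inE//; exact: measurableI.
by rewrite lebesgue_measure_itv/= lte_fin; case: ltP => // h; rewrite lee_fin subr_ge0.
Qed.

(** As e <= 1, e^2 <= e: keeping the first power is what lets the bounds over successive steps
    telescope. *)
Lemma sqnorm_le p q (N : 'M[R]_(p, q)) (e : R) : 0 <= e <= 1 ->
  (forall i j, `|N i j| <= C * e) -> sqnorm N <= (p * q)%:R * C ^+ 2 * e.
Proof.
move=> /andP[e0 e1] Ne.
have h i j : N i j ^+ 2 <= C ^+ 2 * e.
  rewrite -[N i j ^+ 2]real_normK ?num_real//.
  apply: le_trans (_ : (C * e) ^+ 2 <= _); first by rewrite lerXn2r ?nnegrE ?mulr_ge0.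
  rewrite exprMn ler_wpM2l ?sqr_ge0//.
  by rewrite expr2 ler_piMr.
apply: le_trans (_ : \sum_(i < p) \sum_(j < q) C ^+ 2 * e <= _).
  by apply: ler_sum => i _; apply: ler_sum => j _.
by rewrite !sumr_const !card_ord -[leRHS]mulrA mulr_natl mulnC mulrnA.
Qed.

(** The 3 counts the contributions to the error bound: the auxiliary step covering s = 0, the full
    steps, and the incomplete last step. *)
Definition rate : R := 3 * T * ((d * m)%:R * C ^+ 2).

(** On a full step the squared error is at most Q times the increment of [rho t], and these
    increments sum to at most 1; on the incomplete step the kernel itself is bounded. Each
    contribution is multiplied by the mesh size. *)
Lemma riemann_dint n t : 0 <= t -> t < T ->
  (forall i j, joint_measurable t (fun s (_ : Omega) => kernel t s i j)) ->
  (dint P t (fun s w => sqnorm (kernel t s - step_fun (riemann n t) s w)) <=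
   (rate / n.+1%:R)%:E)%E.
Proof.
move=> t0 tT mk; set Q := (d * m)%:R * C ^+ 2; set K := mesh_floor n t.
have /andP[Kt tK] := mesh_floorP n t0; rewrite -/K in Kt tK.
pose r k := rho t (mesh n k).
(* The index is shifted by one: [c k.+1] is the bound on ]s_k, s_{k+1}], and its last case k = K is
   the incomplete step. *)
pose c k := if k is k'.+1 then Q * (if (k' < K)%N then r k'.+1 - r k' else 1) else Q.
pose h := T / n.+1%:R.
pose a k := mesh n k - h. (* the step k = 0 only serves to cover s = 0 *)
have Q0 : 0 <= Q by rewrite mulr_ge0// sqr_ge0.
have meshK k : (k <= K)%N -> mesh n k <= t.
  by move=> kK; apply: le_trans Kt; exact: mesh_le.
have c0 k : 0 <= c k.
  case: k => [|k] //=; apply: mulr_ge0 => //; case: ifP => // kK.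
  by rewrite subr_ge0; apply: rho_mono => //; [exact: mesh_le|exact: meshK].
have ab k : a k <= mesh n k by rewrite /a gerBl ltW// mesh_step_gt0.
have pw s w : 0 <= s <= t -> sqnorm (kernel t s - step_fun (riemann n t) s w) <=
    \sum_(k < K.+2) c k * \1_`]a k, mesh n k] s.
  move=> /andP[s0 st].
  have pos (k : 'I_K.+2) : s \in `]a k, mesh n k] ->
      c k <= \sum_(k < K.+2) c k * \1_`]a k, mesh n k] s.
    move=> sk; rewrite [leRHS](bigD1 k)//= indicE mem_set// mulr1 lerDl.
    by apply: sumr_ge0 => l _; rewrite mulr_ge0.
  move: s0; rewrite le_eqVlt => /predU1P[/esym s0|s0].
    apply: le_trans (pos ord0 _); last first.
      by rewrite s0 in_itv/= /a mesh0 sub0r oppr_lt0 mesh_step_gt0/=.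
    rewrite /= -[Q]mulr1; apply: sqnorm_le; first by rewrite ler01 lexx.
    move=> i j; rewrite !mxE step_funE big1 ?subr0; last first.
      move=> k _; rewrite indicE memNset ?mul0r//= in_itv/= => /andP[+ _].
      by rewrite s0 ltNge mesh_ge0.
    apply: le_trans (kernel_le _ _ _ _) _ => //.
    by apply: ler_wpM2l => //; exact: rho_le1.
  have [k [kK ks sk]] := mesh_itv s0 (le_trans st (ltW tK)).
  have kK' : (k.+1 < K.+2)%N by [].
  apply: le_trans (pos (Ordinal kK') _); last first.
    by rewrite in_itv/= /a meshS addrK -meshS ks.
  have stepE i j : step_fun (riemann n t) s w i j =
      if (k < K)%N then kernel t (mesh n k) i j else 0.
    rewrite step_funE/= -/K; case: ifP => hk.
      rewrite (bigD1 (Ordinal hk))//= indicE mem_set//=; last by rewrite in_itv/= ks.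
      rewrite mul1r big1 ?addr0// => l lk; rewrite indicE memNset ?mul0r//=.
      rewrite (mesh_itv_uniq l ks sk) => /eqP lk'; move/eqP: lk; apply.
      exact: val_inj.
    apply: big1 => l _; rewrite indicE memNset ?mul0r//=.
    by rewrite (mesh_itv_uniq l ks sk) => /eqP lk; rewrite -lk ltn_ord in hk.
  rewrite /=; apply: sqnorm_le.
    case: ifP => hk; last by rewrite ler01 lexx.
    rewrite subr_ge0 rho_mono//; [|exact: mesh_le|exact: meshK].
    by rewrite lerBlDr (le_trans (rho_le1 _ _))// ?meshK// lerDl rho_ge0.
  move=> i j; rewrite !mxE stepE; case: ifP => hk.
    apply: le_trans (kernel_incr i j (ltW ks) st tT) _.
    apply: ler_wpM2l => //; rewrite lerD2r; apply: rho_mono => //; exact: meshK.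
  rewrite subr0; apply: le_trans (kernel_le _ _ st tT) _.
  by apply: ler_wpM2l => //; exact: rho_le1.
have mf : joint_measurable t (fun s w => sqnorm (kernel t s - step_fun (riemann n t) s w)).
  apply: joint_measurable_sqnorm => i j.
  have -> : (fun s w => (kernel t s - step_fun (riemann n t) s w) i j) =
      fun s w => kernel t s i j - step_fun (riemann n t) s w i j.
    by apply/funext => s; apply/funext => w; rewrite !mxE.
  apply: measurable_funB; first exact: mk.
  exact: (joint_measurable_step W i j tT (riemann_simple n t0 tT)).
(* The integrand does not depend on w, so the outer integral is a multiplication by the total mass
   1. *)
have -> : dint P t (fun s w => sqnorm (kernel t s - step_fun (riemann n t) s w)) =
    (\int[mu]_(s in `[0%R, t])
      (sqnorm (kernel t s - step_fun (riemann n t) s (point : Omega)))%:E)%E.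
  rewrite -[RHS]mule1 -(probability_setT P) -integral_cst//.
apply: (@le_trans _ _ (\int[mu]_(s in `[0%R, t])
    (\sum_(k < K.+2) c k * \1_`]a k, mesh n k] s)%:E)%E).
  apply: ge0_le_integral => //.
  - by move=> s _; rewrite lee_fin sqnorm_ge0.
  - by apply/measurable_EFinP; exact: measurable_section mf.
  - apply/measurable_EFinP; apply: measurable_sum => k.
    apply: measurable_funM => //; apply: measurable_funTS; exact: measurable_indic.
  by move=> s /=; rewrite in_itv/= => st; rewrite lee_fin; exact: pw.
apply: le_trans (integral_steps_le _ _ ab c0) _; rewrite lee_fin.
have -> : \sum_(k < K.+2) c k * (mesh n k - a k) = (\sum_(k < K.+2) c k) * h.
  by rewrite mulr_suml; apply: eq_bigr => k _; rewrite /a opprB addrC subrK.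
rewrite big_ord_recl big_ord_recr/= ltnn mulr1.
have -> : \sum_(k < K) Q * (if (k < K)%N then r k.+1 - r k else 1) = Q * (r K - r 0%N).
  rewrite -mulr_sumr -(telescope_sumr r (leq0n K)) big_mkord.
  by congr (_ * _); apply: eq_bigr => k _; rewrite ltn_ord.
have -> : rate / n.+1%:R = 3 * Q * h by rewrite /rate /h -/Q; ring.
rewrite ler_pM2r ?mesh_step_gt0//.
have : Q * (r K - r 0%N) <= Q.
  rewrite -[leRHS]mulr1 ler_wpM2l// lerBlDr (le_trans (rho_le1 _ _))// ?meshK//.
  by rewrite lerDl rho_ge0.
by lra.
Qed.

(** * Mean-square approximation at rate 1/n *)

Definition L2_rate (Z : Omega -> R) (V : nat -> Omega -> R) : Prop :=
  exists c : R, forall n, L2 P (fun w => V n w - Z w) /\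
    Ex P (fun w => (V n w - Z w) ^+ 2) <= c / n.+1%:R.

Lemma L2_rate0 : L2_rate (fun=> 0) (fun _ _ => 0).
Proof.
exists 0 => n; rewrite subrr expr0n/= mul0r Ex_cst lexx; split => //.
exact: L2_cst.
Qed.

Lemma L2_rateZ a Z V : L2_rate Z V ->
  L2_rate (fun w => a * Z w) (fun n w => a * V n w).
Proof.
move=> [c h]; exists (a ^+ 2 * c) => n; have [h1 h2] := h n.
have -> : (fun w => a * V n w - a * Z w) = fun w => a * (V n w - Z w).
  by apply/funext => w; rewrite mulrBr.
split; first exact: L2Z.
have -> : (fun w => (a * V n w - a * Z w) ^+ 2) = fun w => a ^+ 2 * (V n w - Z w) ^+ 2.
  by apply/funext => w; rewrite -mulrBr exprMn.
by rewrite ExZ; [rewrite -mulrA ler_wpM2l// sqr_ge0|case: h1].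
Qed.

Lemma L2_rateD Z V Z' V' : L2_rate Z V -> L2_rate Z' V' ->
  L2_rate (fun w => Z w + Z' w) (fun n w => V n w + V' n w).
Proof.
move=> [c h] [c' h']; exists (2 * c + 2 * c') => n.
have [h1 h2] := h n; have [h1' h2'] := h' n.
have E w : V n w + V' n w - (Z w + Z' w) = (V n w - Z w) + (V' n w - Z' w) by ring.
have L : L2 P (fun w => V n w + V' n w - (Z w + Z' w)).
  by under eq_fun do rewrite E; exact: L2D.
split => //.
apply: (@le_trans _ _ (Ex P (fun w => 2 * (V n w - Z w) ^+ 2 + 2 * (V' n w - Z' w) ^+ 2))).
  apply: Ex_le; [by case: L| |].
    by apply: L1D; apply: L1Z; [case: h1|case: h1'].
  move=> w; rewrite E; have := sqr_ge0 ((V n w - Z w) - (V' n w - Z' w)); nra.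
have [[_ i1] [_ i2]] := (h1, h1').
rewrite ExD; [|exact: L1Z|exact: L1Z]; rewrite !ExZ//.
have -> : (2 * c + 2 * c') / n.+1%:R = 2 * (c / n.+1%:R) + 2 * (c' / n.+1%:R) by ring.
by apply: lerD; rewrite ler_pM2l.
Qed.

Lemma L2_rate_sum (I : finType) (Z : I -> Omega -> R) (V : I -> nat -> Omega -> R) :
  (forall i, L2_rate (Z i) (V i)) ->
  L2_rate (fun w => \sum_i Z i w) (fun n w => \sum_i V i n w).
Proof.
move=> h; elim: (index_enum I) => [|i r IH].
  have -> : (fun w => \sum_(i <- [::]) Z i w) = fun=> 0.
    by apply/funext => w; rewrite big_nil.
  have -> : (fun n w => \sum_(i <- [::]) V i n w) = fun _ _ => 0.
    by apply/funext => n; apply/funext => w; rewrite big_nil.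
  exact: L2_rate0.
have -> : (fun w => \sum_(i <- i :: r) Z i w) = fun w => Z i w + \sum_(i <- r) Z i w.
  by apply/funext => w; rewrite big_cons.
have -> : (fun n w => \sum_(i <- i :: r) V i n w) =
    fun n w => V i n w + \sum_(i <- r) V i n w.
  by apply/funext => n; apply/funext => w; rewrite big_cons.
exact: L2_rateD.
Qed.

Lemma L2_rate_gaussian Z V : measurable_fun [set: Omega] Z -> L2_rate Z V ->
  (forall n, exists sg, centered_gaussian P (V n) sg) ->
  exists sg, centered_gaussian P Z sg.
Proof.
move=> mZ [c h] gV; apply: centered_gaussian_closure => // e e0.
pose n := Num.truncn (c / e); have [sg Vsg] := gV n; have [h1 h2] := h n.
exists (V n), sg; split => //; apply: le_lt_trans h2 _.
by rewrite ltr_pdivrMr// mulrC -ltr_pdivrMr// truncnS_gt.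
Qed.

(** An error of at least 1 / (p + 1) for all n at once is no more likely than for a single n, and
    that probability tends to 0. Only some good n is claimed for each e, so no summability over n is
    involved. *)
Lemma L2_rate_approx Z V : L2_rate Z V ->
  {ae P, forall w e, 0 < e -> exists n, `|V n w - Z w| < e}.
Proof.
move=> [c h].
have ae1 (p : nat) : {ae P, forall w, exists n, `|V n w - Z w| < p.+1%:R^-1}.
  pose N n := [set w | p.+1%:R^-1 <= `|V n w - Z w|].
  have mN n : measurable (N n).
    by apply: measurable_norm_ge; have [[]] := h n.
  exists (\bigcap_n N n); split.
  - exact: bigcapT_measurable.
  - apply/eqP; rewrite eq_le measure_ge0 andbT; apply/lee_addgt0Pr => e e0.
    rewrite add0e.
    pose a : R := c / p.+1%:R^-1 ^+ 2.
    pose n := Num.truncn (a / e); have [h1 h2] := h n.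
    apply: (@le_trans _ _ (P (N n))).
      by apply: le_measure; rewrite ?inE//; [exact: bigcapT_measurable|exact: bigcap_inf].
    have p0 : 0 < p.+1%:R^-1 :> R by rewrite invr_gt0.
    apply: le_trans (Ex_chebyshev h1 p0) _; rewrite lee_fin.
    apply: (@le_trans _ _ (a / n.+1%:R)).
      rewrite /a mulrAC ler_pM2r ?invr_gt0 ?exprn_gt0//.
    rewrite ler_pdivrMr// mulrC -ler_pdivrMr// ltW// truncnS_gt//.
  move=> w /= hw n _ /=; rewrite /N/= leNgt; apply/negP => hn.
  by apply: hw; exists n.
have /ae_foralln : forall p, {ae P, forall w, exists n, `|V n w - Z w| < p.+1%:R^-1} by [].
apply: filterS => w hw e e0; have [n hn] := hw (Num.truncn e^-1).
exists n; apply: lt_trans hn _.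
by rewrite -[ltRHS]invrK ltf_pV2 ?posrE ?invr_gt0// truncnS_gt.
Qed.

Variable X : R -> Omega -> 'cV[R]_d.
Hypothesis X_integral : forall t, 0 <= t < T ->
  is_ito_integral P F B t (fun s _ => kernel t s) (X t).

Lemma riemann_rate t i : 0 <= t -> t < T ->
  L2_rate (fun w => X t w i ord0)
    (fun n w => step_integral B (riemann n t) w i ord0).
Proof.
move=> t0 tT; have Xt : is_ito_integral P F B t (fun s _ => kernel t s) (X t).
  by apply: X_integral; rewrite t0.
exists (4 * m2 * rate) => n.
have Rs := riemann_simple n t0 tT.
have [mk _ mX _] := Xt.
have le := ito_distance W i tT Xt Rs.
have {}le := le_trans le (lee_wpmul2l _ (riemann_dint n t0 tT mk)).
have {le} : (\int[P]_w ((X t w i ord0 - step_integral B (riemann n t) w i ord0) ^+ 2)%:E <=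
    (4 * m2 * rate / n.+1%:R)%:E)%E.
  rewrite -[4 * m2 * rate / _]mulrA EFinM; apply: le.
  by rewrite lee_fin mulr_ge0// ltW// gauss_m2_gt0.
have [mR _] := step_integral_L2 W i tT Rs.
have -> : (fun w => ((X t w i ord0 - step_integral B (riemann n t) w i ord0) ^+ 2)%:E) =
    fun w => ((step_integral B (riemann n t) w i ord0 - X t w i ord0) ^+ 2)%:E.
  by apply/funext => w; rewrite -sqrrN opprB.
move=> le.
have L : L2 P (fun w => step_integral B (riemann n t) w i ord0 - X t w i ord0).
  apply: ge0_integral_lty_L2; first by apply: measurable_funB => //; exact: mX.
  by apply: le_lt_trans le _; rewrite ltry.
split => //; rewrite -lee_fin -EFin_Ex//; by case: L.
Qed.

(** Padding with zero coefficients puts the sums for all t on one grid, where their linear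
    combinations are again linear in the increments. *)
Lemma riemann_mesh_sum n t w i : 0 <= t -> t < T ->
  step_integral B (riemann n t) w i ord0 =
  \sum_(k < n) \sum_j (if (k < mesh_floor n t)%N then kernel t (mesh n k) i j else 0) *
     incr j (mesh n k) (mesh n k.+1) w.
Proof.
move=> t0 tT; rewrite step_integralE/= (big_ord_widen n (fun k => \sum_j
  kernel t (mesh n k) i j * incr j (mesh n k) (mesh n k.+1) w)) ?mesh_floor_le//.
rewrite big_mkcond/=; apply: eq_bigr => k _; case: ifP => // _.
by rewrite big1// => j _; rewrite mul0r.
Qed.

(** * The process on [0, T] and its finite-dimensional laws *)

Definition bridge (t : R) (w : Omega) : 'cV[R]_d := if t < T then X t w else 0.

Lemma bridge_lin_gaussian (N : nat) (t : 'I_N -> R) (c : 'I_N -> 'rV[R]_d) :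
  (forall k, `[0, T]%classic (t k)) ->
  exists sg, centered_gaussian P
    (fun w => \sum_(k < N) (c k *m bridge (t k) w) ord0 ord0) sg.
Proof.
move=> t0T; have t0 k : 0 <= t k by have := t0T k; rewrite /= in_itv/= => /andP[].
pose v k i n w := if t k < T then step_integral B (riemann n (t k)) w i ord0 else 0.
pose V n w := \sum_k \sum_i c k ord0 i * v k i n w.
have ZE : (fun w => \sum_(k < N) (c k *m bridge (t k) w) ord0 ord0) =
    fun w => \sum_k \sum_i c k ord0 i * bridge (t k) w i ord0.
  by apply/funext => w; apply: eq_bigr => k _; rewrite mxE.
rewrite ZE; apply: (@L2_rate_gaussian _ V).
- apply: measurable_sum => k; apply: measurable_sum => i.
  apply: measurable_funM => //; rewrite /bridge; have [tk|tk] := boolP (t k < T).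
    by have [|_ _ mX _] := @X_integral (t k); [rewrite t0|exact: mX].
  by under eq_fun do rewrite mxE; exact: measurable_cst.
- apply: L2_rate_sum => k; apply: L2_rate_sum => i; apply: L2_rateZ.
  rewrite /v /bridge; have [tk|tk] := boolP (t k < T); first exact: riemann_rate.
  by under eq_fun do rewrite mxE; exact: L2_rate0.
move=> n.
(* Coefficients on the common mesh: they vanish past the last full step before [t k], and altogether
   at [t k = T], where the process is zero. *)
pose g k i l j := if (t k < T) && (l < mesh_floor n (t k))%N
  then kernel (t k) (mesh n l) i j else 0.
have [sg hsg] := grid_gaussian W (mesh_ge0 n 0) (fun k => mesh_le n (leqnSn k))
  (fun l j => \sum_k \sum_i c k ord0 i * g k i l j) (mesh_lt (leqnn n)).
exists sg; move: hsg; congr (centered_gaussian _ _ _); apply/funext => w.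
have vE k i : v k i n w = \sum_(l < n) \sum_j g k i l j * incr j (mesh n l) (mesh n l.+1) w.
  rewrite /v /g; case: ifP => tk; first by rewrite riemann_mesh_sum.
  by rewrite big1// => l _; rewrite big1// => j _; rewrite mul0r.
rewrite /V; under [RHS]eq_bigr => k _ do under eq_bigr => i _ do rewrite vE mulr_sumr.
under [RHS]eq_bigr => k _ do rewrite exchange_big/=.
rewrite [RHS]exchange_big/=; apply: eq_bigr => l _.
under [RHS]eq_bigr => k _ do under eq_bigr => i _ do rewrite mulr_sumr.
under [RHS]eq_bigr => k _ do rewrite exchange_big/=.
rewrite [RHS]exchange_big/=; apply: eq_bigr => j _.
rewrite mulr_suml; apply: eq_bigr => k _; rewrite mulr_suml.
by apply: eq_bigr => i _; rewrite mulrA.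
Qed.

Lemma bridge_gaussian : gaussian_process P `[0, T] bridge.
Proof.
move=> N t c t0T; have [sg h] := bridge_lin_gaussian c t0T.
exact: centered_gaussian_is_gaussian h.
Qed.

Lemma bridge_centered : centered_process P `[0, T] bridge.
Proof.
move=> t tT i.
have [sg] := @bridge_lin_gaussian 1 (fun=> t) (fun=> delta_mx ord0 i) (fun=> tT).
have -> : (fun w => \sum_(k < 1) ((delta_mx ord0 i : 'rV[R]_d) *m bridge t w) ord0 ord0) =
    fun w => bridge t w i ord0.
  apply/funext => w; rewrite big_ord1 mxE (bigD1 i)//= big1 ?addr0.
    by rewrite mxE !eqxx mul1r.
  by move=> k /negbTE ki; rewrite mxE ki andbF mul0r.
move=> h; have [[mb ib] _] := centered_gaussian_L2 h.
have := centered_gaussian_Ex h; rewrite unlock.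
move=> E0; rewrite EFin_Ex ?E0//; exact: L2_L1 (conj mb ib).
Qed.

(** * Continuity at T *)

Lemma kernel_sum_small (b : R -> R) i j e : 0 < e ->
  (forall e', 0 < e' -> exists u, [/\ 0 <= u, u < T &
     forall s, u <= s -> s < T -> `|b s - b u| <= e']) ->
  (exists D, forall s, 0 <= s -> s < T -> `|b s| <= D) ->
  \forall t \near T^'-, forall n,
    `|\sum_(k < mesh_floor n t) kernel t (mesh n k) i j *
        (b (mesh n k.+1) - b (mesh n k))| <= e.
Proof.
move=> e0 bC [D bD].
have D0 : 0 <= D by apply: le_trans (bD 0 (lexx 0) T_gt0).
have C1 : 0 < C + 1 by rewrite ltr_wpDl.
have D1 : 0 < D + 1 by rewrite ltr_wpDl.
(* The final bound is C (2 D [eta] + 2 [ep]), and C D [eta] and C [ep] are each at most e / 4; the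
   added 1 avoids dividing by zero when C or D vanishes. *)
pose ep := e / (4 * (C + 1)); pose eta := e / (4 * (C + 1) * (D + 1)).
have ep0 : 0 < ep by rewrite divr_gt0// mulr_gt0.
have eta0 : 0 < eta by rewrite divr_gt0// !mulr_gt0.
have [u [u0 uT ub]] := bC ep ep0.
have etal0 : 0 < eta `^ lam^-1 by rewrite powR_gt0.
near=> t => n.
have tT : t < T by near: t; exact: nbhs_left_lt.
have ut : u <= t by near: t; exact: nbhs_left_ge.
have t0 : 0 <= t by exact: le_trans ut.
(* Raised to the power [lam], this yields [rho t u <= eta]. *)
have tv : T - t < (T - u) * eta `^ lam^-1.
  by near: t; apply: nbhs_left_ltBl; rewrite mulr_gt0// subr_gt0.
have qE : rho t u <= eta.
  have -> : eta = (eta `^ lam^-1) `^ lam.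
    by rewrite -powRrM mulVf ?gt_eqF// powRr1// ltW.
  have /andP[r0 _] := ratio_itv ut tT.
  apply: ge0_ler_powR; rewrite ?nnegrE; [exact: ltW|exact: ltW|exact: ltW|].
  by rewrite ler_pdivrMr ?subr_gt0// mulrC ltW.
set K := mesh_floor n t; have /andP[Kt tK] := mesh_floorP n t0; rewrite -/K in Kt tK.
have kt k : (k <= K)%N -> mesh n k <= t.
  by move=> kK; apply: le_trans Kt; exact: mesh_le.
(* Subtracting the value at the last mesh point removes the boundary term in the summation by
   parts. *)
pose x k := b (mesh n k) - b (mesh n K).
have kT k : (k <= K)%N -> mesh n k < T by move=> kK; exact: le_lt_trans (kt _ kK) tT.
have := @abel_bound R (fun k => kernel t (mesh n k) i j) x (fun k => rho t (mesh n k))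
  C (2 * D) (2 * ep) eta (fun k => mesh n k < u) K.
have -> : \sum_(k < K) kernel t (mesh n k) i j * (x k.+1 - x k) =
    \sum_(k < K) kernel t (mesh n k) i j * (b (mesh n k.+1) - b (mesh n k)).
  by apply: eq_bigr => k _; rewrite /x; congr (_ * _); ring.
move=> h; apply: le_trans (h _ _ _ _ _ _ _ _ _ _ _ _ _) _ => {h}//.
- by rewrite mulr_ge0.
- by rewrite mulr_ge0// ltW.
- by rewrite /x subrr.
- by apply: kernel_le => //; exact: kt.
- by move=> k kK; apply: kernel_incr => //; [exact: mesh_le|exact: kt].
- by move=> k; exact: rho_ge0.
- by move=> k kK; apply: rho_mono => //; [exact: mesh_le|exact: kt].
- by apply: rho_le1 => //; exact: kt.
- by move=> k kK ku; apply: le_trans qE; apply: rho_mono => //; exact: ltW.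
- exact: ltW.
- move=> k kK; apply: le_trans (ler_normB _ _) _.
  by rewrite mulr_natl mulr2n; apply: lerD; apply: bD; rewrite ?mesh_ge0// kT.
- move=> k kK; rewrite -leNgt => uk.
  have -> : x k = (b (mesh n k) - b u) - (b (mesh n K) - b u) by rewrite /x; ring.
  apply: le_trans (ler_normB _ _) _.
  rewrite mulr_natl mulr2n; apply: lerD; apply: ub; rewrite ?kT//.
  by apply: le_trans uk _; exact: mesh_le.
have h1 : C * ep <= e / 4.
  rewrite /ep mulrA ler_pdivrMr ?mulr_gt0//.
  have -> : e / 4 * (4 * (C + 1)) = C * e + e by field.
  by rewrite lerDl ltW.
have h2 : C * D * eta <= e / 4.
  rewrite /eta mulrA ler_pdivrMr ?mulr_gt0//.
  have -> : e / 4 * (4 * (C + 1) * (D + 1)) = C * D * e + (C * e + D * e + e) by field.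
  by rewrite lerDl !addr_ge0// ?mulr_ge0// ltW.
by move: h1 h2; lra.
Unshelve. all: by end_near. Qed.

(** A time s is approached from below by dyadic points, at a level n for which (T - u) / 2^n is
    below the radius given by continuity at s. *)
Lemma dyadic_dense (b : R -> R) u e : 0 <= u -> u < T ->
  {within `[0, T[, continuous b} ->
  (forall n k, (k < 2 ^ n)%N -> `|b (dyadic T u n k) - b u| < e) ->
  forall s, u <= s -> s < T -> `|b s - b u| <= e.
Proof.
move=> u0 uT /within_continuousP bc bd s us sT; rewrite leNgt; apply/negP => es.
have s0T : `[0, T[%classic s by rewrite /= in_itv/= (le_trans u0 us).
have [] := bc s s0T (`|b s - b u| - e); first by rewrite subr_gt0.
move=> r r0 br.
pose n := Num.truncn ((T - u) / r).
have Tu : 0 < T - u by rewrite subr_gt0.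
pose y := (s - u) / (T - u) * 2 ^+ n.
have y0 : 0 <= y by rewrite !mulr_ge0 ?invr_ge0 ?subr_ge0// ltW.
pose k := Num.truncn y; have /andP[k1 k2] := truncn_itv y0.
rewrite -/k in k1 k2.
have n2 : 0 < 2 ^+ n :> R by rewrite exprn_gt0.
have k2n : (k < 2 ^ n)%N.
  rewrite -(ltr_nat R) natrX; apply: le_lt_trans k1 _.
  by rewrite /y -[ltRHS]mul1r ltr_pM2r// ltr_pdivrMr// mul1r ltrD2r.
have sE : s = u + (T - u) * (y / 2 ^+ n).
  by rewrite /y; field; rewrite !gt_eqF//= .
have ds : dyadic T u n k <= s.
  by rewrite {1}sE lerD2l ler_pM2l// ler_pM2r ?invr_gt0.
have sd : s - dyadic T u n k < r.
  rewrite {1}sE /dyadic.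
  have -> : u + (T - u) * (y / 2 ^+ n) - (u + (T - u) * (k%:R / 2 ^+ n)) =
      (T - u) * (y - k%:R) / 2 ^+ n by ring.
  rewrite ltr_pdivrMr//.
  apply: (@le_lt_trans _ _ (T - u)).
    by rewrite ler_piMr ?(ltW Tu)// lerBlDl natr1 ltW.
  rewrite mulrC -ltr_pdivrMr//; apply: lt_le_trans (truncnS_gt _) _.
  by rewrite -natrX ler_nat ltn_expl.
have d0 : u <= dyadic T u n k.
  by rewrite lerDl mulr_ge0 ?(ltW Tu)// mulr_ge0// invr_ge0 ltW.
have := br (dyadic T u n k); rewrite /= in_itv/= (le_trans u0 d0) (le_lt_trans ds sT).
rewrite ger0_norm ?subr_ge0// => /(_ isT sd).
have := bd n k k2n.
have := ler_normD (b s - b (dyadic T u n k)) (b (dyadic T u n k) - b u).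
rewrite addrA subrK; lra.
Qed.

Lemma cauchy_bounded (b : R -> R) : {within `[0, T[, continuous b} ->
  (exists u, [/\ 0 <= u, u < T & forall s, u <= s -> s < T -> `|b s - b u| <= 1]) ->
  exists D, forall s, 0 <= s -> s < T -> `|b s| <= D.
Proof.
move=> /within_continuousP bc [u [u0 uT bu]].
have nc : {within `[0, u], continuous (fun s => `|b s|)}.
  apply/within_continuousP => x; rewrite /= in_itv/= => /andP[x0 xu] e e0.
  have [|r r0 br] := bc x _ e e0; first by rewrite /= in_itv/= x0 (le_lt_trans xu).
  exists r => // y; rewrite /= in_itv/= => /andP[y0 yu] xy.
  apply: le_lt_trans (ler_dist_dist _ _) _; apply: br => //.
  by rewrite /= in_itv/= y0 (le_lt_trans yu).
have [c _ bmax] := EVT_max u0 nc.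
exists (`|b c| + 1) => s s0 sT; have [su|us] := leP s u.
  by apply: le_trans (bmax s _) _; rewrite ?in_itv/= ?s0// lerDl.
have h1 := bu s (ltW us) sT; have h2 : `|b u| <= `|b c| by apply: bmax; rewrite in_itv/= u0 lexx.
have := ler_normD (b s - b u) (b u); rewrite subrK; lra.
Qed.

Lemma riemann_small w i e : 0 < e -> {within `[0, T[, continuous (B^~ w)} ->
  (forall j e', 0 < e' -> exists u, [/\ 0 <= u, u < T & forall n k, (k < 2 ^ n)%N ->
    `|incr j u (dyadic T u n k) w| < e']) ->
  \forall t \near T^'-, forall n, `|step_integral B (riemann n t) w i ord0| <= e.
Proof.
move=> e0 /within_continuous_cVP Bc Bd.
have incrE j a b : incr j a b w = B b w j ord0 - B a w j ord0 by rewrite /incr !mxE.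
have Bu j e' : 0 < e' -> exists u, [/\ 0 <= u, u < T &
    forall s, u <= s -> s < T -> `|B s w j ord0 - B u w j ord0| <= e'].
  move=> e'0; have [u [u0 uT ud]] := Bd j e' e'0; exists u; split => //.
  apply: (@dyadic_dense (fun s => B s w j ord0)) => // n k kn.
  by rewrite -incrE; exact: ud.
(* The divisor [m.+1] instead of m covers m = 0. *)
have e1 : 0 < e / m.+1%:R by rewrite divr_gt0.
have : \forall t \near T^'-, forall j n,
    `|\sum_(k < mesh_floor n t) kernel t (mesh n k) i j *
        (B (mesh n k.+1) w j ord0 - B (mesh n k) w j ord0)| <= e / m.+1%:R.
  apply: filter_forall => j.
  apply: (@kernel_sum_small (fun s => B s w j ord0)) => //; first exact: Bu.
  by apply: cauchy_bounded => //; exact: Bu.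
apply: filterS => t ht n; rewrite step_integralE/= exchange_big/=.
apply: le_trans (ler_norm_sum _ _ _) _.
apply: (@le_trans _ _ (\sum_(j < m) e / m.+1%:R)).
  apply: ler_sum => j _; under eq_bigr do rewrite incrE; exact: ht.
rewrite sumr_const card_ord -(mulr_natr _ m) mulrAC ler_pdivrMr//.
by rewrite ler_pM2l// ler_nat.
Qed.

(** Before T continuity is local. At T, a rational q has some Riemann sum within e / 4 of X_q, and
    near T this sum is itself at most e / 4; any other y is compared, by continuity of X at y, with
    a rational just below it. *)
Lemma bridge_path w : {within `[0, T[, continuous (X^~ w)} ->
  {within `[0, T[, continuous (B^~ w)} ->
  (forall j e', 0 < e' -> exists u, [/\ 0 <= u, u < T & forall n k, (k < 2 ^ n)%N ->
    `|incr j u (dyadic T u n k) w| < e']) ->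
  (forall (q : rat) i, 0 <= ratr q :> R -> ratr q < T -> forall e, 0 < e ->
    exists n, `|step_integral B (riemann n (ratr q)) w i ord0 - X (ratr q) w i ord0| < e) ->
  {within `[0, T], continuous (bridge^~ w)}.
Proof.
move=> /within_continuous_cVP Xc Bc Bd Xq; apply/within_continuous_cVP => i.
have /within_continuousP {}Xc := Xc i.
apply/within_continuousP => x; rewrite /= in_itv/= => /andP[x0].
rewrite le_eqVlt => /predU1P[->|xT] e e0; last first.
  have [|r r0 xr] := Xc x _ e e0; first by rewrite /= in_itv/= x0.
  exists (Num.min r (T - x)); first by rewrite lt_min r0 subr_gt0.
  move=> y; rewrite /= in_itv/= => /andP[y0 yT]; rewrite lt_min => /andP[h1 h2].
  have {}yT : y < T.
    by move: h2; rewrite distrC => /(le_lt_trans (ler_norm _)); rewrite ltrD2r.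
  by rewrite /bridge xT yT; apply: xr => //; rewrite /= in_itv/= y0.
have e2 : 0 < e / 2 by rewrite divr_gt0.
have e4 : 0 < e / 4 by rewrite divr_gt0.
have [r /= r0 Tr] := (nbhs_ballP _ _).1 (riemann_small i e4 Bc Bd).
have Xsmall (q : rat) : 0 <= ratr q :> R -> ratr q < T -> T - r < ratr q ->
    `|X (ratr q) w i ord0| < e / 2.
  move=> q0 qT qr; have [n hn] := Xq q i q0 qT _ e4.
  have h : `|step_integral B (riemann n (ratr q)) w i ord0| <= e / 4.
    apply: Tr => //; rewrite /ball/= ger0_norm ?subr_ge0 1?ltW//.
    by rewrite ltrBlDl -ltrBlDr.
  have := ler_normB (step_integral B (riemann n (ratr q)) w i ord0)
    (step_integral B (riemann n (ratr q)) w i ord0 - X (ratr q) w i ord0).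
  rewrite opprB addrC subrK; lra.
(* The minimum with T makes y positive, so that a nonnegative rational below y exists. *)
exists (Num.min r T); first by rewrite lt_min r0.
move=> y; rewrite /= in_itv/= => /andP[y0]; rewrite /bridge ltxx mxE sub0r normrN.
rewrite le_eqVlt => /predU1P[->|yT]; first by rewrite ltxx mxE normr0.
rewrite yT ger0_norm ?subr_ge0 1?ltW// lt_min => /andP[yr yT'].
have {}y0 : 0 < y by move: yT'; lra.
have [|r' r'0 yr'] := Xc y _ _ e2; first by rewrite /= in_itv/= ltW.
have [|q] := @rat_in_itvoo R (Num.max 0 (Num.max (T - r) (y - r'))) y.
  by rewrite !gt_max y0 gtrBl r'0 andbT/=; move: yr; lra.
rewrite in_itv/= !gt_max => /andP[/and3P[q0 qr qr'] qy].
have h1 := Xsmall q (ltW q0) (lt_trans qy yT) qr.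
have h2 : `|X y w i ord0 - X (ratr q) w i ord0| < e / 2.
  apply: yr'; first by rewrite /= in_itv/= ltW// (lt_trans qy).
  rewrite ger0_norm ?subr_ge0 1?ltW//; move: qr'; lra.
have := ler_normD (X y w i ord0 - X (ratr q) w i ord0) (X (ratr q) w i ord0).
rewrite subrK; lra.
Qed.

(** The exceptional sets of the rational times are merged into one null set by enumerating the
    rationals with [pickle_inv]. *)
Lemma bridge_continuous : {ae P, forall w, {within `[0, T[, continuous (X^~ w)}} ->
  {ae P, forall w, {within `[0, T], continuous (bridge^~ w)}}.
Proof.
move=> Xc; have [_ [_ _ _ _ Bc]] := W.
have Bd : {ae P, forall w j e', 0 < e' -> exists u, [/\ 0 <= u, u < T &
    forall n k, (k < 2 ^ n)%N -> `|incr j u (dyadic T u n k) w| < e']}.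
  by apply: filter_forall => j; exact: (wiener_cauchy W j T_gt0).
have Xq : {ae P, forall w k (q : rat), pickle_inv k = Some q -> forall i,
    0 <= ratr q :> R -> ratr q < T -> forall e, 0 < e ->
    exists n, `|step_integral B (riemann n (ratr q)) w i ord0 - X (ratr q) w i ord0| < e}.
  apply: ae_foralln => k; case: (pickle_inv k) => [q|]; last exact: aeW.
  have : {ae P, forall w i, 0 <= ratr q :> R -> ratr q < T -> forall e, 0 < e ->
    exists n, `|step_integral B (riemann n (ratr q)) w i ord0 - X (ratr q) w i ord0| < e}.
    apply: filter_forall => i.
    have [q0|q0] := boolP (0 <= ratr q :> R); last exact: aeW.
    have [qT|qT] := boolP (ratr q < T); last exact: aeW.
    by apply: filterS (L2_rate_approx (riemann_rate i q0 qT)) => w hw _ _.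
  by apply: filterS => w hw q' [<-].
apply: filter_app Xc; apply: filter_app Bc; apply: filter_app Bd.
apply: filterS Xq => w Xq Bd Bc Xc.
apply: bridge_path => // q i; exact: (Xq (pickle q) q (pickleK_inv q)).
Qed.

End riemann.

Theorem theorem3p4 (R : realType) (T : R) (d m : nat)
  (A : 'M[R]_d) (Sigma : 'M[R]_(d, m))
  (disp : measure_display) (Omega : measurableType disp)
  (P : probability Omega R)
  (B : R -> Omega -> 'cV[R]_m) (X : R -> Omega -> 'cV[R]_d)
  (T_gt0 : 0 < T)
  (B_wiener :
    is_wiener_process P T (completed_canonical_filtration P B) B)
  (Sigma_full_rank : \rank Sigma = d)
  (A_spec : ReSpec A `<=` `]0, +oo[)
  (X_integral : forall t, 0 <= t < T ->
    is_ito_integral P (completed_canonical_filtration P B) B t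
      (fun s _ => mxpow ((T - t) / (T - s)) A *m Sigma) (X t))
  (X_continuous :
    {ae P, forall w, {within `[0, T[, continuous (X^~ w)}}) :
  let Xhat := fun t w => if t < T then X t w else 0 in
  [/\ gaussian_process P `[0, T] Xhat,
      centered_process P `[0, T] Xhat
    & {ae P, forall w, {within `[0, T], continuous (Xhat^~ w)}}].
Proof.
have [lam [C [lam0 C0 M_le M_incr]]] := mxpow_bounds Sigma A_spec.
pose M r := mxpow r A *m Sigma.
move=> Xhat; split.
- exact: (bridge_gaussian B_wiener T_gt0 (M := M) lam0 C0 M_le M_incr X_integral).
- exact: (bridge_centered B_wiener T_gt0 (M := M) lam0 C0 M_le M_incr X_integral).
- exact: (bridge_continuous B_wiener T_gt0 (M := M) lam0 C0 M_le M_incr X_integral).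
Qed.
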